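(* Let $\mathcal{G}$ and $\mathcal{H}$ be weakly equivalent graphings of vertex degree bound $d$. Then $\mathcal{H}$ is hyperfinite if and only if $\mathcal{G}$ is hyperfinite.
   Context: Fix an integer $d\ge 1$. $U^r_d$ is the finite set of rooted-isomorphism classes of rooted graphs with degrees at most $d$ in which every vertex is at shortest-path distance at most $r$ from the root. A graphing $\mathcal{G}(X,E,\mu)$ of vertex degree bound $d$ consists of a standard Borel probability space $(X,\mu)$ and a symmetric Borel set $E\subset X\times X$ without diagonal elements, in which every vertex has degree at most $d$, such that every Borel bijection $T:X\to X$ satisfying $T(x)=x$ or $(x,T(x))\in E$ for every $x$ preserves $\mu$. For $r\ge 1$, $\alpha\in U^r_d$, $p(\mathcal{G},\alpha)$ is the $\mu$-measure of the set of $x\in X$ whose $r$-ball, rooted at $x$, is rooted-isomorphic to $\alpha$. Two graphings $\mathcal{G},\mathcal{H}$ are weakly equivalent if $p(\mathcal{G},\alpha)=p(\mathcal{H},\alpha)$ for all $r\ge1$ and $\alpha\in U^r_d$. A graphing $\mathcal{G}(X,E,\mu)$ is hyperfinite if for every $\epsilon>0$ there are $K>0$ and a Borel set $Z\subset X$ with $\mu(Z)<\epsilon$ such that after removing all edges incident to $Z$ all components have at most $K$ vertices. *)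

(* Defs.v *)
(* MathComp-Analysis; [R : realType] is the field of real numbers. *)
From HB Require Import structures.
From mathcomp Require Import all_boot all_order all_algebra.
From mathcomp Require Import all_classical all_reals all_analysis.

Set Implicit Arguments.
Unset Strict Implicit.
Unset Printing Implicit Defensive.

Import Order.TTheory GRing.Theory Num.Theory.
Local Open Scope classical_set_scope.

(* X is isomorphic, as a measurable space, to a complete separable metric
   space M with its Borel sigma-algebra. *)
Definition standard_Borel (R : realType) (disp : measure_display)
    (X : measurableType disp) : Prop :=
  exists (M : metricType R) (f : X -> M),
    [/\ (forall F : set_system M, ProperFilter F -> cauchy F -> exists l : M, F --> l),
        (exists D : set M, countable D /\ dense D),
        bijective f
      & @measurable disp X = preimage_set_system setT f <<s @open M >>].

Definition edge_rel (T : choiceType) (E : set (T * T)) : rel T :=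
  fun x y => (x, y) \in E.

Definition dist_le (T : Type) (e : rel T) (r : nat) (x y : T) : Prop :=
  exists p : seq T, [/\ path e x p, last x p = y & (size p <= r)%N].

Definition component (T : Type) (e : rel T) (x : T) : set T :=
  [set y | exists2 p : seq T, path e x p & last x p = y].

(* U^r_d, through representatives: such rooted graphs are finite and nonempty,
   so each isomorphism class has a representative with vertex set 'I_n. *)
Record rooted_ball (d r : nat) := RootedBall {
  rb_order : nat;
  rb_adj : rel 'I_rb_order;
  rb_root : 'I_rb_order;
  rb_sym : symmetric rb_adj;
  rb_irr : irreflexive rb_adj;
  rb_deg : forall v, (#|[set w | rb_adj v w]%SET| <= d)%N;
  rb_dist : forall v, dist_le rb_adj r rb_root v
}.
Arguments rb_adj {d r} _ _ _.

Record graphing (R : realType) (d : nat) := Graphing {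
  gr_disp : measure_display;
  gr_space : measurableType gr_disp;
  gr_mu : probability gr_space R;
  gr_edge : set (gr_space * gr_space);
  gr_standard : standard_Borel R gr_space;
  gr_meas : measurable gr_edge;
  gr_sym : forall x y, gr_edge (x, y) -> gr_edge (y, x);
  gr_irr : forall x, ~ gr_edge (x, x);
  gr_deg : forall x, ([set y | gr_edge (x, y)] #<= `I_d)%card;
  gr_preserve : forall T : gr_space -> gr_space,
    measurable_fun setT T -> bijective T ->
    (forall x, T x = x \/ gr_edge (x, T x)) ->
    forall A, measurable A -> gr_mu (T @^-1` A) = gr_mu A
}.
Arguments gr_edge {R d} _ _.

(* The r-ball around x is the subgraph induced on the vertices at distance at
   most r from x; f is a rooted isomorphism from alpha onto it. *)
Definition ball_iso (R : realType) (d r : nat) (G : graphing R d)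
    (alpha : rooted_ball d r) (x : gr_space G) : Prop :=
  exists f : 'I_(rb_order alpha) -> gr_space G,
    [/\ set_bij setT [set y | dist_le (edge_rel (gr_edge G)) r x y] f,
        f (rb_root alpha) = x
      & forall i j, rb_adj alpha i j <-> gr_edge G (f i, f j)].

Definition p_ball (R : realType) (d r : nat) (G : graphing R d)
    (alpha : rooted_ball d r) : \bar R :=
  gr_mu G [set x | ball_iso alpha x].

Definition weakly_equivalent (R : realType) (d : nat) (G H : graphing R d) :
    Prop :=
  forall (r : nat) (alpha : rooted_ball d r),
    (1 <= r)%N -> p_ball G alpha = p_ball H alpha.

Definition hyperfinite (R : realType) (d : nat) (G : graphing R d) : Prop :=
  forall eps : R, (0 < eps)%R ->
  exists (K : nat) (Z : set (gr_space G)),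
    [/\ (0 < K)%N, measurable Z, (gr_mu G Z < eps%:E)%E
      & forall x, (component
          (edge_rel (gr_edge G `\` [set e | Z e.1 \/ Z e.2])) x
          #<= `I_K)%card].

(* Main.v *)
(** Let [G] be hyperfinite, cut into components with at most [k] vertices by a
    set [Z] of small measure.  To a rooted finite set [(x, K)] attach the
    indicator that [K] is the component of [x] in [G] minus [Z]; this depends on
    [Z], but it can be projected, in the Hilbert space of functions of rooted
    finite sets, onto the functions that only depend on the isomorphism type of
    a ball around [x].  An almost optimal local approximation [w], with values
    in [0,1], is almost orthogonal to every bounded local function of [(x, K)]
    after subtracting the indicator.  With the mass transport principle this
    says that the weights [w z K / |K|] form an almost exact fractional partition
    of [G] into finite sets, of small total boundary.  Since [w] is local, weak
    equivalence transfers these two estimates to [H].  There the fractional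
    partition is rounded: sets are selected in finitely many steps, a step
    consisting of a colour, a set of colours and a threshold, and each vertex
    joins the first selected set that meets its neighbourhood.  Choosing the
    steps one at a time by averaging makes the set of vertices whose
    neighbourhood is split small.

    Measurability rests on the theorem that the projection of a Borel set with
    finite sections of bounded size is Borel, derived from Lusin's separation
    theorem; it provides finitely many Borel maps that enumerate the
    neighbours of each vertex. *)
Require Import Defs.
From HB Require Import structures.
From Stdlib Require Cantor.
From mathcomp Require Import all_boot all_order all_algebra.
From mathcomp Require Import all_classical all_reals all_analysis.
From mathcomp Require Import finmap measurable_realfun zify ring lra.

Set Implicit Arguments.
Unset Strict Implicit.
Unset Printing Implicit Defensive.

Import Order.TTheory GRing.Theory Num.Theory.
Import numFieldNormedType.Exports.
Local Open Scope classical_set_scope.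

(** * Borel sets of the Cantor space and projections *)

(** The cutting set of [G] has no counterpart in [H], because weak equivalence only compares the
    laws of balls. What survives replacing the component indicators by local weights [w] is their
    pairing with local functions, and two such tests suffice. Coverage is linear in the weights and
    equals 1 for the component indicators, so testing the residual against the local function that
    spreads [coverage w - 1] back over the rooted sets gives, by mass transport, exactly the mean of
    [(coverage w - 1) ^ 2]. Testing against boundary shares compares the boundary of [w] with that
    of the components. An almost minimal [w] is enough: no limit is taken and [w] keeps a finite
    radius. It is defined on all graphings at once, which gives it a meaning in [H]. There, a
    truncated Borel colouring ensures that a step selects at most one set near a typical vertex, and
    averaging over the finitely many steps replaces auxiliary randomness. *)

Definition cyl : set (set (nat -> bool)) :=
  range (fun n => [set b : nat -> bool | b n]).

Definition bor (B : set (nat -> bool)) := <<s cyl >> B.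

Lemma bor_sigma : sigma_algebra setT bor.
Proof. exact: smallest_sigma_algebra. Qed.

Lemma bor0 : bor set0.
Proof. by have [] := bor_sigma. Qed.

Lemma borC B : bor B -> bor (~` B).
Proof. by have [_ h _] := bor_sigma; move=> /h; rewrite setTD. Qed.

Lemma borT : bor setT.
Proof. by rewrite -setC0; exact: (borC bor0). Qed.

Lemma bor_bigcup (I : countType) (F : I -> set (nat -> bool)) :
  (forall i, bor (F i)) -> bor (\bigcup_i F i).
Proof.
move=> hF; have [_ _ h] := bor_sigma.
have -> : \bigcup_i F i = \bigcup_n (if @choice.unpickle I n is Some i then F i else set0).
  apply/seteqP; split=> x [].
    by move=> i _ Fi; exists (choice.pickle i) => //; rewrite choice.pickleK.
  by move=> n _; case: choice.unpickle => // i Fi; exists i.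
by apply: h => n; case: choice.unpickle => // ; exact: bor0.
Qed.

Lemma bor_bigcap (I : countType) (F : I -> set (nat -> bool)) :
  (forall i, bor (F i)) -> bor (\bigcap_i F i).
Proof.
move=> hF; rewrite -[X in bor X]setCK setC_bigcap.
by apply: borC; apply: bor_bigcup => i; apply: borC.
Qed.

Lemma borI A B : bor A -> bor B -> bor (A `&` B).
Proof.
move=> hA hB; have -> : A `&` B = \bigcap_(b : bool) (if b then A else B).
  apply/seteqP; split=> x; first by move=> [Ax Bx] [].
  by move=> h; split; [exact: (h true)|exact: (h false)].
by apply: bor_bigcap => -[].
Qed.

Lemma borU A B : bor A -> bor B -> bor (A `|` B).
Proof.
by move=> hA hB; rewrite -[X in bor X]setCK setCU; apply: borC; apply: borI; exact: borC.
Qed.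

Lemma borD A B : bor A -> bor B -> bor (A `\` B).
Proof. by move=> hA hB; rewrite setDE; apply: borI => //; apply: borC. Qed.

Lemma bor_cyl n c : bor [set b | b n = c].
Proof.
have h : bor [set b : nat -> bool | b n] by apply: sub_sigma_algebra; exists n.
case: c => //; rewrite (_ : mkset _ = ~` [set b : nat -> bool | b n]).
  exact: borC.
by apply/seteqP; split=> b /=; [move=> ->|move/negP/negbTE].
Qed.

Lemma bor_prop (P : Prop) : bor [set _ | P].
Proof.
have [p|np] := pselect P.
  suff -> : [set _ : nat -> bool | P] = setT by exact: borT.
  by apply/seteqP; split.
suff -> : [set _ : nat -> bool | P] = set0 by exact: bor0.
by apply/seteqP; split.
Qed.

(* Closedness in the product topology of (nat -> bool) * (nat -> nat), phrased
   with approximation by prefixes. *)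
Definition closed2 (P : (nat -> bool) -> (nat -> nat) -> Prop) :=
  forall x z, (forall n, exists x' z',
    [/\ P x' z', forall i, i < n -> x' i = x i & forall i, i < n -> z' i = z i]%N) ->
  P x z.

Definition projection (P : (nat -> bool) -> (nat -> nat) -> Prop) :=
  [set x | exists z, P x z].

(* Every Borel set has this form, which reduces Lusin-Souslin to closed sets. *)
Definition inj_closed_proj B := exists P, [/\ closed2 P, B = projection P
  & forall x z z', P x z -> P x z' -> z = z'].

Lemma inj_closed_proj_cyl n c : inj_closed_proj [set b | b n = c].
Proof.
exists (fun b z => b n = c /\ z = fun=> 0%N); split.
- move=> x z h; split.
    by have [x' [z' [[<- _] e _]]] := h n.+1; rewrite e.
  apply/funext => i; have [x' [z' [[_ ->] _ e]]] := h i.+1.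
  by rewrite -e.
- by apply/seteqP; split=> b /= => [<-|[z []]//]; exists (fun=>0%N).
- by move=> x z z' [_ ->] [_ ->].
Qed.

(** Packs countably many witnesses into one sequence, so that a countable conjunction of conditions
    still has a single witness. *)
Definition zrow (z : nat -> nat) i : nat -> nat := fun j => z (Cantor.to_nat (i, j)).

Lemma zrow_inj z z' : (forall i, zrow z i = zrow z' i) -> z = z'.
Proof.
move=> h; apply/funext => n.
have := congr1 (fun f => f (Cantor.of_nat n).2) (h (Cantor.of_nat n).1).
by rewrite /zrow; case: (Cantor.of_nat n) (Cantor.cancel_to_of n) => i j /= ->.
Qed.

Definition zunrow (Z : nat -> nat -> nat) : nat -> nat :=
  fun n => Z (Cantor.of_nat n).1 (Cantor.of_nat n).2.

Lemma zunrowK Z i : zrow (zunrow Z) i = Z i.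
Proof. by apply/funext => j; rewrite /zrow /zunrow Cantor.cancel_of_to. Qed.

Lemma leq_zrow i j : exists n, forall l, (l < j -> Cantor.to_nat (i,l) < n)%N.
Proof.
elim: j => [|j [n hn]]; first by exists 0%N.
exists (maxn n (Cantor.to_nat (i,j)).+1) => l; rewrite ltnS leq_eqVlt => /orP[/eqP ->|/hn].
  by rewrite leq_maxr.
by move=> h; rewrite (leq_trans h) ?leq_maxl.
Qed.

(** The hypothesis is uniform continuity of [f]: a prefix of the output is determined by a prefix of
    the input whose length depends on [n] alone. *)
Lemma closed2_comp P (f : (nat -> nat) -> (nat -> nat)) :
  (forall n, exists m, forall z z', (forall i, i < m -> z i = z' i)%N ->
     (forall i, i < n -> f z i = f z' i)%N) ->
  closed2 P -> closed2 (fun x z => P x (f z)).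
Proof.
move=> hf cP x z h; apply: cP => n; have [m hm] := hf n.
have [x' [z' [Pz xx zz]]] := h (maxn m n).
exists x', (f z'); split=> // [i hi|i hi].
  by apply: xx; rewrite (leq_trans hi) ?leq_maxr.
by apply: (hm z' z) => // j hj; apply: zz; rewrite (leq_trans hj) ?leq_maxl.
Qed.

Lemma closed2_zrow P i : closed2 P -> closed2 (fun x z => P x (zrow z i)).
Proof.
apply: closed2_comp (fun z => zrow z i) _ => n.
have [m hm] := leq_zrow i n; exists m => z z' h j /hm; exact: h.
Qed.

Lemma closed2_all (I : Type) (Q : I -> (nat -> bool) -> (nat -> nat) -> Prop) :
  (forall i, closed2 (Q i)) -> closed2 (fun x z => forall i, Q i x z).
Proof.
move=> cQ x z h i; apply: cQ => n; have [x' [z' [H1 H2 H3]]] := h n.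
by exists x', z'; split.
Qed.

Lemma closed2_and P Q : closed2 P -> closed2 Q -> closed2 (fun x z => P x z /\ Q x z).
Proof.
move=> cP cQ x z h; split; [apply: cP|apply: cQ] => n;
have [x' [z' [[H1 H1'] H2 H3]]] := h n; by exists x', z'; split.
Qed.

Lemma closed2_imp (p : Prop) P : closed2 P -> closed2 (fun x z => p -> P x z).
Proof. by move=> cP; apply: (@closed2_all p (fun=> P)) => _. Qed.

Lemma closed2_at (Q : nat -> Prop) i : closed2 (fun x z => Q (z i)).
Proof. by move=> x z h; have [x' [z' [H1 H2 <-]]] := h i.+1. Qed.

Lemma inj_closed_proj_bigcap (F : nat -> set (nat -> bool)) :
  (forall n, inj_closed_proj (F n)) -> inj_closed_proj (\bigcap_n F n).
Proof.
move=> /choice[P hP].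
exists (fun x z => forall n, P n x (zrow z n)); split.
- by apply: closed2_all => n; apply: closed2_zrow; have [] := hP n.
- apply/seteqP; split=> x /=.
    move=> h; have {h} /choice[Z hZ] : forall n, exists z, P n x z.
      by move=> n; have [_ Fn _] := hP n; have := h n I; rewrite Fn.
    by exists (zunrow Z) => n; rewrite zunrowK.
  by move=> [z hz] n _; have [_ -> _] := hP n; exists (zrow z n).
- move=> x z z' h h'; apply: zrow_inj => n; have [_ _ u] := hP n.
  exact: u (h n) (h' n).
Qed.

(** The first entry of the witness names the set that contains the point; disjointness makes this
    entry unique. *)
Lemma inj_closed_proj_disj (F : nat -> set (nat -> bool)) :
  (forall n, inj_closed_proj (F n)) -> (forall n m x, F n x -> F m x -> n = m) ->
  inj_closed_proj (\bigcup_n F n).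
Proof.
move=> /choice[P hP] dF.
exists (fun x z => P (z 0%N) x (fun i => z i.+1)); split.
- move=> x z h; have [+ _ _] := hP (z 0%N); apply => n.
  have [x' [z' [Pz xx zz]]] := h n.+1.
  exists x', (fun i => z' i.+1); split=> [|i hi|i hi].
  + by rewrite -zz.
  + by apply: xx; rewrite ltnS ltnW.
  + exact: zz.
- apply/seteqP; split=> x /=.
    move=> [n _]; have [_ -> _] := hP n => -[z hz].
    by exists (fun i => if i is j.+1 then z j else n).
  by move=> [z hz]; exists (z 0%N) => //; have [_ -> _] := hP (z 0%N); exists (fun i => z i.+1).
- move=> x z z' h h'.
  have e : z 0%N = z' 0%N.
    apply: (dF _ _ x).
    + by have [_ -> _] := hP (z 0%N); exists (fun i => z i.+1).
    + by have [_ -> _] := hP (z' 0%N); exists (fun i => z' i.+1).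
  have [_ _ u] := hP (z 0%N).
  move: h' => /=; rewrite -e => h'; have E := u _ _ _ h h'.
  by apply/funext => -[//|i]; have := congr1 (fun f => f i) E.
Qed.

(** Complements are not directly accessible for projections, so the induction carries a set together
    with its complement. A union is made disjoint first, and the complements carried along supply
    the differences. *)
Lemma inj_closed_proj_bor B : bor B -> inj_closed_proj B.
Proof.
suff H : bor `<=` [set B | inj_closed_proj B /\ inj_closed_proj (~` B)] by move=> /H[].
apply: smallest_sub => [|_ [n _ <-] /=]; last first.
  split; first exact: inj_closed_proj_cyl.
  rewrite (_ : ~` _ = [set b | b n = false]); first exact: inj_closed_proj_cyl.
  by apply/seteqP; split=> b /=; [move/negP/negbTE|move=> ->].
split.
- split.
    rewrite (_ : set0 = \bigcap_n [set b : nat -> bool | b 0%N = (n == 0)%N]).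
      by apply: inj_closed_proj_bigcap => n; exact: inj_closed_proj_cyl.
    by apply/seteqP; split=> // b h /=; have := h 0%N I; have := h 1%N I => /= ->.
  (* The whole space is the disjoint union of the two cylinders on bit 0; all further terms of the
     sequence are empty. *)
  rewrite setC0 (_ : setT = \bigcup_n [set b : nat -> bool | if n is n.+2 then b 0%N /\ ~~ b 0%N else b 0%N = (n == 0)%N]).
    apply: inj_closed_proj_disj; last by move=> [|[|n]] [|[|m]] x //=; case: (x 0%N) => //=; intuition.
    move=> [|[|n]] /=; try exact: inj_closed_proj_cyl.
    rewrite (_ : mkset _ = \bigcap_n [set b : nat -> bool | b 0%N = (n == 0)%N]).
      by apply: inj_closed_proj_bigcap => m; exact: inj_closed_proj_cyl.
    apply/seteqP; split=> // b /=; first by case=> ->.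
    by move=> h /=; have := h 0%N I; have := h 1%N I => /= ->.
  apply/seteqP; split=> // b _ /=.
  by case E: (b 0%N); [exists 0%N|exists 1%N].
- by move=> A [h1 h2]; rewrite setTD /= setCK.
- move=> F hF; split; last first.
    by rewrite setC_bigcup; apply: inj_closed_proj_bigcap => n; have [] := hF n.
  rewrite (seqDU_bigcup_eq F).
  apply: inj_closed_proj_disj; last first.
    move=> n m x Fn Fm; apply: contrapT => /eqP nm.
    by have /trivIsetP/(_ n m I I nm) := trivIset_seqDU F; rewrite -subset0 => /(_ x); apply.
  move=> n; rewrite (_ : seqDU F n = \bigcap_i (if i is j.+1 then (if (j < n)%N then ~` F j else F n) else F n)).
    by apply: inj_closed_proj_bigcap => -[|j]; [have [] := hF n|case: ifP => _; [have [] := hF j|have [] := hF n]].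
  apply/seteqP; split=> x /=.
    move=> [Fx nFx] [|j] _ //=; case: ifP => // jn Fj; apply: nFx.
    by rewrite -bigcup_mkord; exists j.
  move=> h; split; first exact: (h 0%N).
  rewrite -bigcup_mkord => -[j /= jn Fj].
  by have := h j.+1 I => /=; rewrite jn; apply.
Qed.

(** * Lusin separation and injective projections of closed sets *)

Definition borel_sep (A B : set (nat -> bool)) :=
  exists C, [/\ bor C, A `<=` C & forall x, B x -> ~ C x].

Lemma borel_sep_bigcup (T : countType) (A B : T -> set (nat -> bool)) :
  (forall i j, borel_sep (A i) (B j)) -> borel_sep (\bigcup_i A i) (\bigcup_i B i).
Proof.
move=> h; have {h} /choice[C hC] : forall p : T * T, exists C, [/\ bor C, A p.1 `<=` C & forall x, B p.2 x -> ~ C x].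
  by move=> p; exact: h.
exists (\bigcup_i \bigcap_j C (i, j)); split.
- by apply: bor_bigcup => i; apply: bor_bigcap => j; have [] := hC (i, j).
- by move=> x [i _ Ax]; exists i => // j _; have [_ + _] := hC (i, j); apply.
- by move=> x [j _ Bx] [i _ /(_ j I)]; have [_ _] := hC (i, j); apply.
Qed.

Definition prefix (x : nat -> bool) (z : nat -> nat) n := mkseq (fun i => (x i, z i)) n.

Definition branch (P : (nat -> bool) -> (nat -> nat) -> Prop) (s : seq (bool * nat)) :=
  [set x | exists z, P x z /\ prefix x z (size s) = s].

Lemma branch_rcons P s : branch P s = \bigcup_a branch P (rcons s a).
Proof.
apply/seteqP; split=> x.
  move=> [z [Pz e]]; exists (x (size s), z (size s)) => //; exists z; split => //.
  by rewrite size_rcons /prefix mkseqS -/(prefix x z (size s)) e.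
move=> [a _ [z [Pz e]]]; exists z; split=> //.
by move: e; rewrite size_rcons /prefix mkseqS => /rcons_inj[-> _].
Qed.

Lemma prefix_le x z m n : (m <= n)%N -> take m (prefix x z n) = prefix x z m.
Proof. by move=> mn; rewrite /prefix /mkseq -map_take take_iota (minn_idPl mn). Qed.

Lemma prefixP x z x' z' n : prefix x z n = prefix x' z' n <->
  (forall i, i < n -> x i = x' i /\ z i = z' i)%N.
Proof.
split=> [e i hi|h].
  have := congr1 (fun s => nth (x i, z i) s i) e.
  by rewrite /prefix !nth_mkseq // => -[].
by apply/eq_in_map => i; rewrite mem_iota add0n /= => /h[-> ->].
Qed.

(* Non-separable prefixes could be extended forever while staying
   non-separable; closedness would turn the two limits into two witnesses
   above the same point. *)
Lemma lusin_sep P s t :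
  closed2 P -> (forall x z z', P x z -> P x z' -> z = z') ->
  size s = size t -> s <> t -> borel_sep (branch P s) (branch P t).
Proof.
move=> cP uP est nst; apply: contrapT => ns.
pose W := {st : seq (bool * nat) * seq (bool * nat) | ~ borel_sep (branch P st.1) (branch P st.2)}.
have stp (w : W) : exists w' : W, exists a b,
    (sval w').1 = rcons (sval w).1 a /\ (sval w').2 = rcons (sval w).2 b.
  case: w => -[u v] /= nuv; apply: contrapT => h; apply: nuv.
  rewrite (branch_rcons _ u) (branch_rcons _ v); apply: borel_sep_bigcup => a b.
  apply: contrapT => nuv; apply: h.
  by exists (exist _ (rcons u a, rcons v b) nuv), a, b.
have [f hf] := choice stp.
pose w0 : W := exist _ (s, t) ns.
pose w n := iter n f w0.
have sz n : size (sval (w n)).1 = (size s + n)%N /\ size (sval (w n)).2 = (size s + n)%N.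
  elim: n => [|n [IH1 IH2]]; first by rewrite /= addn0 est.
  have [a [b [e1 e2]]] := hf (w n).
  by rewrite /w iterS -/(w n) e1 e2 !size_rcons IH1 IH2 addnS.
have tk n m : (n <= m)%N -> take (size s + n) (sval (w m)).1 = (sval (w n)).1 /\
      take (size s + n) (sval (w m)).2 = (sval (w n)).2.
  elim: m => [|m IH]; first by rewrite leqn0 => /eqP ->; rewrite !take_oversize //= ?addn0 ?est.
  rewrite leq_eqVlt => /orP[/eqP ->|]; first by rewrite !take_oversize // ?(sz m.+1).1 ?(sz m.+1).2.
  rewrite ltnS => nm; have [IH1 IH2] := IH nm.
  have [a [b [e1 e2]]] := hf (w m).
  rewrite /w iterS -/(w m) e1 e2 -!cats1 !takel_cat ?(sz m).1 ?(sz m).2 ?leq_add2l //.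
pose p i := nth (false, 0%N) (sval (w i.+1)).1 i.
pose q i := nth (false, 0%N) (sval (w i.+1)).2 i.
have pE n : prefix (fst \o p) (snd \o p) (size s + n) = (sval (w n)).1.
  apply: (@eq_from_nth _ (false,0%N)); first by rewrite size_mkseq (sz n).1.
  move=> i; rewrite size_mkseq => hi; rewrite nth_mkseq //= -surjective_pairing /p.
  case: (leqP n i.+1) => ni.
    by rewrite -(tk n i.+1 ni).1 nth_take.
  by rewrite -(tk i.+1 n (ltnW ni)).1 nth_take // addnS ltnS leq_addl.
have qE n : prefix (fst \o q) (snd \o q) (size s + n) = (sval (w n)).2.
  apply: (@eq_from_nth _ (false,0%N)); first by rewrite size_mkseq (sz n).2.
  move=> i; rewrite size_mkseq => hi; rewrite nth_mkseq //= -surjective_pairing /q.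
  case: (leqP n i.+1) => ni.
    by rewrite -(tk n i.+1 ni).2 nth_take.
  by rewrite -(tk i.+1 n (ltnW ni)).2 nth_take // addnS ltnS leq_addl.
(* If the limits differed at bit [i], the cylinder fixing that bit would separate the two branches
   at stage [i.+1]. *)
have px : fst \o p = fst \o q.
  apply/funext => i.
  apply: contrapT => ne; case: (svalP (w i.+1)).
  exists [set b | b i = (fst \o p) i]; split; first exact: bor_cyl.
    move=> x [z [_]]; rewrite (sz _).1 -pE => /prefixP/(_ i).
    by rewrite addnS ltnS leq_addl => -[].
  move=> x [z [_]]; rewrite (sz _).2 -qE => /prefixP/(_ i).
  by rewrite addnS ltnS leq_addl => -[]// /= -> _ e; apply: ne; rewrite /= e.
(* Closedness applies because no branch in the sequence is empty: an empty branch is separated from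
   every set. *)
have Pp : P (fst \o p) (snd \o p).
  apply: cP => n; have [[x [z [Pz]]]|ne] := pselect (branch P (sval (w n)).1 !=set0).
    rewrite (sz _).1 -pE => /prefixP h; exists x, z; split=> // i hi.
    - by have [] := h i (leq_trans hi (leq_addl _ _)).
    - by have [] := h i (leq_trans hi (leq_addl _ _)).
  have := svalP (w n); case; exists set0; split; [exact: bor0| |by move=> x _ []].
  by move=> x hx; apply: ne; exists x.
have Pq : P (fst \o q) (snd \o q).
  apply: cP => n; have [[x [z [Pz]]]|ne] := pselect (branch P (sval (w n)).2 !=set0).
    rewrite (sz _).2 -qE => /prefixP h; exists x, z; split=> // i hi.
    - by have [] := h i (leq_trans hi (leq_addl _ _)).
    - by have [] := h i (leq_trans hi (leq_addl _ _)).
  have := svalP (w n); case; exists setT; split; [exact: borT|exact: subsetT|].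
  by move=> x hx; exfalso; apply: ne; exists x.
rewrite -px in Pq; have ez := uP _ _ _ Pp Pq.
by apply: nst; have := pE 0%N; have := qE 0%N; rewrite -px -ez /= => -> ->.
Qed.

(** Branches over distinct prefixes of equal length have disjoint Borel hulls [C s]. A point lying,
    for each [n], in the hulls along some prefix of length [n] therefore determines these prefixes
    coherently, and their limit is a witness. *)
Lemma lusin_souslin P :
  closed2 P -> (forall x z z', P x z -> P x z' -> z = z') -> bor (projection P).
Proof.
move=> cP uP.
have /choice[D hD] : forall st : seq (bool * nat) * seq (bool * nat), exists D,
    bor D /\ (size st.1 = size st.2 -> st.1 <> st.2 ->
      branch P st.1 `<=` D /\ forall x, branch P st.2 x -> ~ D x).
  move=> [s t] /=; have [[e n]|h] := pselect (size s = size t /\ s <> t).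
    by have [D [h1 h2 h3]] := lusin_sep cP uP e n; exists D.
  by exists set0; split=> [|e n]; [exact: bor0|case: h].
(* The first condition does not depend on [x]: it empties [C s] when the branch is empty, so each
   remaining prefix provides an approximation for closedness. The second reads the bits of [x] off
   the prefix. *)
pose C (s : seq (bool * nat)) : set (nat -> bool) :=
  [set x | branch P s !=set0] `&`
  ((\bigcap_(i : 'I_(size s)) [set x : nat -> bool | x i = (nth (false, 0%N) s i).1]) `&`
  \bigcap_(t : seq (bool * nat))
    (if `[< size s = size t /\ s <> t >] then D (s, t) `\` D (t, s) else setT)).
have bC s : bor (C s).
  apply: borI; first exact: bor_prop.
  apply: borI; first by apply: bor_bigcap => i; exact: bor_cyl.
  apply: bor_bigcap => t; case: ifP => _; last exact: borT.
  by apply: borD; exact: (hD _).1.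
have CA s : branch P s `<=` C s.
  move=> x Ax; split; first by exists x.
  split.
    move=> [i hi] _ /=; have [z [_ e]] := Ax.
    by rewrite -e nth_mkseq.
  move=> t _; case: ifPn => // /asboolP[e n]; split.
    by have [_ /(_ e n)[+ _]] := hD (s, t); apply.
  by have [_ /(_ (esym e) (nesym n))[_ +]] := hD (t, s); apply.
have dC s t x : size s = size t -> C s x -> C t x -> s = t.
  move=> e [_ [_ /(_ t I)]] + [_ [_ /(_ s I)]].
  have [//|n] := pselect (s = t).
  case: ifPn => [_|/asboolP []//]; case: ifPn => [_|/asboolP [] //]; last by split=> //; apply: nesym.
  by move=> [h1 h2] [h3 h4].
suff -> : projection P = \bigcap_n \bigcup_(s : seq (bool * nat))
    (if size s == n then \bigcap_(i : 'I_n.+1) C (take i s) else set0).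
  apply: bor_bigcap => n; apply: bor_bigcup => s; case: ifP => _; last exact: bor0.
  by apply: bor_bigcap => i; exact: bC.
apply/seteqP; split=> x.
  move=> [z Pz] n _; exists (prefix x z n) => //.
  rewrite size_mkseq eqxx => -[i /= hi] _; rewrite ltnS in hi.
  by apply: CA; exists z; split=> //; rewrite prefix_le // size_mkseq.
move=> h.
have /choice[s hs] : forall n, exists s : seq (bool * nat), size s = n /\
    forall i, (i <= n)%N -> C (take i s) x.
  move=> n; have [s _] := h n I; case: eqP => // e hC; exists s; split=> // i hi.
  by have := hC (Ordinal (hi : i < n.+1)%N) I.
have tk n m : (n <= m)%N -> take n (s m) = s n.
  move=> nm; have [e1 h1] := hs n; have [e2 h2] := hs m.
  apply: (dC _ _ x); first by rewrite size_takel ?e1 ?e2.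
    exact: h2.
  by have := h1 n (leqnn n); rewrite take_oversize ?e1.
pose z i := (nth (false, 0%N) (s i.+1) i).2.
have sE n : prefix x z n = s n.
  have [e1 h1] := hs n.
  apply: (@eq_from_nth _ (false,0%N)); first by rewrite size_mkseq e1.
  move=> i; rewrite size_mkseq => hi; rewrite nth_mkseq // /z.
  have -> : nth (false, 0%N) (s n) i = nth (false, 0%N) (s i.+1) i.
    by rewrite -(tk i.+1 n hi) nth_take.
  have [e2 h2] := hs i.+1.
  have := h2 i.+1 (leqnn _); rewrite take_oversize ?e2 // => -[_ [+ _]].
  have hi2 : (i < size (s i.+1))%N by rewrite e2.
  by move=> /(_ (Ordinal hi2) I) /= ->; case: nth.
exists z; apply: cP => n.
have [e h1] := hs n.
have := h1 n (leqnn n); rewrite take_oversize ?e // => -[[x' [z' [Pz' e']]] _].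
move: e'; rewrite e -sE => /prefixP hp.
by exists x', z'; split=> // i /hp[].
Qed.

(** The indices [0..d] are [d + 1] in number, so this excludes [d + 1] distinct solutions and allows
    [d]. *)
Definition atmost (T : Type) d (Q : T -> Prop) :=
  ~ exists f : nat -> T, (forall i, (i <= d)%N -> Q (f i)) /\
      (forall i j, (i <= d)%N -> (j <= d)%N -> f i = f j -> i = j).

Definition evens (z : nat -> nat) : nat -> nat := fun i => z i.*2.
Definition odds (z : nat -> nat) : nat -> nat := fun i => z i.*2.+1.

Definition weave (T : Type) (x y : nat -> T) : nat -> T :=
  fun i => if odd i then y i./2 else x i./2.

Lemma evens_weave x y : evens (weave x y) = x.
Proof. by apply/funext => i; rewrite /evens /weave odd_double doubleK. Qed.

Lemma odds_weave x y : odds (weave x y) = y.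
Proof. by apply/funext => i; rewrite /odds /weave /= odd_double /= uphalf_double. Qed.

Lemma weave_inj z z' : evens z = evens z' -> odds z = odds z' -> z = z'.
Proof.
move=> e o; apply/funext => i; rewrite -(odd_double_half i).
case: (odd i); first exact: (congr1 (fun f => f i./2) o).
exact: (congr1 (fun f => f i./2) e).
Qed.

Lemma closed2_evens P : closed2 P -> closed2 (fun x z => P x (evens z)).
Proof.
apply: closed2_comp => n; exists n.*2 => z z' h i hi.
by apply: h; rewrite ltn_double.
Qed.

Lemma closed2_odds P : closed2 P -> closed2 (fun x z => P x (odds z)).
Proof.
apply: closed2_comp => n; exists n.*2 => z z' h i hi.
by apply: h; rewrite ltn_Sdouble.
Qed.

(** Weaving the unique witness of [B x] into the witness of [P] restricts the problem to [B], where
    uniqueness is available. *)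
Lemma lusin_souslin_on P B :
  closed2 P -> bor B -> (forall x z z', B x -> P x z -> P x z' -> z = z') ->
  bor (B `&` projection P).
Proof.
move=> cP /inj_closed_proj_bor[Q [cQ BQ uQ]] uP.
rewrite (_ : _ `&` _ = projection (fun x z => P x (evens z) /\ Q x (odds z))).
  apply: lusin_souslin; first by apply: closed2_and; [exact: closed2_evens|exact: closed2_odds].
  move=> x z z' [h1 h2] [h1' h2']; apply: weave_inj; last exact: uQ h2 h2'.
  by apply: uP h1 h1'; rewrite BQ; exists (odds z).
apply/seteqP; split=> x.
  by rewrite BQ => -[[z Qz] [y Py]]; exists (weave y z); rewrite evens_weave odds_weave.
by move=> [z [Pz Qz]]; split; [rewrite BQ; exists (odds z)|exists (evens z)].
Qed.

Lemma closed2_pre (Q : seq nat -> Prop) n : closed2 (fun x z => Q (mkseq z n)).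
Proof.
move=> x z h; have [x' [z' [h1 _ h3]]] := h n.
rewrite (_ : mkseq z n = mkseq z' n) //.
by apply/eq_in_map => i; rewrite mem_iota add0n /= => /h3.
Qed.

Lemma separating_prefix (T : eqType) m (f : nat -> nat -> T) :
  (forall i j, (i < m)%N -> (j < m)%N -> f i = f j -> i = j) ->
  exists n, forall i j, (i < m)%N -> (j < m)%N -> mkseq (f i) n = mkseq (f j) n -> i = j.
Proof.
move=> fi.
have /choice[N hN] : forall p : 'I_m * 'I_m, exists n, p.1 != p.2 -> mkseq (f p.1) n != mkseq (f p.2) n.
  move=> [i j] /=; have [->|ne] := eqVneq i j; first by exists 0%N.
  have [k hk] : exists k, f i k <> f j k.
    apply: contrapT => h; move/eqP: ne; apply; apply: val_inj; apply: (fi _ _ (ltn_ord i) (ltn_ord j)).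
    by apply/funext => k; apply: contrapT => hk; apply: h; exists k.
  exists k.+1 => _; apply/eqP => /(congr1 (fun s => nth (f i k) s k)).
  by rewrite !nth_mkseq.
exists (\max_p N p) => i j hi hj e.
have [/(congr1 val)//|ne] := eqVneq (Ordinal hi) (Ordinal hj).
have := hN (Ordinal hi, Ordinal hj) ne => /= /negP[]; apply/eqP.
have l : (N (Ordinal hi, Ordinal hj) <= \max_p N p)%N by exact: leq_bigmax.
have := congr1 (take (N (Ordinal hi, Ordinal hj))) e.
by rewrite /mkseq -!map_take !take_iota (minn_idPl l).
Qed.

(* On the points with exactly [d] witnesses, the [d]-tuple of witnesses is
   unique once pairwise distinct prefixes are prescribed, so that Lusin-Souslin
   applies to tuples; the other points have at most [d - 1] witnesses. *)
Lemma projection_atmost d P B :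
  closed2 P -> bor B -> (forall x, B x -> atmost d (P x)) -> bor (B `&` projection P).
Proof.
elim: d B => [|d IH] B cP bB hB.
  rewrite (_ : _ `&` _ = set0); first exact: bor0.
  apply/seteqP; split=> // x [Bx [z Pz]]; case: (hB x Bx).
  by exists (fun=> z); split=> // i j; rewrite !leqn0 => /eqP-> /eqP->.
(* [p] holds a prefix length and the list of prescribed prefixes. Rows beyond [d] are set to zero so
   that the sequence coding the tuple is unique as well. *)
pose Q (p : nat * seq (seq nat)) x z :=
  (forall i : nat, (i <= d)%N -> P x (zrow z i) /\ mkseq (zrow z i) p.1 = nth [::] p.2 i) /\
  (forall i, (d < i)%N -> forall j, zrow z i j = 0%N).
have cQ p : closed2 (Q p).
  apply: closed2_and; apply: closed2_all => i; apply: closed2_imp.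
    apply: closed2_and; first exact: closed2_zrow.
    by apply: (@closed2_zrow (fun x z => mkseq z p.1 = nth [::] p.2 i)); exact: (@closed2_pre (fun s => s = _)).
  by apply: closed2_all => j; rewrite /zrow; exact: (@closed2_at (fun s => s = _)).
pose ok (p : nat * seq (seq nat)) := uniq p.2 && (size p.2 == d.+1).
pose A := \bigcup_(p : nat * seq (seq nat)) (if ok p then B `&` projection (Q p) else set0).
have bA : bor A.
  apply: bor_bigcup => p; case: ifPn => [/andP[up /eqP sp]|_]; last exact: bor0.
  apply: lusin_souslin_on => // x z z' Bx [h1 h2] [h1' h2']; apply: zrow_inj => i.
  case: (ltnP d i) => di; first by apply/funext => j; rewrite h2 // h2'.
  apply: contrapT => ne; apply: (hB x Bx).
  (* If a second tuple differs in row [i], that row differs from all rows of [z]: from row [i] by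
     assumption, from the others by its prefix. This makes [d + 2] witnesses. *)
  exists (fun j => if (j <= d)%N then zrow z j else zrow z' i); split.
    by move=> j _; case: ifPn => [/h1[]//|_]; have [] := h1' _ di.
  have nn j : (j <= d)%N -> zrow z j <> zrow z' i.
    move=> jd e; have [_ e1] := h1 _ jd; have [_ e2] := h1' _ di.
    have : nth [::] p.2 j = nth [::] p.2 i by rewrite -e1 -e2 e.
    move/eqP; rewrite nth_uniq ?sp // => /eqP ji; apply: ne; rewrite -ji in e *.
    exact: e.
  move=> j k; rewrite (leq_eqVlt j) (leq_eqVlt k) !ltnS.
  case: (leqP j d) => jd; case: (leqP k d) => kd.
  - move=> _ _ e; have [_ e1] := h1 _ jd; have [_ e2] := h1 _ kd.
    have : nth [::] p.2 j = nth [::] p.2 k by rewrite -e1 -e2 e.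
    by move/eqP; rewrite nth_uniq ?sp // => /eqP.
  - by move=> _ _ /nn; case.
  - by move=> _ _ /esym/nn; case.
  - by rewrite !orbF => /eqP -> /eqP ->.
rewrite (_ : _ `&` _ = A `|` ((B `\` A) `&` projection P)).
  apply: borU => //; apply: IH => //; first exact: borD.
  move=> x [Bx nA] [f [f1 f2]]; apply: nA.
  have [n hn] := @separating_prefix _ d.+1 f f2.
  pose ts := mkseq (fun i => mkseq (f i) n) d.+1.
  exists (n, ts) => //; rewrite /ok [size _]size_mkseq eqxx andbT [(_, _).2]/=.
  have -> : uniq ts.
    apply/(uniqP [::]) => i j; rewrite !inE !size_mkseq => hi hj.
    by rewrite !nth_mkseq //; exact: hn.
  split=> //; exists (zunrow (fun i => if (i <= d)%N then f i else fun=> 0%N)); split=> i hi.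
    by rewrite zunrowK hi; split; [exact: f1|rewrite nth_mkseq].
  by rewrite zunrowK leqNgt hi.
apply/seteqP; split=> x.
  by move=> [Bx Px]; have [Ax|nA] := pselect (A x); [left|right].
move=> [[p _]|[[Bx _] Px]//].
case: ifPn => // _ [Bx [z [h1 h2]]]; split=> //; exists (zrow z 0%N).
by have [] := h1 0%N (leq0n _).
Qed.

(** * Coding a complete separable metric space in the Cantor space *)

Section MetricCode.
Context (R : realType) (M : metricType R) (e : nat -> M).
Hypothesis dense_e : forall (x : M) (r : R), (0 < r)%R -> exists i, (mdist (e i) x < r)%R.
Hypothesis complete : forall F : set_system M, ProperFilter F -> cauchy F -> exists l : M, F --> l.
Local Open Scope ring_scope.

Let rad (j : nat) : R := j.+1%:R^-1.
Let q n := e (Cantor.of_nat n).1.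
Let rho n : R := rad (Cantor.of_nat n).2.

Lemma rad_gt0 j : 0 < rad j. Proof. by rewrite invr_gt0. Qed.

Lemma rad_small (r : R) : 0 < r -> exists j, forall i, (j <= i)%N -> rad i < r.
Proof.
move=> r0; have [j _ hj] := near_infty_natSinv_lt (PosNum r0).
by exists j => i /hj.
Qed.

(* The [n]-th bit of the code of [x] says whether [x] is in the [n]-th ball of a
   countable base. *)
Definition metric_code (x : M) : nat -> bool := fun n => mdist (q n) x < rho n.

Lemma metric_codeE i j x : metric_code x (Cantor.to_nat (i, j)) = (mdist (e i) x < rad j).
Proof. by rewrite /metric_code /q /rho Cantor.cancel_of_to. Qed.

Lemma metric_code_inj : injective metric_code.
Proof.
move=> x y exy; apply: contrapT => /eqP; rewrite -mdist_gt0 => d0.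
have [j hj] := rad_small (divr_gt0 d0 (ltr0n R 2)).
have [i hi] := dense_e x (rad_gt0 j).
have : metric_code x (Cantor.to_nat (i, j)) by rewrite metric_codeE.
rewrite exy metric_codeE => hi'.
have := le_lt_trans (metric_triangle x (e i) y) (ltrD _ hi').
rewrite metric_sym => /(_ _ hi) h.
have := lt_trans h (ltrD (hj j (leqnn _)) (hj j (leqnn _))).
by rewrite -splitr ltxx.
Qed.

(** The conditions describe the families of basic balls containing a point: there are arbitrarily
    small balls, any two are compatible, and a ball occurs exactly when a ball of the family lies
    inside it with a margin. Completeness gives the point; each condition involves countably many
    bits. *)
Lemma range_metric_code : range metric_code =
  [set b : nat -> bool | (forall j, exists i, b (Cantor.to_nat (i, j))) /\
    (forall n m, b n -> b m -> mdist (q n) (q m) < rho n + rho m) /\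
    (forall n, b n <-> exists m, b m /\ mdist (q n) (q m) + rho m < rho n)].
Proof.
apply/seteqP; split=> b.
  move=> [x _ <-]; split=> [j|].
    by have [i hi] := dense_e x (rad_gt0 j); exists i; rewrite metric_codeE.
  split=> [n m hn hm|n].
    apply: le_lt_trans (metric_triangle _ x _) _.
    by rewrite (metric_sym x); apply: ltrD.
  split=> [hn|[m [hm h]]].
    have : 0 < rho n - mdist (q n) x by rewrite subr_gt0.
    move=> /divr_gt0/(_ (ltr0n R 2))/rad_small[j /(_ j (leqnn j)) hj].
    have [i hi] := dense_e x (rad_gt0 j).
    exists (Cantor.to_nat (i, j)); rewrite metric_codeE hi; split=> //.
    rewrite /q /rho Cantor.cancel_of_to /= -/(q n) -/(rho n).
    have := metric_triangle (q n) x (e i); rewrite (metric_sym x) => ht.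
    by lra.
  rewrite /metric_code.
  by have := metric_triangle (q n) (q m) x; rewrite /metric_code in hm; lra.
move=> [h1 [h2 h3]].
have [i hi] := choice h1.
pose p j := e (i j).
have hp n j : b n -> mdist (q n) (p j) < rho n + rad j.
  move=> bn; have := h2 n _ bn (hi j).
  by rewrite /q /rho Cantor.cancel_of_to.
have [l hl] : exists l : M, (p @ \oo) --> l.
  apply: complete; apply: cauchy_exP => eps eps0.
  have [j hj] := rad_small (divr_gt0 eps0 (ltr0n R 2)).
  exists (p j); exists j => // k /= jk.
  rewrite ballEmdist /=; have := hp _ k (hi j).
  rewrite /q /rho Cantor.cancel_of_to /= => h.
  by have := hj j (leqnn j); have := hj k jk; rewrite -/(p j) in h; lra.
have hl2 (eta : R) : 0 < eta -> exists j, mdist (p j) l < eta /\ rad j < eta.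
  move=> eta0; have [j hj] := rad_small eta0.
  have [k _ hk] := cvg_ball hl eta0.
  exists (maxn j k); rewrite hj ?leq_maxl //; split=> //.
  have := hk (maxn j k) (leq_maxr _ _).
  by rewrite /= ballEmdist /= metric_sym.
have hle n : b n -> mdist (q n) l <= rho n.
  move=> bn; rewrite leNgt; apply/negP; rewrite -subr_gt0 => /divr_gt0/(_ (ltr0n R 2))/hl2[j [hj1 hj2]].
  by have := hp _ j bn; have := metric_triangle (q n) (p j) l; lra.
exists l => //; apply/funext => n; rewrite /metric_code; apply/idP/idP.
  move=> hn; apply/h3.
  move: (hn); rewrite -subr_gt0 => /divr_gt0/(_ (ltr0n R 2))/hl2[j [hj1 hj2]].
  exists (Cantor.to_nat (i j, j)); split; first exact: hi.
  rewrite /q /rho Cantor.cancel_of_to /= -/(q n) -/(rho n) -/(p j).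
  by have := metric_triangle (q n) l (p j); rewrite (metric_sym l); lra.
move=> /h3[m [bmeas hm]]; have := hle _ bmeas.
by have := metric_triangle (q n) (q m) l; lra.
Qed.

Lemma bor_range_metric_code : bor (range metric_code).
Proof.
rewrite range_metric_code.
have bb n : bor [set b : nat -> bool | b n] by exact: (bor_cyl n true).
rewrite (_ : mkset _ = (\bigcap_j \bigcup_i [set b : nat -> bool | b (Cantor.to_nat (i, j))]) `&`
  ((\bigcap_n \bigcap_m (~` [set b : nat -> bool | b n] `|` ~` [set b : nat -> bool | b m] `|` [set _ | mdist (q n) (q m) < rho n + rho m]))
  `&` \bigcap_n (([set b : nat -> bool | b n] `&` (\bigcup_m ([set b : nat -> bool | b m] `&` [set _ | mdist (q n) (q m) + rho m < rho n])))
   `|` ((~` [set b : nat -> bool | b n]) `&` ~` (\bigcup_m ([set b : nat -> bool | b m] `&` [set _ | mdist (q n) (q m) + rho m < rho n])))))).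
  apply: borI; first by apply: bor_bigcap => j; apply: bor_bigcup => i.
  have bU n : bor (\bigcup_m ([set b : nat -> bool | b m] `&` [set _ | mdist (q n) (q m) + rho m < rho n])).
    by apply: bor_bigcup => m; apply: borI => //; exact: bor_prop.
  apply: borI; apply: bor_bigcap => n.
    apply: bor_bigcap => m; apply: borU; last exact: bor_prop.
    by apply: borU; exact: borC.
  by apply: borU; apply: borI => //; exact: borC.
apply/seteqP; split=> b /=.
  move=> [h1 [h2 h3]]; split; first by move=> j _; have [i hi] := h1 j; exists i.
  split.
    move=> n _ m _; have [bn|] := boolP (b n); last by move=> h; left; left; apply/negP.
    have [bmeas|] := boolP (b m); last by move=> h; left; right; apply/negP.
    by right; exact: h2.
  move=> n _; have [bn|nbn] := boolP (b n).
    by left; split=> //; have /h3[m [bmeas hm]] := bn; exists m.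
  right; split; first exact/negP.
  by move=> [m _ [bmeas hm]]; move/negP: nbn; apply; apply/h3; exists m.
move=> [h1 [h2 h3]]; split; first by move=> j; have [i _ hi] := h1 j I; exists i.
split.
  by move=> n m bn bmeas; have [[]|] := h2 n I m I.
move=> n; have [[bn [m _ [bmeas hm]]]|[nbn nU]] := h3 n I.
  by split=> // _; exists m.
split=> // [[m [bmeas hm]]]; exfalso; apply: nU; by exists m.
Qed.

Lemma open_metric_code n : open [set x | metric_code x n].
Proof.
rewrite openE => x /= hx; apply/nbhs_ballP; exists (rho n - mdist (q n) x).
  by rewrite /= subr_gt0.
move=> y; rewrite ballEmdist /= /metric_code => hy.
by have := metric_triangle (q n) x y; lra.
Qed.

Lemma borel_metric_code (A : set M) :
  <<s @open M >> A <-> exists B, bor B /\ A = metric_code @^-1` B.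
Proof.
split.
  suff : <<s @open M >> `<=` [set A | exists B, bor B /\ A = metric_code @^-1` B] by apply.
  apply: smallest_sub; first split.
  - by exists set0; split; [exact: bor0|].
  - by move=> _ [B [bB ->]]; exists (~` B); split; [exact: borC|rewrite setTD].
  - move=> F /choice[G hG]; exists (\bigcup_n G n); split.
      by apply: bor_bigcup => n; exact: (hG n).1.
    by rewrite preimage_bigcup; apply: eq_bigcup => // n _; exact: (hG n).2.
  - move=> U oU /=.
    exists (\bigcup_n ([set b : nat -> bool | b n] `&` [set _ | [set x | metric_code x n] `<=` U])).
    split.
      by apply: bor_bigcup => n; apply: borI; [exact: (bor_cyl n true)|exact: bor_prop].
    apply/seteqP; split=> x /=; last by move=> [n _ [/= h1]]; apply.
    move=> Ux; move: oU; rewrite openE => /(_ x Ux) /nbhs_ballP[r /= r0 hr].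
    have [j /(_ j (leqnn j)) hj] := rad_small (divr_gt0 r0 (ltr0n R 2)).
    have [i hi] := dense_e x (rad_gt0 j).
    exists (Cantor.to_nat (i, j)) => //; split=> /=; rewrite ?metric_codeE //.
    move=> y /=; rewrite metric_codeE => hy; apply: hr.
    rewrite ballEmdist /=; have := metric_triangle x (e i) y.
    by rewrite (metric_sym x (e i)); lra.
move=> [B [bB ->]].
suff : bor `<=` [set B | <<s @open M >> (metric_code @^-1` B)] by apply.
have [s0 sC sU] : sigma_algebra setT <<s @open M >> by exact: smallest_sigma_algebra.
apply: smallest_sub; first split.
- by rewrite /= preimage_set0.
- by move=> C hC; rewrite /= setTD preimage_setC -setTD; apply: sC.
- by move=> F hF; rewrite /= preimage_bigcup; apply: sU.
- by move=> _ [n _ <-]; apply: sub_sigma_algebra; exact: open_metric_code.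
Qed.

End MetricCode.

Lemma standard_Borel_code (R : realType) disp (X : measurableType disp) (x0 : X) :
  standard_Borel R X ->
  exists c : X -> nat -> bool, [/\ injective c, bor (range c) &
    forall A : set X, measurable A <-> exists B, bor B /\ A = c @^-1` B].
Proof.
move=> [M [f [cM [D [/countable_injP[g ginj] dD]] bf mX]]].
have [e he] : exists e : nat -> M, forall x, D x -> exists n, e n = x.
  pose e n := if pselect (exists x, D x /\ g x = n) is left h then projT1 (cid h) else f x0.
  exists e => x Dx; exists (g x); rewrite /e; case: pselect => [h|[]]; last by exists x.
  case: cid => y /= [Dy gy]; apply: ginj => //; exact/mem_set.
have de (x : M) (r : R) : (0 < r)%R -> exists i, (mdist (e i) x < r)%R.
  move=> r0; have [] := dD (interior (ball x r)).
  - exists x; exact: nbhsx_ballx.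
  - exact: open_interior.
  - move=> y [yb /he[i ei]]; exists i; rewrite ei.
    by have := interior_subset yb; rewrite ballEmdist /= metric_sym.
have fi := bij_inj bf.
exists (metric_code e \o f); split.
- by move=> x y /(metric_code_inj de)/fi.
- rewrite (_ : range _ = range (metric_code e)); first exact: bor_range_metric_code.
  have [h fK hK] := bf.
  apply/seteqP; split=> b [x _ <-]; first by exists (f x).
  by exists (h x) => //=; rewrite hK.
- move=> A; rewrite mX /preimage_set_system; split.
    move=> [B /(borel_metric_code de)[C [bC ->]] <-]; exists C; split=> //.
    by rewrite setTI.
  move=> [B [bB ->]]; exists (metric_code e @^-1` B); last by rewrite setTI.
  by apply/(borel_metric_code de); exists B.
Qed.

Lemma bor_preimage (f : (nat -> bool) -> (nat -> bool)) B :
  (forall n, bor [set b | f b n]) -> bor B -> bor (f @^-1` B).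
Proof.
move=> hf bB; suff : bor `<=` [set B | bor (f @^-1` B)] by apply.
apply: smallest_sub; first split.
- by rewrite /= preimage_set0; exact: bor0.
- by move=> C hC; rewrite /= setTD preimage_setC; apply: borC.
- by move=> F hF; rewrite /= preimage_bigcup; apply: bor_bigcup.
- by move=> _ [n _ <-]; exact: hf.
Qed.

(** * Borel projections with bounded finite sections *)

Section Projection.
Context (R : realType) (disp : measure_display) (X : measurableType disp).
Hypothesis stdX : standard_Borel R X.

(** In codes, [E] is the projection of a closed set with unique witnesses. Joining the code of [y]
    to that witness yields a closed set over the code of [x] whose sections are no larger than those
    of [E]. *)
Lemma measurable_finite_proj d (E : set (X * X)) :
  measurable E -> (forall x, atmost d (fun y => E (x, y))) ->
  measurable [set x | exists y, E (x, y)].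
Proof.
have [c [ci bc mc]] := standard_Borel_code point stdX.
move=> mE hE.
pose bev (b : nat -> bool) i := b i.*2.
pose bod (b : nat -> bool) i := b i.*2.+1.
have bevw x y : bev (weave x y) = x.
  by apply/funext => i; rewrite /bev /weave odd_double doubleK.
have bodw x y : bod (weave x y) = y.
  by apply/funext => i; rewrite /bod /weave /= odd_double /= uphalf_double.
have mev B : bor B -> bor (bev @^-1` B).
  by apply: bor_preimage => n; exact: (bor_cyl _ true).
have mod B : bor B -> bor (bod @^-1` B).
  by apply: bor_preimage => n; exact: (bor_cyl _ true).
have [F [bF EF]] : exists F, bor F /\ E = [set p | F (weave (c p.1) (c p.2))].
  suff : measurable `<=` [set E : set (X * X) | exists F, bor F /\ E = [set p | F (weave (c p.1) (c p.2))]] by apply.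
  apply: smallest_sub; first split.
  - by exists set0; split; [exact: bor0|].
  - by move=> _ [B [bB ->]]; exists (~` B); split; [exact: borC|rewrite setTD].
  - move=> G /choice[H hH]; exists (\bigcup_n H n); split.
      by apply: bor_bigcup => n; exact: (hH n).1.
    by apply/seteqP; split=> p [n _]; rewrite /= ?(hH n).2 => h; exists n => //; rewrite (hH n).2.
  - move=> _ [[A mA <-]|[A mA <-]]; rewrite setTI; have [B [bB ->]] := (mc A).1 mA.
      exists (bev @^-1` B); split; first exact: mev.
      by apply/seteqP; split=> p /=; rewrite bevw.
    exists (bod @^-1` B); split; first exact: mod.
    by apply/seteqP; split=> p /=; rewrite bodw.
have : bor (F `&` (bev @^-1` range c) `&` (bod @^-1` range c)).
  by apply: borI; [apply: borI => //; exact: mev|exact: mod].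
move=> /inj_closed_proj_bor[P [cP PE uP]].
pose bits (z : nat -> nat) i := z i.*2 == 1%N.
(* Even entries carry the code of [y] as numbers. Bounding them by 1 lets this code determine them,
   so distinct witnesses come from distinct [y]. *)
pose Q x z := P (weave x (bits z)) (odds z) /\ forall i, (z i.*2 <= 1)%N.
have cQ : closed2 Q.
  apply: closed2_and; last first.
    by apply: closed2_all => i; exact: (@closed2_at (fun s => s <= 1)%N).
  move=> x z h; apply: cP => n; have [x' [z' [h1 h2 h3]]] := h n.*2.
  exists (weave x' (bits z')), (odds z'); split=> // i hi.
    have hi2 : (i./2 < n)%N by lia.
    rewrite /weave; case: ifP => _; last by apply: h2; lia.
    by rewrite /bits h3 //; lia.
  by rewrite /odds h3 //; lia.
have QE x z : Q x z -> exists x0 y0, [/\ E (x0, y0), x = c x0 & bits z = c y0].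
  move=> [h _]; have : projection P (weave x (bits z)) by exists (odds z).
  rewrite -PE => -[[Fx [x0 _ e1]] [y0 _ e2]].
  rewrite bevw in e1; rewrite bodw in e2; exists x0, y0; split=> //.
  by rewrite EF /= e1 e2.
have aQ x : setT x -> atmost d (Q x).
  move=> _ [f [f1 f2]]; have [x0 [_ [_ e0 _]]] := QE _ _ (f1 0%N (leq0n d)).
  have /choice[g hg] : forall i, exists y, (i <= d)%N -> E (x0, y) /\ bits (f i) = c y.
    move=> i; case: (leqP i d) => id; last by exists x0.
    have [x1 [y1 [e1 e2 e3]]] := QE _ _ (f1 i id); exists y1 => _.
    by have <- : x1 = x0 by apply: ci; rewrite -e2.
  apply: (hE x0); exists g; split=> [i /hg[]//|i j hi hj gij].
  apply: f2 => //; have [Pi bi] := f1 i hi; have [Pj bj] := f1 j hj.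
  have ebits : bits (f i) = bits (f j) by rewrite (hg i hi).2 (hg j hj).2 gij.
  apply: weave_inj; last by apply: (uP _ _ _ Pi); rewrite ebits.
  apply/funext => k; have := congr1 (fun s => s k) ebits; rewrite /bits /evens.
  by have := bi k; have := bj k; case: (f i _) => [|[|]] //; case: (f j _) => [|[|]].
have bQ := projection_atmost cQ borT aQ.
apply/mc; exists (projection Q); split; first by rewrite setTI in bQ.
apply/seteqP; split=> x /=.
  move=> [y Exy].
  have : projection P (weave (c x) (c y)).
    rewrite -PE; split; last by rewrite /= bodw; exists y.
    by split; [rewrite EF in Exy|rewrite /= bevw; exists x].
  move=> [z Pz]; exists (weave (fun i => nat_of_bool (c y i)) z).
  have eb : bits (weave (fun i => nat_of_bool (c y i)) z) = c y.
    by apply/funext => i; rewrite /bits /weave odd_double doubleK; case: (c y i).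
  split; first by rewrite eb odds_weave.
  by move=> i; rewrite /weave odd_double doubleK; case: (c y i).
move=> [z /QE[x0 [y0 [h1 h2 h3]]]]; exists y0.
by rewrite (ci _ _ h2).
Qed.
End Projection.

(** * Borel enumeration of the neighbours *)

Section Measurable.
Context (disp : measure_display) (X : measurableType disp).

Lemma meas_bigcup (I : countType) (F : I -> set X) :
  (forall i, measurable (F i)) -> measurable (\bigcup_i F i).
Proof. by apply: countable_bigcupT_measurable; exact: countableP. Qed.

Lemma meas_bigcap (I : countType) (F : I -> set X) :
  (forall i, measurable (F i)) -> measurable (\bigcap_i F i).
Proof.
move=> hF; rewrite -[X in measurable X]setCK setC_bigcap.
by apply: measurableC; apply: meas_bigcup => i; apply: measurableC.
Qed.

Lemma meas_prop (P : Prop) : measurable [set _ : X | P].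
Proof.
have [p|np] := pselect P.
  suff -> : [set _ : X | P] = setT by exact: measurableT.
  by apply/seteqP; split.
suff -> : [set _ : X | P] = set0 by exact: measurable0.
by apply/seteqP; split.
Qed.

Definition borel_map (f : X -> X) := forall A, measurable A -> measurable (f @^-1` A).

Definition first_case (P : nat -> X -> bool) (F : nat -> X -> X) (x : X) : X :=
  if pselect (exists n, P n x) is left h then F (ex_minn h) x else x.

Lemma borel_first_case (P : nat -> X -> bool) F : (forall n, measurable [set x | P n x]) ->
  (forall n, borel_map (F n)) -> borel_map (first_case P F).
Proof.
move=> mP mF A mA.
rewrite (_ : _ @^-1` _ = (\bigcup_n ([set x | P n x] `&` (\bigcap_(i : 'I_n) ~` [set x | P i x]) `&` F n @^-1` A))
  `|` ((\bigcap_n ~` [set x | P n x]) `&` A)).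
  apply: measurableU.
    apply: meas_bigcup => n; apply: measurableI; last exact: mF.
    by apply: measurableI => //; apply: meas_bigcap => i; apply: measurableC.
  by apply: measurableI => //; apply: meas_bigcap => i; apply: measurableC.
apply/seteqP; split=> x; rewrite /preimage /first_case /=.
  case: pselect => [h|h]; last by right; split=> // n _ Pn; apply: h; exists n.
  case: ex_minnP => m Pm hm FA; left; exists m => //; split=> //; split=> // i _ /= /hm.
  by rewrite leqNgt ltn_ord.
case: pselect => [h|h]; last first.
  by move=> [[n _ [[Pn _] _]]|[_ //]]; case: h; exists n.
case: ex_minnP => m Pm hm [[n _ [[Pn hn] FA]]|[hn _]]; last by case: (hn m I).
suff -> : m = n by [].
apply/eqP; rewrite eqn_leq hm //= leqNgt; apply/negP => mn.
by have := hn (Ordinal mn) I; apply.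
Qed.

Lemma first_caseP (P : nat -> X -> bool) F x : (exists n, P n x) ->
  exists n, P n x /\ first_case P F x = F n x.
Proof.
rewrite /first_case; case: pselect => // h _.
by case: ex_minnP => m Pm _; exists m.
Qed.

Lemma first_caseN (P : nat -> X -> bool) F x : ~ (exists n, P n x) -> first_case P F x = x.
Proof. by rewrite /first_case; case: pselect. Qed.
End Measurable.

Section Nbhd.
Context (R : realType) (d : nat) (G : graphing R d).
Notation X := (gr_space G).
Implicit Types (x y z : X) (A : set X).

Definition gr_code : X -> nat -> bool :=
  projT1 (cid (standard_Borel_code point (@gr_standard _ _ G))).

Lemma gr_code_inj : injective gr_code.
Proof. by rewrite /gr_code; case: cid => c []. Qed.

Lemma gr_measP A : measurable A <-> exists B, bor B /\ A = gr_code @^-1` B.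
Proof. by rewrite /gr_code; case: cid => c []. Qed.

Lemma meas_code n b : measurable [set x | gr_code x n = b].
Proof. by apply/gr_measP; exists [set s | s n = b]; split => //; exact: bor_cyl. Qed.

Lemma borel_eq (f g : X -> X) : borel_map f -> borel_map g -> measurable [set x | f x = g x].
Proof.
move=> mf mg.
rewrite (_ : mkset _ = \bigcap_n \bigcup_b ([set x | gr_code (f x) n = b] `&` [set x | gr_code (g x) n = b])).
  apply: meas_bigcap => n; apply: meas_bigcup => b.
  by apply: measurableI; [exact: (mf _ (meas_code n b))|exact: (mg _ (meas_code n b))].
apply/seteqP; split=> x /=; first by move=> e n _; exists (gr_code (f x) n) => //=; rewrite e.
move=> h; apply: gr_code_inj; apply/funext => n.
by have [b _ [/= -> ->]] := h n I.
Qed.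


Lemma gr_nbr_finite x : finite_set [set y | gr_edge G (x, y)].
Proof. by apply/finite_set_leP; exists d; exact: gr_deg. Qed.

(* Closed neighbourhood: [x] belongs to [nb x]. *)
Definition nb x : {fset X} := (x |` fset_set [set y | gr_edge G (x, y)])%fset.

Lemma in_nb x y : (y \in nb x) <-> y = x \/ gr_edge G (x, y).
Proof.
rewrite /nb !inE in_fset_set ?inE; last exact: gr_nbr_finite.
split=> [/orP[/eqP|]|[->|h]]; [by left| |by rewrite eqxx|]; last by apply/orP; right; exact/mem_set.
by move=> /set_mem h; right.
Qed.

Lemma nb_card x : (#|` nb x| <= d.+1)%N.
Proof.
rewrite /nb cardfsU1 -(add1n d); apply: leq_add; first exact: leq_b1.
exact/geq_card_fset_set/gr_deg.
Qed.

Lemma nb_refl x : x \in nb x. Proof. by apply/in_nb; left. Qed.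

Lemma nb_sym x y : (y \in nb x) = (x \in nb y).
Proof.
by apply/idP/idP => /in_nb[->|/gr_sym e]; rewrite ?nb_refl //; apply/in_nb; right.
Qed.

(** The single use of the projection theorem: the edges and the diagonal, restricted to targets in
    [A], have sections of at most [d + 1] points. The diagonal is Borel because codes have countably
    many bits. *)
Lemma nb_meas A : measurable A -> measurable [set x | exists2 y, y \in nb x & A y].
Proof.
move=> mA; pose E := (gr_edge G `|` [set p : X * X | p.2 = p.1]) `&` (setT `*` A).
have mD : measurable [set p : X * X | p.2 = p.1].
  have mX B : measurable B -> measurable ([set p | B p.1] : set (X * X)).
    move=> mB; rewrite (_ : mkset _ = B `*` setT); first exact: measurableX.
    by apply/seteqP; split=> p //= [].
  have mX2 B : measurable B -> measurable ([set p | B p.2] : set (X * X)).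
    move=> mB; rewrite (_ : mkset _ = setT `*` B); first exact: measurableX.
    by apply/seteqP; split=> p //= [].
  rewrite (_ : mkset _ = \bigcap_n \bigcup_b ([set p : X * X | [set x | gr_code x n = b] p.1]
      `&` [set p : X * X | [set x | gr_code x n = b] p.2])).
    apply: meas_bigcap => n; apply: meas_bigcup => b.
    by apply: measurableI; [apply: mX|apply: mX2]; exact: meas_code.
  apply/seteqP; split=> -[x y] /=; first by move=> -> n _; exists (gr_code x n).
  move=> h; apply: gr_code_inj; apply/funext => n.
  by have [b _ [/= -> ->]] := h n I.
have mE : measurable E.
  apply: measurableI; last exact: measurableX.
  by apply: measurableU => //; exact: gr_meas.
have aE x : atmost d.+1 (fun y => E (x, y)).
  move=> [f [f1 f2]].
  have : (size (mkseq f d.+2) <= size (nb x))%N.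
    apply: uniq_leq_size.
      apply/(uniqP (f 0%N)) => i j; rewrite !inE !size_mkseq => hi hj.
      by rewrite !nth_mkseq //; exact: f2.
    move=> y /mapP[i]; rewrite mem_iota add0n /= => hi ->.
    by have [[h|/= h] _] := f1 i hi; apply/in_nb; [right|left].
  by rewrite size_mkseq leqNgt ltnS nb_card.
have := measurable_finite_proj (@gr_standard _ _ G) mE aE.
congr measurable; apply/seteqP; split=> x.
  by move=> [y [[h|h] [_ Ay]]]; exists y => //; apply/in_nb; [right|left].
by move=> [y /in_nb[h|h] Ay]; exists y; split=> //; [right|left].
Qed.

Definition cylX (s : seq bool) : set X := [set y | mkseq (gr_code y) (size s) = s].

Lemma meas_cylX s : measurable (cylX s).
Proof.
rewrite (_ : cylX s = \bigcap_(i : 'I_(size s)) [set y | gr_code y i = nth false s i]).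
  by apply: meas_bigcap => i; exact: meas_code.
apply/seteqP; split=> y /=.
  by move=> e [i hi] _ /=; have := congr1 (fun t => nth false t i) e; rewrite nth_mkseq.
move=> h; apply: (@eq_from_nth _ false); rewrite size_mkseq // => i hi.
by rewrite nth_mkseq // (h (Ordinal hi) I).
Qed.

Lemma cylX_sep x (s : {fset X}) : exists n, forall y, y \in s ->
  mkseq (gr_code y) n = mkseq (gr_code x) n -> y = x.
Proof.
have /choice[N hN] : forall y, exists n, y <> x -> gr_code y n <> gr_code x n.
  move=> y; have [->|ne] := pselect (y = x); first by exists 0%N.
  apply: contrapT => h; apply: ne; apply: gr_code_inj; apply/funext => n.
  by apply: contrapT => hn; apply: h; exists n.
exists (\max_(y <- s) (N y).+1) => y ys e; apply: contrapT => /hN; apply.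
have l : (N y < \max_(y <- s) (N y).+1)%N by exact: (@leq_bigmax_seq _ _ predT (fun y => (N y).+1)).
have := congr1 (fun t => nth false t (N y)) e.
by rewrite !nth_mkseq.
Qed.

Definition uniq_nb s x := (exists2 y, y \in nb x & cylX s y) /\
  (forall y z, y \in nb x -> cylX s y -> z \in nb x -> cylX s z -> y = z).

(* Junk value [x] when the cylinder [s] does not isolate a neighbour of [x]. *)
Definition sel s x := if `[< uniq_nb s x >] then xget x [set y | y \in nb x /\ cylX s y] else x.

(** Two points differ exactly when equally long prefixes of their codes differ at some length, so
    non-uniqueness is a countable union of conditions covered by [nb_meas]. *)
Lemma meas_uniq_nb s : measurable [set x | uniq_nb s x].
Proof.
rewrite (_ : mkset _ = [set x | exists2 y, y \in nb x & cylX s y] `\`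
   \bigcup_(p : seq bool * seq bool) ([set _ | size p.1 = size p.2 /\ p.1 <> p.2] `&`
      ([set x | exists2 y, y \in nb x & (cylX s `&` cylX p.1) y] `&`
       [set x | exists2 y, y \in nb x & (cylX s `&` cylX p.2) y]))).
  apply: measurableD; first by apply: nb_meas; exact: meas_cylX.
  apply: meas_bigcup => p; apply: measurableI; first exact: meas_prop.
  by apply: measurableI; apply: nb_meas; apply: measurableI; exact: meas_cylX.
apply/seteqP; split=> x.
  move=> [h1 h2]; split=> // -[[t t'] _ [/= [est ne] [[y yn [ys yt]] [z zn [zs zt]]]]].
  by apply: ne; have := h2 y z yn ys zn zs => e; rewrite -yt -zt e est.
move=> [h1 h2]; split=> // y z yn ys zn zs; apply: contrapT => ne; apply: h2.
have [n hn] := cylX_sep z [fset y]%fset.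
exists (mkseq (gr_code y) n, mkseq (gr_code z) n) => //; split=> /=.
  by rewrite !size_mkseq; split=> // e; apply: ne; apply: hn => //; rewrite inE.
by split; [exists y|exists z] => //; split=> //; rewrite /cylX /= size_mkseq.
Qed.

Lemma sel_nb s x : sel s x \in nb x.
Proof.
rewrite /sel; case: asboolP => [[[y yn ys] _]|_]; last exact: nb_refl.
by have [] := @xgetI _ x [set y | y \in nb x /\ cylX s y] y (conj yn ys).
Qed.

Lemma borel_sel s : borel_map (sel s).
Proof.
move=> A mA.
rewrite (_ : _ @^-1` _ = ([set x | uniq_nb s x] `&` [set x | exists2 y, y \in nb x & (cylX s `&` A) y]) `|`
   (A `\` [set x | uniq_nb s x])).
  apply: measurableU; last by apply: measurableD => //; exact: meas_uniq_nb.
  apply: measurableI; first exact: meas_uniq_nb.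
  by apply: nb_meas; apply: measurableI => //; exact: meas_cylX.
apply/seteqP; split=> x; rewrite /sel /preimage /=.
  case: asboolP => [u|nu]; last by right.
  have [[y yn ys] _] := u.
  have [h1 h2] := @xgetI _ x [set y | y \in nb x /\ cylX s y] y (conj yn ys).
  by move=> h; left; split=> //; exists (xget x [set y | y \in nb x /\ cylX s y]).
case: asboolP => [u|nu] [[//= _ [y yn [ys Ay]]]|[//]].
have [_ uu] := u.
have [h1 h2] := @xgetI _ x [set y | y \in nb x /\ cylX s y] y (conj yn ys).
by rewrite (uu _ y h1 h2).
Qed.

Lemma sel_cover x y : y \in nb x -> exists s, sel s x = y.
Proof.
move=> yn; have [n hn] := cylX_sep y (nb x).
exists (mkseq (gr_code y) n).
have hs z : z \in nb x -> cylX (mkseq (gr_code y) n) z -> z = y.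
  by move=> zn; rewrite /cylX /= size_mkseq; exact: hn.
have ys : cylX (mkseq (gr_code y) n) y by rewrite /cylX /= size_mkseq.
rewrite /sel; case: asboolP => [_|[]]; last first.
  by split; [exists y|move=> z z' /hs h /h -> /hs h' /h' ->].
have [h1 h2] := @xgetI _ x [set z | z \in nb x /\ cylX (mkseq (gr_code y) n) z] y (conj yn ys).
exact: hs h1 h2.
Qed.

Definition selN n x := if choice.unpickle n is Some s then sel s x else x.

Lemma borel_selN n : borel_map (selN n).
Proof. by rewrite /selN => A mA; case: (choice.unpickle n) => [s|//]; exact: borel_sel. Qed.

Definition fresh (fs : seq (X -> X)) n x := selN n x \notin [seq f x | f <- fs].

(** A greedy enumeration: each new map takes the first selector giving an unlisted neighbour, and
    falls back on [x] when none is left. Starting from [id], [d] rounds exhaust the at most [d + 1]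
    points of [nb x]. *)
Fixpoint steps k : seq (X -> X) :=
  if k is k'.+1 then rcons (steps k') (first_case (fresh (steps k')) selN) else [:: id].

Lemma size_steps k : size (steps k) = k.+1.
Proof. by elim: k => //= k IH; rewrite size_rcons IH. Qed.

Lemma borel_steps k i : borel_map (nth id (steps k) i).
Proof.
elim: k i => [|k IH] i; first by case: i => [|i] A //=; rewrite nth_nil.
rewrite /= nth_rcons; case: ifP => // _; case: ifP => _; last by move=> A.
apply: borel_first_case; last exact: borel_selN.
move=> n; rewrite /fresh.
rewrite (_ : mkset _ = \bigcap_(j : 'I_k.+1) ~` [set x | selN n x = nth id (steps k) j x]).
  by apply: meas_bigcap => j; apply: measurableC; apply: borel_eq => //; exact: borel_selN.
apply/seteqP; split=> x /=.
  move=> /negP h j _ /= e; apply: h; rewrite e -(nth_map id x (fun f => f x)) ?size_steps //.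
  by rewrite mem_nth // size_map size_steps.
move=> h; apply/negP => /(nthP x)[j]; rewrite size_map size_steps => hj.
rewrite (nth_map id) ?size_steps // => /esym e.
exact: (h (Ordinal hj) I).
Qed.

Lemma steps_cover x y : (y \in nb x) = (y \in [seq f x | f <- steps d]).
Proof.
have sub k : {subset [seq f x | f <- steps k] <= nb x}.
  elim: k => [|k IH] z /=; first by rewrite inE => /eqP ->; exact: nb_refl.
  rewrite map_rcons mem_rcons inE => /orP[/eqP ->|/IH //].
  have [h|h] := pselect (exists n, fresh (steps k) n x); last by rewrite first_caseN // nb_refl.
  have [n [_ ->]] := first_caseP selN h; rewrite /selN.
  by case: choice.unpickle => [s|]; [exact: sel_nb|exact: nb_refl].
(* Repetitions begin only after every neighbour has been listed; without repetitions, [d + 1]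
   entries already fill [nb x]. *)
have alt k : uniq [seq f x | f <- steps k] \/ {subset nb x <= [seq f x | f <- steps k]}.
  elim: k => [|k [IH|IH]]; first by left.
  - rewrite /= map_rcons rcons_uniq IH andbT.
    have [h|h] := pselect (exists n, fresh (steps k) n x).
      by left; have [n [hn ->]] := first_caseP selN h.
    right=> z /sel_cover[s e]; rewrite mem_rcons inE; apply/orP; right.
    apply/negPn/negP => hz; apply: h; exists (choice.pickle s).
    by rewrite /fresh /selN choice.pickleK e.
  - by right=> z /IH; rewrite /= map_rcons mem_rcons inE => ->; rewrite orbT.
apply/idP/idP; last exact: sub.
have [u|h] := alt d; last exact: h.
have [|_ e] := uniq_min_size u (@sub d); first by rewrite size_map size_steps nb_card.
by rewrite e.
Qed.

Definition step (i : 'I_d.+1) : X -> X := nth id (steps d) i.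

Lemma borel_step i : borel_map (step i). Proof. exact: borel_steps. Qed.

(** Allows words to be padded, so that words of length exactly [n] reach the whole ball of radius
    [n]. *)
Lemma step0 x : step ord0 x = x.
Proof.
suff h k : nth id (steps k) 0 x = x by exact: h.
by elim: k => //= k IH; rewrite nth_rcons size_steps.
Qed.

Lemma stepP x y : reflect (exists i, step i x = y) (y \in nb x).
Proof.
rewrite steps_cover; apply: (iffP (nthP x)) => [[j]|[i <-]].
  rewrite size_map size_steps => hj; rewrite (nth_map id) ?size_steps // => <-.
  by exists (Ordinal hj).
by exists i; rewrite ?(nth_map id) ?size_map ?size_steps.
Qed.

End Nbhd.

(** * Balls and local functions *)

Section Ball.
Context (R : realType) (d : nat) (G : graphing R d).
Notation X := (gr_space G).
Implicit Types (x y z : X).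

Fixpoint gball n x : {fset X} :=
  if n is m.+1 then (\bigcup_(y <- gball m x) nb y)%fset else [fset x]%fset.

Lemma in_gball0 x y : (y \in gball 0 x) = (y == x).
Proof. by rewrite inE. Qed.

Lemma in_gballS n x y : reflect (exists2 z, z \in gball n x & y \in nb z) (y \in gball n.+1 x).
Proof.
apply: (iffP (bigfcupP _ _ _ _)) => [[z]|[z zn yz]]; first by rewrite andbT; exists z.
by exists z => //; rewrite zn.
Qed.

Lemma gball_refl n x : x \in gball n x.
Proof.
elim: n => [|n IH]; first by rewrite in_gball0.
by apply/in_gballS; exists x => //; exact: nb_refl.
Qed.

Lemma gball_trans m n x y z : y \in gball m x -> z \in gball n y -> z \in gball (m + n) x.
Proof.
move=> xy; elim: n z => [|n IH] z; first by rewrite in_gball0 addn0 => /eqP ->.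
by move=> /in_gballS[u /IH h hz]; rewrite addnS; apply/in_gballS; exists u.
Qed.

Lemma nb_gball1 x : gball 1 x = nb x.
Proof.
apply/fsetP => y; apply/in_gballS/idP => [[z]|h]; last by exists x; rewrite ?in_gball0.
by rewrite in_gball0 => /eqP ->.
Qed.

Lemma gball_mono m n x : (m <= n)%N -> {subset gball m x <= gball n x}.
Proof.
move=> mn y hy; rewrite -(subnKC mn); apply: gball_trans hy _.
exact: gball_refl.
Qed.

Lemma gball_sym n x y : (y \in gball n x) = (x \in gball n y).
Proof.
suff h a b : b \in gball n a -> a \in gball n b by apply/idP/idP; exact: h.
elim: n a b => [|n IH] a b; first by rewrite !in_gball0 eq_sym.
move=> /in_gballS[z /IH za bz]; rewrite -addn1 addnC; apply: gball_trans za.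
by rewrite nb_gball1 nb_sym.
Qed.

Lemma gball_card n x : (#|` gball n x| <= d.+1 ^ n)%N.
Proof.
elim: n x => [|n IH] x; first by rewrite /= cardfs1 expn0.
have -> : gball n.+1 x = (\bigcup_(y <- nb x) gball n y)%fset.
  apply/fsetP => z; rewrite gball_sym; apply/in_gballS/bigfcupP.
    by move=> [y zy xy]; exists y; rewrite ?andbT 1?nb_sym // gball_sym.
  by move=> [y + zy]; rewrite andbT => yx; exists y; rewrite 1?nb_sym // gball_sym.
apply: (@leq_trans (\sum_(y <- nb x) d.+1 ^ n)).
  elim: (enum_fset (nb x)) => [|y s IHs]; first by rewrite !big_nil cardfs0.
  rewrite !big_cons; apply: leq_trans (leq_add (IH y) IHs).
  by rewrite -cardfsUI leq_addr.
by rewrite big_const_seq count_predT iter_addn_0 expnSr leq_mul2l nb_card orbT.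
Qed.

Definition act (w : seq 'I_d.+1) x := foldl (fun x i => step i x) x w.

Lemma act_rcons w i x : act (rcons w i) x = step i (act w x).
Proof. by rewrite /act foldl_rcons. Qed.

Lemma borel_act w : borel_map (act w).
Proof.
elim: w => [|i w IH] A mA //.
by have := borel_step i (IH A mA).
Qed.

Lemma in_gball n x y : reflect (exists w : n.-tuple 'I_d.+1, act w x = y) (y \in gball n x).
Proof.
apply: (iffP idP) => [|[w <-]].
  elim: n y => [|n IH] y; first by rewrite in_gball0 => /eqP ->; exists [tuple].
  move=> /in_gballS[z /IH[w <-]] /stepP[i <-].
  by exists [tuple of rcons w i]; rewrite act_rcons.
case: w => w /= /eqP <-.
elim/last_ind: w => [|w i IH]; first exact: gball_refl.
rewrite size_rcons act_rcons; apply/in_gballS; exists (act w x) => //.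
by apply/stepP; exists i.
Qed.

Lemma gball_edge n x y z : y \in gball n x -> gr_edge G (y, z) -> z \in gball n.+1 x.
Proof. by move=> yx yz; apply/in_gballS; exists y => //; apply/in_nb; right. Qed.

Lemma gball_dist n x y : y \in gball n x <-> dist_le (edge_rel (gr_edge G)) n x y.
Proof.
split.
  elim: n y => [|n IH] y; first by rewrite in_gball0 => /eqP ->; exists [::].
  move=> /in_gballS[z /IH[p [p1 p2 p3]]] /in_nb[->|e].
    by exists p; split=> //; exact: leqW.
  exists (rcons p y); rewrite rcons_path p1 last_rcons size_rcons p2; split=> //.
  exact/mem_set.
move=> [p [pp <- h]]; apply: (gball_mono h).
move: pp {h}; elim/last_ind: p => [_|p z IH]; first exact: gball_refl.
rewrite size_rcons rcons_path last_rcons => /andP[/IH h /set_mem e].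
exact: gball_edge h e.
Qed.

End Ball.

(** * Isomorphisms of labelled balls *)

Section Iso.
Context (R : realType) (d : nat) (L : Type).
Implicit Types (G H : graphing R d).

(* Isomorphism of labelled [n]-balls, except that edges between two vertices at
   distance exactly [n] from the root need not be respected. *)
Definition niso G H (lG : gr_space G -> L) (lH : gr_space H -> L) n
    (x : gr_space G) (x' : gr_space H) (t : gr_space G -> gr_space H) : Prop :=
  [/\ t x = x',
      {in gball n x &, injective t},
      (forall j y, (j < n)%N -> y \in gball j x -> t @` nb y = nb (t y))%fset
    & forall y, y \in gball n x -> lH (t y) = lG y].

Context (G H : graphing R d) (lG : gr_space G -> L) (lH : gr_space H -> L).
Context (n : nat) (x : gr_space G) (x' : gr_space H) (t : gr_space G -> gr_space H).
Hypothesis it : niso lG lH n x x' t.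

Lemma niso_shift m r y : y \in gball m x -> (m + r <= n)%N -> niso lG lH r y (t y) t.
Proof.
case: it => tx ti tn tl ym mr; split=> //.
- move=> u v hu hv; apply: ti; apply: (gball_mono mr); exact: gball_trans ym _.
- move=> j u jr hu; apply: (tn (m + j)%N); last exact: gball_trans ym hu.
  by apply: leq_trans mr; rewrite ltn_add2l.
- by move=> u hu; apply: tl; apply: (gball_mono mr); exact: gball_trans ym hu.
Qed.

Lemma niso_mono r : (r <= n)%N -> niso lG lH r x x' t.
Proof.
case: (it) => tx _ _ _ rn; rewrite -tx; apply: (@niso_shift 0) => //.
exact: gball_refl.
Qed.

Lemma niso_gball r : (r <= n)%N -> (t @` gball r x)%fset = gball r x'.
Proof.
case: it => tx ti tn tl; elim: r => [|r IH] rn.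
  apply/fsetP => y; apply/imfsetP/idP; rewrite in_gball0.
    by move=> [z /=]; rewrite in_gball0 => /eqP -> ->; rewrite tx.
  by move=> /eqP ->; exists x => //=; rewrite in_gball0.
have {}IH := IH (ltnW rn).
apply/fsetP => y; apply/imfsetP/in_gballS.
  move=> [z /= /in_gballS[u hu zu] ->]; exists (t u).
    by rewrite -IH; apply/imfsetP; exists u.
  by rewrite -(tn r) //; apply/imfsetP; exists z.
move=> [u']; rewrite -IH => /imfsetP[u /= hu ->]; rewrite -(tn r) // => /imfsetP[z /= zu ->].
by exists z => //; apply/in_gballS; exists u.
Qed.

Lemma niso_label y : y \in gball n x -> lH (t y) = lG y.
Proof. by case: it => _ _ _; apply. Qed.

Lemma niso_inj : {in gball n x &, injective t}.
Proof. by case: it. Qed.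

Lemma niso_root : t x = x'. Proof. by case: it. Qed.


End Iso.

Lemma niso_gball_at (R : realType) d (L : Type) (G H : graphing R d) lG lH n x x' t
    (it : @niso R d L G H lG lH n x x' t) m r y :
  y \in gball m x -> (m + r <= n)%N -> (t @` gball r y)%fset = gball r (t y).
Proof. by move=> ym mr; apply: (niso_gball (niso_shift it ym mr)). Qed.

Lemma niso_mem (R : realType) d (L : Type) (G H : graphing R d) lG lH n x x' t
    (it : @niso R d L G H lG lH n x x' t) m r y z :
  z \in gball m x -> (m + r <= n)%N -> y \in gball n x ->
  (t y \in gball r (t z)) = (y \in gball r z).
Proof.
move=> zm mr yn; rewrite -(niso_gball_at it zm mr); apply/imfsetP/idP => [[u /= ur e]|yr].
  by rewrite (niso_inj it yn _ e) //; apply: gball_mono mr _ _; exact: gball_trans zm ur.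
by exists y.
Qed.

Lemma niso_forget (R : realType) d (L : Type) (G H : graphing R d) lG lH n x x' t :
  @niso R d L G H lG lH n x x' t -> niso (fun=> tt) (fun=> tt) n x x' t.
Proof. by case=> h1 h2 h3 h4; split. Qed.

(** * Local functions and finite patterns *)

Section Local.
Context (R : realType) (d : nat) (G : graphing R d) (L : finType) (l : gr_space G -> L).
Notation X := (gr_space G).
Hypothesis ml : forall a, measurable [set x | l x = a].

(** A finite-valued Borel record of the labelled ball: which words lead to the same vertex, and the
    labels at their ends. *)
Definition pattern n (x : X) : {ffun n.-tuple 'I_d.+1 * n.-tuple 'I_d.+1 -> bool} * {ffun n.-tuple 'I_d.+1 -> L} :=
  ([ffun p : n.-tuple 'I_d.+1 * n.-tuple 'I_d.+1 => act p.1 x == act p.2 x], [ffun w : n.-tuple 'I_d.+1 => l (act w x)]).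

Lemma meas_pattern n p : measurable [set x | pattern n x = p].
Proof.
rewrite (_ : mkset _ = (\bigcap_(w : n.-tuple 'I_d.+1 * n.-tuple 'I_d.+1) [set x | (act w.1 x == act w.2 x) = p.1 w])
   `&` \bigcap_(w : n.-tuple 'I_d.+1) [set x | l (act w x) = p.2 w]).
  apply: measurableI; apply: meas_bigcap => w; last exact: (borel_act w (ml _)).
  have h : measurable [set x : X | act w.1 x = act w.2 x] by apply: borel_eq; exact: borel_act.
  case: (p.1 w).
    by rewrite (_ : mkset _ = [set x : X | act w.1 x = act w.2 x]) //; apply/seteqP; split=> x /= /eqP.
  rewrite (_ : mkset _ = ~` [set x : X | act w.1 x = act w.2 x]); first exact: measurableC.
  by apply/seteqP; split=> x /= => [/eqP|/eqP/negbTE].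
apply/seteqP; split=> x /=.
  by move=> <-; split=> w _ /=; rewrite ffunE.
move=> [h1 h2]; rewrite [p]surjective_pairing; congr pair; apply/ffunP => w; rewrite ffunE.
  exact: h1 w I.
exact: h2 w I.
Qed.

(** The end of a word at [x] is sent to the end of the same word at [x']; equal coincidences make
    this well defined and injective. The additional letter shows the neighbours of the ends of
    [n]-letter words. *)
Lemma pattern_niso n (x x' : X) : pattern n.+1 x = pattern n.+1 x' ->
  exists t, niso l l n x x' t /\ forall w, (size w <= n)%N -> t (act w x) = act w x'.
Proof.
move=> e.
have e1 (u v : n.+1.-tuple 'I_d.+1) : (act u x == act v x) = (act u x' == act v x').
  by have /(congr1 fst)/ffunP/(_ (u, v)) := e; rewrite /= !ffunE.
have e2 (u : n.+1.-tuple 'I_d.+1) : l (act u x) = l (act u x').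
  by have /(congr1 snd)/ffunP/(_ u) := e; rewrite /= !ffunE.
have /choice[t ht] : forall y, exists y', forall w : n.+1.-tuple 'I_d.+1, act w x = y -> act w x' = y'.
  move=> y; have [[w wy]|h] := pselect (exists w : n.+1.-tuple 'I_d.+1, act w x = y).
    by exists (act w x') => v vy; apply/eqP; rewrite -e1 vy wy.
  by exists x => w wy; exfalso; apply: h; exists w.
have tE (w : n.+1.-tuple 'I_d.+1) : t (act w x) = act w x' by rewrite (ht _ w erefl).
have tN (w : n.-tuple 'I_d.+1) : t (act w x) = act w x'.
  by have := tE [tuple of rcons w ord0]; rewrite !act_rcons !step0.
have tP w : (size w <= n)%N -> t (act w x) = act w x'.
  move=> wn; have h k y : act (nseq k ord0) y = y.
    by elim: k => //= k IH; rewrite /act /= step0.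
  have sz : size (w ++ nseq (n.+1 - size w) ord0) == n.+1.
    by rewrite size_cat size_nseq subnKC // ltnW.
  have := tE (Tuple sz); rewrite /= /act !foldl_cat -!/(act _ _) !h.
  by [].
exists t; split; last exact: tP.
split.
- have h y : act (nseq n.+1 ord0) y = y.
    by elim: (n.+1) => //= k IH; rewrite /act /= step0.
  by move: (tE [tuple of nseq n.+1 ord0]); rewrite -/(nseq n.+1 ord0) !h.
- move=> y z /(gball_mono (leqnSn n))/in_gball[u <-] /(gball_mono (leqnSn n))/in_gball[v <-].
  by rewrite !tE => /eqP h; apply/eqP; rewrite e1.
- move=> j y jn /(gball_mono (ltnW jn))/in_gball[w <-]; rewrite tN.
  have tS i : t (step i (act w x)) = step i (act w x').
    by have := tE [tuple of rcons w i]; rewrite !act_rcons.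
  apply/fsetP => z; apply/imfsetP/stepP.
    by move=> [_ /= /stepP[i <-] ->]; exists i; rewrite tS.
  by move=> [i <-]; exists (step i (act w x)); [apply/stepP; exists i|rewrite tS].
- by move=> y /(gball_mono (leqnSn n))/in_gball[w <-]; rewrite tE e2.
Qed.

(* Functions determined by the labelled ball together with the pattern of
   coincidences of the words in the enumerating maps: local enough to be
   measurable, but depending on the enumeration. *)
Definition wlocal (U : Type) (f : X -> U) := exists n, forall x x' t, niso l l n x x' t ->
  (forall w, (size w <= n)%N -> t (act w x) = act w x') -> f x = f x'.

Definition local (U : Type) (f : X -> U) :=
  exists n, forall x x' t, niso l l n x x' t -> f x = f x'.

Lemma local_wlocal (U : Type) (f : X -> U) : local f -> wlocal f.
Proof. by move=> [n hf]; exists n => x x' t /hf ->. Qed.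

(** Patterns range over a finite type, so such a function has finitely many values; measurability
    and boundedness follow. *)
Lemma wlocal_factor (U : Type) (f : X -> U) : wlocal f ->
  exists n (g : _ -> U), forall x, f x = g (pattern n x).
Proof.
move=> [n hf]; exists n.+1.
have /choice[g hg] : forall p, exists u, forall x, pattern n.+1 x = p -> f x = u.
  move=> p; have [[x <-]|h] := pselect (exists x, pattern n.+1 x = p).
    by exists (f x) => y /pattern_niso[t [/hf h /h]].
  by exists (f point) => x hx; exfalso; apply: h; exists x.
by exists g => x; exact: hg.
Qed.

Lemma wlocal_meas (U : Type) (f : X -> U) (P : set U) : wlocal f -> measurable (f @^-1` P).
Proof.
move=> /wlocal_factor[n [g hg]].
rewrite (_ : _ @^-1` _ = \bigcup_p ([set x | pattern n x = p] `&` [set _ | P (g p)])).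
  by apply: meas_bigcup => p; apply: measurableI; [exact: meas_pattern|exact: meas_prop].
apply/seteqP; split=> x; rewrite /preimage /= hg; first by exists (pattern n x).
by move=> [p _ [/= -> ]].
Qed.

Lemma wlocal_bounded (f : X -> R) : wlocal f -> exists M : R, forall x, (`|f x| <= M)%R.
Proof.
move=> /wlocal_factor[n [g hg]]; exists (\sum_p `|g p|)%R => x.
rewrite hg (bigD1 (pattern n x)) //= lerDl; apply: sumr_ge0 => p _; exact: normr_ge0.
Qed.

End Local.

(** * Mass transport *)

Section Preserve.
Context (R : realType) (d : nat) (G : graphing R d).
Notation X := (gr_space G).
Notation mu := (gr_mu G).
Implicit Types (x y z : X) (A : set X).

Lemma meas_image_step i A : measurable A -> measurable (step i @` A).
Proof.
move=> mA.
rewrite (_ : _ @` _ = \bigcup_j ((step j @^-1` A) `&` [set y | step i (step j y) = y])).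
  apply: meas_bigcup => j; apply: measurableI; first exact: borel_step.
  apply: borel_eq => // B mB; exact: borel_step (borel_step _ mB).
apply/seteqP; split=> y.
  move=> [x Ax <-].
  have : x \in nb (step i x) by rewrite nb_sym; apply/stepP; exists i.
  by move=> /stepP[j e]; exists j => //; rewrite /preimage /= e.
by move=> [j _ [/= Aj e]]; exists (step j y).
Qed.

Lemma borel_ite (f g : X -> X) A : measurable A -> borel_map f -> borel_map g ->
  borel_map (fun x => if `[< A x >] then f x else g x).
Proof.
move=> mA mf mg B mB.
rewrite (_ : _ @^-1` _ = (A `&` f @^-1` B) `|` (g @^-1` B `\` A)).
  by apply: measurableU; [apply: measurableI => //; exact: mf|apply: measurableD => //; exact: mg].
apply/seteqP; split=> x; rewrite /preimage /=.
  by case: asboolP => [|] h1 h2; [left|right].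
by case: asboolP => h [[]|[]].
Qed.

(* The partial injection [step i] on [A] extends to an involution of the whole
   space that moves points along edges. *)
Lemma preserve_step_disjoint i A : measurable A -> {in A &, injective (step i)} ->
  (forall x, A x -> ~ A (step i x)) -> mu (step i @` A) = mu A.
Proof.
move=> mA iA dA.
(* A search through the enumerated neighbours finds a preimage of [x] in [A]; [g] goes back to it,
   and is the identity off the image. *)
pose J n x := (n < d.+1)%N && `[< A (step (inord n) x) /\ step i (step (inord n) x) = x >].
pose g := first_case J (fun n => step (inord n)).
pose T x := if `[< A x >] then step i x else g x.
have mJ n : measurable [set x | J n x].
  rewrite /J; case: (n < d.+1)%N => /=; last by rewrite (_ : mkset _ = set0) //; apply/seteqP; split.
  rewrite (_ : mkset _ = (step (inord n) @^-1` A) `&` [set y | step i (step (inord n) y) = y]).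
    apply: measurableI; first exact: borel_step.
    apply: borel_eq => // B mB; exact: borel_step (borel_step _ mB).
  by apply/seteqP; split=> x /= => [/asboolP|h] //; apply/asboolP.
have mg : borel_map g by apply: borel_first_case => // n; exact: borel_step.
have mT : borel_map T by apply: borel_ite => //; exact: borel_step.
have gP x : (exists y, A y /\ step i y = x) -> A (g x) /\ step i (g x) = x.
  move=> [y [Ay e]].
  have : y \in nb x by rewrite nb_sym; apply/stepP; exists i.
  move=> /stepP[j ej].
  have [|n [/andP[_ /asboolP Jn] ge]] := @first_caseP _ _ J (fun n => step (inord n)) x.
    by exists j; rewrite /J ltn_ord /=; apply/asboolP; rewrite inord_val ej.
  by rewrite /g ge.
have gN x : ~ (exists y, A y /\ step i y = x) -> g x = x.
  move=> h; apply: first_caseN => -[n /andP[_ /asboolP[h1 h2]]]; apply: h.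
  by exists (step (inord n) x).
have TA x : A x -> T x = step i x by rewrite /T; case: asboolP.
have TN x : ~ A x -> T x = g x by rewrite /T; case: asboolP.
have TT x : T (T x) = x.
  have [Ax|nAx] := pselect (A x).
    rewrite (TA x Ax) (TN _ (dA x Ax)).
    have [|h1 h2] := gP (step i x); first by exists x.
    by apply: iA; [exact/mem_set|exact/mem_set|exact: h2].
  rewrite (TN _ nAx); have [h|h] := pselect (exists y, A y /\ step i y = x).
    by have [h1 h2] := gP x h; rewrite TA.
  by rewrite gN // TN // gN.
have gE x : g x = x \/ gr_edge G (x, g x).
  rewrite /g; have [h|h] := pselect (exists n, J n x); last by rewrite first_caseN //; left.
  have [n [_ ->]] := first_caseP (fun n => step (inord n)) h.
  by have /in_nb : step (inord n) x \in nb x by apply/stepP; exists (inord n).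
have mi := meas_image_step i mA.
have := @gr_preserve _ _ G T _ _ _ _ mi.
rewrite (_ : T @^-1` (step i @` A) = A); last first.
  apply/seteqP; split=> x; rewrite /preimage /T /=.
    case: asboolP => // nAx [y Ay e].
    have [h|h] := pselect (exists y, A y /\ step i y = x).
      by have [h1 _] := gP x h; case: (dA y Ay); rewrite e.
    by rewrite (gN _ h) in e; case: h; exists y.
  by move=> Ax; case: asboolP => // _; exists x.
move=> ->//.
- by move=> _ B mB; rewrite setTI; exact: mT.
- by exists T.
- move=> x; rewrite /T; case: asboolP => // Ax.
  by have /in_nb : step i x \in nb x by apply/stepP; exists i.
Qed.

(** Fixed points contribute trivially. Any other point differs from its image in some bit of the
    code, and prescribing this bit makes a piece disjoint from its image. *)
Lemma preserve_step i A : measurable A -> {in A &, injective (step i)} ->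
  mu (step i @` A) = mu A.
Proof.
move=> mA iA.
(* The index [k.+1] encodes the bit position [k./2] together with the value [odd k] of that bit at
   [x]; index 0 is kept for the fixed points. *)
pose F m : set X := if m is k.+1 then
   A `&` ([set x | gr_code x k./2 = odd k] `&` [set x | gr_code (step i x) k./2 = ~~ odd k])
  else A `&` [set x | step i x = x].
have mF m : measurable (F m).
  case: m => [|k]; apply: measurableI => //; first by apply: borel_eq => //; exact: borel_step.
  apply: measurableI; first exact: meas_code.
  exact: (borel_step i (meas_code _ _ _)).
pose P := seqDU F.
have PF m : P m `<=` F m by exact: subset_seqDU.
have FA m : F m `<=` A by case: m => [|k] x [].
have mP m : measurable (P m).
  by apply: measurableD => //; apply: bigsetU_measurable.
have AP : A = \bigcup_m P m.
  rewrite /P -seqDU_bigcup_eq; apply/seteqP; split=> x; last by move=> [m _ /FA].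
  move=> Ax; have [e|ne] := pselect (step i x = x); first by exists 0%N.
  have [k hk] : exists k, gr_code (step i x) k <> gr_code x k.
    apply: contrapT => h; apply: ne; apply: gr_code_inj; apply/funext => k.
    by apply: contrapT => hk; apply: h; exists k.
  exists (k.*2 + gr_code x k).+1 => //=; split=> //=.
  have -> : (k.*2 + gr_code x k)./2 = k by rewrite addnC half_bit_double.
  have -> : odd (k.*2 + gr_code x k) = gr_code x k by rewrite oddD odd_double oddb.
  by split=> //; move: hk; case: (gr_code x k); case: gr_code.
have iP m : {in P m &, injective (step i)}.
  by move=> x y /set_mem hx /set_mem hy; apply: iA; apply/mem_set/(FA m)/PF.
have dP : trivIset setT P by exact: trivIset_seqDU.
have E1 m : mu (step i @` P m) = mu (P m).
  case: m (PF m) (iP m) (mP m) => [|k] sP iPm mPm.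
    suff -> : step i @` P 0%N = P 0%N by [].
    apply/seteqP; split=> y; first by move=> [x Px <-]; have [_ /= ->] := sP _ Px.
    by move=> Py; exists y => //; have [_ /= ->] := sP _ Py.
  apply: preserve_step_disjoint => // x Px Px'.
  have [_ [_ /= h1]] := sP _ Px; have [_ [/= h2 _]] := sP _ Px'.
  by move: h1; rewrite h2; case: odd.
have -> : step i @` A = \bigcup_m (step i @` P m) by rewrite AP image_bigcup.
rewrite [in RHS]AP !measure_bigcup //.
- by apply: eq_eseriesr => m _; exact: E1.
- by move=> m _; exact: meas_image_step.
- apply/trivIsetP => m n _ _ mn; rewrite -subset0 => y [[x Px <-] [x' Px' e]].
  have xx : x' = x by apply: iA => //; apply/mem_set; rewrite AP; [exists n|exists m].
  move/trivIsetP: dP => /(_ m n I I mn); rewrite -subset0 => /(_ x); apply.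
  by split=> //; rewrite -xx.
Qed.

Lemma preserve_act w A : measurable A -> {in A &, injective (act w)} ->
  measurable (act w @` A) /\ mu (act w @` A) = mu A.
Proof.
move=> mA; elim/last_ind: w => [|w i IH] iA.
  by rewrite (_ : act [::] @` A = A) //; exact: image_id.
have iw : {in A &, injective (act w)}.
  by move=> x y hx hy e; apply: iA => //; rewrite !act_rcons e.
have [m1 e1] := IH iw.
have -> : act (rcons w i) @` A = step i @` (act w @` A).
  rewrite image_comp; apply: eq_imagel => x _; exact: act_rcons.
split; first exact: meas_image_step.
rewrite preserve_step // => _ _ /set_mem[x Ax <-] /set_mem[y Ay <-] e.
by rewrite (iA x y (mem_set Ax) (mem_set Ay)) // !act_rcons.
Qed.

End Preserve.

Local Open Scope ring_scope.

(** * Means of bounded measurable functions *)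

Section Mean.
Context (R : realType) (d : nat) (G : graphing R d).
Notation X := (gr_space G).
Notation mu := (gr_mu G).
Implicit Types (x y z : X) (A : set X) (f g : X -> R).

Definition mean f : R := \int[mu]_x f x.

Definition bmeas f := measurable_fun setT f /\ exists M : R, forall x, `|f x| <= M.

Lemma bmeas_integrable f : bmeas f -> mu.-integrable setT (EFin \o f).
Proof.
move=> [mf [M hM]]; apply: measurable_bounded_integrable => //.
  by apply: (@le_lt_trans _ _ 1%E); [exact: probability_le1|rewrite ltry]. 
exists M; split; first exact: num_real.
by move=> N MN x _; apply: le_trans (hM x) (ltW MN).
Qed.

Lemma bmeas_cst (r : R) : bmeas (fun=> r).
Proof. by split; [exact: measurable_cst|exists `|r|]. Qed.

Lemma bmeas_add f g : bmeas f -> bmeas g -> bmeas (fun x => f x + g x).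
Proof.
move=> [mf [M hM]] [mg [N hN]]; split; first exact: measurable_funD.
by exists (M + N) => x; apply: le_trans (ler_normD _ _) (lerD _ _).
Qed.

Lemma bmeas_mul f g : bmeas f -> bmeas g -> bmeas (fun x => f x * g x).
Proof.
move=> [mf [M hM]] [mg [N hN]]; split; first exact: measurable_funM.
by exists (M * N) => x; rewrite normrM; apply: ler_pM.
Qed.

Lemma bmeas_scale (r : R) f : bmeas f -> bmeas (fun x => r * f x).
Proof. by apply: bmeas_mul; exact: bmeas_cst. Qed.

Lemma bmeas_sum (I : Type) (r : seq I) (P : pred I) (F : I -> X -> R) :
  (forall i, P i -> bmeas (F i)) -> bmeas (fun x => \sum_(i <- r | P i) F i x).
Proof.
move=> hF; elim: r => [|i r IH].
  rewrite (_ : (fun x => _) = (fun=> 0)); first exact: bmeas_cst.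
  by apply/funext => x; rewrite big_nil.
case Pi : (P i).
  rewrite (_ : (fun x => _) = (fun x => F i x + \sum_(j <- r | P j) F j x)).
    by apply: bmeas_add => //; exact: hF.
  by apply/funext => x; rewrite big_cons Pi.
rewrite (_ : (fun x => _) = (fun x => \sum_(j <- r | P j) F j x)) //.
by apply/funext => x; rewrite big_cons Pi.
Qed.

Definition ind A x : R := (`[< A x >])%:R.

Lemma ind_setI A B x : ind (A `&` B) x = ind A x * ind B x.
Proof.
rewrite /ind -natrM mulnb; congr (nat_of_bool _)%:R.
apply/asboolP/andP => [[a b]|[/asboolP a /asboolP b]]; last by [].
by split; apply/asboolP.
Qed.

Lemma ind_setC A x : ind (~` A) x = 1 - ind A x.
Proof.
rewrite /ind (_ : `[< (~` A) x >] = ~~ `[< A x >]); last exact: asbool_neg.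
by case: asboolP => _; rewrite ?subrr ?subr0.
Qed.

Lemma indE A x : ind A x = \1_A x.
Proof. by rewrite /ind indicE; congr (nat_of_bool _)%:R; apply/asboolP/idP => [/mem_set|/set_mem]. Qed.

Lemma bmeas_ind A : measurable A -> bmeas (ind A).
Proof.
move=> mA; split.
  by rewrite (_ : ind A = \1_A); [exact: measurable_indic|apply/funext => x; exact: indE].
by exists 1 => x; rewrite /ind; case: asboolP; rewrite ?normr1 ?normr0.
Qed.

Lemma mean_ind A : measurable A -> mean (ind A) = fine (mu A).
Proof.
move=> mA; rewrite /mean /Rintegral; congr fine.
under eq_integral do rewrite indE.
by rewrite integral_indic // setIT.
Qed.

Lemma mean_cst (r : R) : mean (fun=> r) = r.
Proof.
rewrite /mean Rintegral_cst // -[RHS]mulr1; congr (_ * _).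
exact: (congr1 fine (probability_setT mu)).
Qed.

Lemma mean_add f g : bmeas f -> bmeas g -> mean (fun x => f x + g x) = mean f + mean g.
Proof. by move=> /bmeas_integrable hf /bmeas_integrable hg; rewrite /mean RintegralD. Qed.

Lemma mean_sub f g : bmeas f -> bmeas g -> mean (fun x => f x - g x) = mean f - mean g.
Proof. by move=> /bmeas_integrable hf /bmeas_integrable hg; rewrite /mean RintegralB. Qed.

Lemma mean_scale (r : R) f : bmeas f -> mean (fun x => r * f x) = r * mean f.
Proof. by move=> /bmeas_integrable hf; rewrite /mean RintegralZl. Qed.

Lemma mean_le f g : bmeas f -> bmeas g -> (forall x, f x <= g x) -> mean f <= mean g.
Proof. by move=> /bmeas_integrable hf /bmeas_integrable hg h; apply: le_Rintegral. Qed.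

Lemma mean_ge0 f : (forall x, 0 <= f x) -> 0 <= mean f.
Proof. by move=> h; apply: Rintegral_ge0. Qed.

Lemma eq_mean f g : f =1 g -> mean f = mean g.
Proof. by move=> /funext ->. Qed.

Lemma mean_sum (I : Type) (r : seq I) (P : pred I) (F : I -> X -> R) :
  (forall i, P i -> bmeas (F i)) ->
  mean (fun x => \sum_(i <- r | P i) F i x) = \sum_(i <- r | P i) mean (F i).
Proof.
move=> hF; elim: r => [|i r IH].
  rewrite [RHS]big_nil -[RHS](mean_cst 0); by apply: eq_mean => x; rewrite big_nil.
rewrite big_cons; case Pi : (P i).
  rewrite -IH -mean_add; [|exact: hF|exact: bmeas_sum].
  by apply: eq_mean => x; rewrite big_cons Pi.
by rewrite -IH; apply: eq_mean => x; rewrite big_cons Pi.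
Qed.

Lemma bmeas_wlocal (L : finType) (l : X -> L) f :
  (forall a, measurable [set x | l x = a]) -> wlocal l f -> bmeas f.
Proof.
move=> ml lf; split; last exact: wlocal_bounded lf.
by move=> _ A mA; rewrite setTI; exact: wlocal_meas lf.
Qed.

(** The function is a finite combination of indicators of patterns, which reduces the change of
    variables to preservation of measure by [act w]. *)
Lemma mean_act (L : finType) (l : X -> L) w A f :
  (forall a, measurable [set x | l x = a]) ->
  measurable A -> {in A &, injective (act w)} -> wlocal l f ->
  mean (fun x => ind A x * f (act w x)) = mean (fun x => ind (act w @` A) x * f x).
Proof.
move=> ml mA iA /(wlocal_factor)[n [g hg]].
pose P p := [set x | pattern l n x = p].
have mP p : measurable (P p) by exact: meas_pattern.
have fE x : f x = \sum_p g p * ind (P p) x.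
  rewrite hg (bigD1 (pattern l n x)) //= big1 ?addr0.
    by rewrite /ind; case: asboolP => [_|[]] //; rewrite mulr1.
  by move=> p np; rewrite /ind; case: asboolP => [h|_]; rewrite ?mulr0 //; rewrite -h eqxx in np.
have mQ p : measurable (A `&` act w @^-1` P p) by apply: measurableI => //; exact: borel_act.
have [mi _] := preserve_act mA iA.
transitivity (mean (fun x => \sum_p g p * ind (A `&` act w @^-1` P p) x)).
  apply: eq_mean => x; rewrite fE mulr_sumr; apply: eq_bigr => p _.
  by rewrite mulrCA ind_setI.
transitivity (mean (fun x => \sum_p g p * ind ((act w @` A) `&` P p) x)); last first.
  apply: eq_mean => x; rewrite fE mulr_sumr; apply: eq_bigr => p _.
  by rewrite mulrCA ind_setI.
rewrite !mean_sum; last 2 first.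
- by move=> p _; apply: bmeas_scale; apply: bmeas_ind; exact: measurableI.
- by move=> p _; apply: bmeas_scale; exact: bmeas_ind.
apply: eq_bigr => p _; rewrite !mean_scale; last 2 first.
- by apply: bmeas_ind; exact: measurableI.
- exact: bmeas_ind.
rewrite !mean_ind //; last exact: measurableI.
congr (_ * fine _).
have iQ : {in A `&` act w @^-1` P p &, injective (act w)}.
  by move=> x y /set_mem[hx _] /set_mem[hy _]; apply: iA; exact/mem_set.
have [_ <-] := preserve_act (mQ p) iQ.
congr (mu _); apply/seteqP; split=> y.
  by move=> [x [Ax Px] <-]; split=> //; exists x.
by move=> [[x Ax <-] Px]; exists x.
Qed.

End Mean.

Local Open Scope ring_scope.

(** * The mass transport principle *)

Section MassTransport.
Context (R : realType) (d : nat) (G : graphing R d) (L : finType) (l : gr_space G -> L).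
Notation X := (gr_space G).
Hypothesis ml : forall a, measurable [set x | l x = a].
Implicit Types (x y z : X).

Definition plocal m (F : X -> X -> R) := exists n, forall x x' t, niso l l n x x' t ->
  forall y, y \in gball m x -> F x y = F x' (t y).

Context (m : nat).
Notation W := (m.-tuple 'I_d.+1).

Definition first_word (u : W) x y :=
  (act u x == y) && [forall w : W, (enum_rank w < enum_rank u)%N ==> (act w x != y)].

Lemma first_word_sum x y : y \in gball m x -> \sum_(u : W) (first_word u x y)%:R = 1 :> R.
Proof.
move=> /in_gball[u0 /eqP hu0].
pose u := [arg min_(u < u0 | act u x == y) (enum_rank u : nat)].
have [hu mu] : act u x == y /\ forall w : W, act w x == y -> (enum_rank u <= enum_rank w)%N.
  by rewrite /u; case: arg_minnP.
rewrite (bigD1 u) //= big1 ?addr0.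
  rewrite /first_word hu; case: forallP => // -[] w; apply/implyP => wu.
  by apply/negP => /mu; rewrite leqNgt wu.
move=> v vu; rewrite /first_word; case: eqP => //= /eqP hv.
case: forallP => // /(_ u); rewrite hu implybF -leqNgt => h; case/eqP: vu.
by apply: enum_rank_inj; apply/val_inj/eqP; rewrite /= eqn_leq h mu.
Qed.

Lemma sum_fset1 (S : {fset X}) a (F : X -> R) : a \in S ->
  (forall y, y != a -> F y = 0) -> \sum_(y <- S) F y = F a.
Proof.
move=> aS h; rewrite (big_fsetD1 a) //= big_seq big1 ?addr0 // => y.
by rewrite !inE => /andP[/h].
Qed.

Lemma act_gball (u : W) x : act u x \in gball m x.
Proof. by apply/in_gball; exists u. Qed.

(** [F] is split according to the first word [u] from [x] to [y] and the first word [v] back. On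
    each piece [act u] is injective, with inverse [act v], so the mass moves along a
    measure-preserving partial map. *)
Lemma mass_transport F : plocal m F ->
  mean (fun x => \sum_(y <- gball m x) F x y) = mean (fun x => \sum_(y <- gball m x) F y x).
Proof.
move=> [n hF].
pose K (u v : W) x y : R := (first_word u x y)%:R * (first_word v y x)%:R * F x y.
have FK x y : y \in gball m x -> F x y = \sum_u \sum_v K u v x y.
  move=> hy; have hx : x \in gball m y by rewrite gball_sym.
  rewrite -[LHS]mul1r -[X in X * _ = _](first_word_sum hy) mulr_suml; apply: eq_bigr => u _.
  rewrite -[LHS]mulr1 -[X in _ * X = _](first_word_sum hx) mulr_sumr; apply: eq_bigr => v _.
  by rewrite /K mulrAC.
have K1 u v x : \sum_(y <- gball m x) K u v x y = K u v x (act u x).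
  apply: sum_fset1; first exact: act_gball.
  by move=> y ne; rewrite /K /first_word eq_sym (negbTE ne) !mul0r.
have K2 u v x : \sum_(y <- gball m x) K u v y x = K u v (act v x) x.
  apply: sum_fset1; first exact: act_gball.
  by move=> y ne; rewrite /K /first_word [act v x == y]eq_sym (negbTE ne) mulr0 mul0r.
have wK2 u v : wlocal l (fun x => K u v (act v x) x).
  exists (n + m + m)%N => x x' t it tw.
  have inj a b : (size a <= n + m + m)%N -> (size b <= n + m + m)%N ->
      (act a x == act b x) = (act a x' == act b x').
    move=> sa sb; rewrite -(tw _ sa) -(tw _ sb).
    have mem (w : seq 'I_d.+1) : (size w <= n + m + m)%N -> act w x \in gball (n + m + m) x.
      move=> sw; apply: (gball_mono sw); apply/in_gball.
      by exists (in_tuple w).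
    by apply/eqP/eqP => [->//|]; apply: (niso_inj it); exact: mem.
  have fwE (w v' : W) : (act w (act v' x) == x) = (act w (act v' x') == x').
    have := inj (v' ++ w) [::]; rewrite /act !foldl_cat /= => -> //.
    by rewrite size_cat !size_tuple -addnA leq_addl.
  have fwE2 (w : W) : (act w x == act v x) = (act w x' == act v x').
    by apply: inj; rewrite size_tuple leq_addl.
  congr (_ * _ * _).
  - rewrite /first_word fwE; congr (nat_of_bool (_ && _))%:R.
    by apply: eq_forallb => w; rewrite fwE.
  - rewrite /first_word fwE2; congr (nat_of_bool (_ && _))%:R.
    by apply: eq_forallb => w; rewrite fwE2.
  - have hv : act v x \in gball m x by exact: act_gball.
    have tx : t x = x' := niso_root it.
    have tv : t (act v x) = act v x' by rewrite tw // size_tuple leq_addl.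
    have it' : niso l l n (act v x) (act v x') t.
      rewrite -tv; apply: (niso_shift it hv); lia.
    by rewrite (hF _ _ _ it') ?tx // gball_sym.
have hbm f : wlocal l f -> bmeas f by exact: bmeas_wlocal.
(* The sources of the piece [(u, v)]; outside this set, [K u v x (act u x)] vanishes. *)
pose A u v := [set x | first_word u x (act u x) /\ first_word v (act u x) x].
have k2A u v x : K u v x (act u x) = ind (A u v) x * K u v (act v (act u x)) (act u x).
  rewrite /ind; case: asboolP => [[h1 h2]|h].
    by have /andP[/eqP e _] := h2; rewrite mul1r e.
  rewrite mul0r /K; case E1 : (first_word _ _ _); rewrite ?mul0r //.
  by case E2 : (first_word _ _ _); rewrite ?mulr0 ?mul0r //; case: h.
have mA u v : measurable (A u v).
  have wA : wlocal l (fun x => first_word u x (act u x) && first_word v (act u x) x).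
    exists (m + m)%N => x x' t it tw.
    have inj a b : (size a <= m + m)%N -> (size b <= m + m)%N ->
        (act a x == act b x) = (act a x' == act b x').
      move=> sa sb; rewrite -(tw _ sa) -(tw _ sb).
      have mem (w : seq 'I_d.+1) : (size w <= m + m)%N -> act w x \in gball (m + m) x.
        move=> sw; apply: (gball_mono sw); apply/in_gball.
        by exists (in_tuple w).
      by apply/eqP/eqP => [->//|]; apply: (niso_inj it); exact: mem.
    have fwE (w : W) : (act w (act u x) == x) = (act w (act u x') == x').
      have := inj (u ++ w) [::]; rewrite /act !foldl_cat /= => -> //.
      by rewrite size_cat !size_tuple.
    have fwE2 (w : W) : (act w x == act u x) = (act w x' == act u x').
      by apply: inj; rewrite size_tuple leq_addl.
    rewrite /first_word fwE2 fwE; congr (_ && _ && (_ && _)).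
      by apply: eq_forallb => w; rewrite fwE2.
    by apply: eq_forallb => w; rewrite fwE.
  have := wlocal_meas ml [set true] wA; congr measurable.
  by apply/seteqP; split=> x; rewrite /preimage /= => /andP.
have iA u v : {in A u v &, injective (act u)}.
  by move=> x y /set_mem[_ /andP[/eqP e _]] /set_mem[_ /andP[/eqP e' _]] h; rewrite -e -e' h.
transitivity (\sum_u \sum_v mean (fun x => K u v x (act u x))).
  rewrite (@eq_mean _ _ _ _ (fun x => \sum_u \sum_v K u v x (act u x))); last first.
    move=> x; rewrite (eq_big_seq _ (FK x)) exchange_big; apply: eq_bigr => u _.
    by rewrite exchange_big; apply: eq_bigr => v _; rewrite K1.
  have bK u v : bmeas (fun x => K u v x (act u x)).
    rewrite (_ : (fun x => _) = (fun x => ind (A u v) x * K u v (act v (act u x)) (act u x))); last exact/funext.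
    apply: bmeas_mul; first exact: bmeas_ind.
    have [mf [M hM]] := hbm _ (wK2 u v).
    split; last by exists M.
    move=> _ B mB; rewrite setTI; have := borel_act u (mf measurableT B mB).
    by rewrite setTI.
  rewrite mean_sum; first by apply: eq_bigr => u _; rewrite mean_sum.
  by move=> u _; apply: bmeas_sum => v _.
rewrite exchange_big /=.
rewrite (@eq_mean _ _ _ (fun x => \sum_(y <- gball m x) F y x) (fun x => \sum_v \sum_u K u v (act v x) x)); last first.
  move=> x; rewrite exchange_big /= (@eq_big_seq _ _ _ _ _ _ (fun y => \sum_u \sum_v K u v y x)); last first.
    by move=> y hy; apply: FK; rewrite gball_sym.
  rewrite exchange_big; apply: eq_bigr => u _.
  by rewrite exchange_big; apply: eq_bigr => v _; rewrite K2.
rewrite mean_sum; last by move=> v _; apply: bmeas_sum => u _; exact: hbm.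
apply: eq_bigr => v _; rewrite mean_sum; last by move=> u _; exact: hbm.
apply: eq_bigr => u _.
rewrite (eq_mean (k2A u v)) (mean_act ml (mA u v) (@iA u v) (wK2 u v)).
apply: eq_mean => x; rewrite /ind; case: asboolP => [_|h]; rewrite ?mul1r // mul0r /K.
case E1 : (first_word _ _ _); rewrite ?mul0r //.
case E2 : (first_word _ _ _); rewrite ?mulr0 ?mul0r //; case: h.
have /andP[/eqP e1 _] := E1.
by exists (act v x); rewrite // /A /= e1.
Qed.

End MassTransport.

Local Open Scope ring_scope.

(** * Transfer along weak equivalence *)

Section Transfer.
Context (R : realType) (d : nat).
Implicit Types (G H : graphing R d).

Notation uiso := (@niso R d unit _ _ (fun=> tt) (fun=> tt)).

Lemma ball_isoP r G (alpha : rooted_ball d r) (x : gr_space G) :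
  ball_iso alpha x <-> exists f : 'I_(rb_order alpha) -> gr_space G,
    [/\ injective f, forall y, y \in gball r x <-> exists i, f i = y,
        f (rb_root alpha) = x
      & forall i j, rb_adj alpha i j <-> gr_edge G (f i, f j)].
Proof.
split=> [[f [[f1 f2 f3] fr fe]]|[f [f1 f2 fr fe]]]; exists f; split=> //.
- by move=> i j; apply: f2; exact/mem_set.
- move=> y; split=> [/gball_dist /f3 [i _ <-]|[i <-]]; first by exists i.
  by apply/gball_dist; apply: f1.
- split; first by move=> i _; apply/gball_dist; rewrite f2; exists i.
    by move=> i j _ _; exact: f1.
  by move=> y /gball_dist/f2[i <-]; exists i.
Qed.

Lemma ball_iso_trans r G H (a b : rooted_ball d r)
    (x : gr_space G) (y : gr_space H) :
  ball_iso a x -> ball_iso a y -> ball_iso b y -> ball_iso b x.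
Proof.
move=> /ball_isoP[f [f1 f2 f3 f4]] /ball_isoP[g [g1 g2 g3 g4]] /ball_isoP[h [h1 h2 h3 h4]].
have /choice[s hs] : forall i, exists k, g k = h i.
  by move=> i; apply/g2; rewrite h2; exists i.
have /choice[s' hs'] : forall k, exists i, h i = g k.
  by move=> i; apply/h2; rewrite g2; exists i.
apply/ball_isoP; exists (f \o s); split.
- by move=> i j /= /f1 e; apply: h1; rewrite -!hs e.
- move=> z; rewrite f2; split=> [[k <-]|[i <-]]; last by exists (s i).
  by exists (s' k) => /=; congr f; apply: g1; rewrite hs hs'.
- by rewrite /= -f3; congr f; apply: g1; rewrite hs h3 g3.
- by move=> i j; rewrite h4 -!hs -g4 f4.
Qed.

Lemma ball_iso_niso n G H (a : rooted_ball d n.+1) (x : gr_space G) (x' : gr_space H) :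
  ball_iso a x -> ball_iso a x' -> exists t, uiso n x x' t.
Proof.
move=> /ball_isoP[f [f1 f2 f3 f4]] /ball_isoP[g [g1 g2 g3 g4]].
have /choice[t ht] : forall y, exists y', forall i, f i = y -> y' = g i.
  move=> y; have [[i fi]|h] := pselect (exists i, f i = y).
    by exists (g i) => j fj; congr g; apply: f1; rewrite fi.
  by exists x' => i fi; case: h; exists i.
have tf i : t (f i) = g i by rewrite (ht _ i).
have tn y z : y \in gball n.+1 x -> z \in gball n.+1 x -> z \in nb y -> t z \in nb (t y).
  move=> /f2[i <-] /f2[j <-] /in_nb[/f1 ->|e]; first by rewrite nb_refl.
  by rewrite !tf; apply/in_nb; right; apply/g4/f4.
have tg j y : (j <= n.+1)%N -> y \in gball j x -> t y \in gball j x'.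
  elim: j y => [|j IH] y jn.
    by rewrite !in_gball0 => /eqP ->; rewrite -f3 tf g3.
  move=> /in_gballS[z zj yz]; apply/in_gballS; exists (t z); first exact: IH (ltnW jn) zj.
  apply: tn => //; first exact: gball_mono (ltnW jn) _ zj.
  by apply: gball_mono jn _ _; apply/in_gballS; exists z.
exists t; split=> //.
- by rewrite -f3 tf g3.
- move=> y z /(gball_mono (leqnSn n))/f2[i <-] /(gball_mono (leqnSn n))/f2[j <-].
  by rewrite !tf => /g1 ->.
- move=> j y jn yj; apply/fsetP => z'.
  have yn : y \in gball n x by exact: gball_mono (ltnW jn) _ yj.
  have yn1 : y \in gball n.+1 x by exact: gball_mono (leqnSn n) _ yn.
  apply/imfsetP/idP => [[z /= zy ->]|zy].
    by apply: tn => //; apply/in_gballS; exists y.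
  have : z' \in gball n.+1 x' by apply/in_gballS; exists (t y) => //; exact: tg.
  move=> /g2[i ei]; exists (f i); last by rewrite tf.
  have /f2[k ek] := yn1; rewrite -ek /=.
  move: zy; rewrite -ek -ei tf => /in_nb[/g1 ->|e]; first by rewrite nb_refl.
  by apply/in_nb; right; apply/f4/g4.
Qed.

(** The radius grows by one because a rooted ball is an induced subgraph, while [niso] does not
    control edges inside the last sphere. *)
Lemma niso_ball_iso n G H (a : rooted_ball d n) (x : gr_space G) (x' : gr_space H) t :
  uiso n.+1 x x' t -> ball_iso a x -> ball_iso a x'.
Proof.
move=> it /ball_isoP[f [f1 f2 f3 f4]]; apply/ball_isoP; exists (t \o f).
have fb i : f i \in gball n x by rewrite f2; exists i.
have fb1 i : f i \in gball n.+1 x by exact: gball_mono (leqnSn n) _ (fb i).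
split.
- by move=> i j /= /(niso_inj it (fb1 i) (fb1 j)) /f1.
- move=> y; rewrite -(niso_gball it (leqnSn n)); split.
    by move=> /imfsetP[z /= /f2[i <-] ->]; exists i.
  by move=> [i <-]; apply/imfsetP; exists (f i).
- by rewrite /= f3 (niso_root it).
- move=> i j; rewrite f4.
  have := niso_mem it (r := 1) (fb i) _ (fb1 j); rewrite addn1 leqnn => /(_ isT).
  rewrite !nb_gball1 => h; split=> e.
    have : f j \in nb (f i) by apply/in_nb; right.
    rewrite -h => /in_nb[/(niso_inj it (fb1 _) (fb1 _)) ff|//].
    by rewrite ff in e; have := gr_irr e.
  have : t (f j) \in nb (t (f i)) by apply/in_nb; right.
  rewrite h => /in_nb[ff|//].
  by rewrite /= ff in e; have := gr_irr e.
Qed.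

Lemma ball_iso_ex r G (x : gr_space G) : exists a : rooted_ball d r, ball_iso a x.
Proof.
pose s := enum_fset (gball r x); pose n := size s.
have us : uniq s by exact: fset_uniq.
have xs : x \in s by exact: gball_refl.
pose f (i : 'I_n) := nth x s i.
have fi : injective f by move=> i j /eqP; rewrite nth_uniq // => /eqP/val_inj.
have fs y : y \in s -> exists i, f i = y.
  by move=> ys; have h : (index y s < n)%N by [rewrite index_mem]; exists (Ordinal h); rewrite /f nth_index.
have [k0 fk0] := fs x xs.
pose adj : rel 'I_n := fun i j => `[< gr_edge G (f i, f j) >].
have adjP i j : adj i j <-> gr_edge G (f i, f j) by split=> /asboolP.
have adjS : symmetric adj by move=> i j; apply/idP/idP => /adjP/gr_sym/adjP.
have adjI : irreflexive adj by move=> i; apply/negbTE/negP => /adjP/gr_irr.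
have adjD i : (#|[set j | adj i j]%SET| <= d)%N.
  have h : ([fset f j | j in [set j | adj i j]%SET] `<=` fset_set [set y | gr_edge G (f i, y)]%classic)%fset.
    apply/fsubsetP => y /imfsetP[j /=]; rewrite inE => /adjP e ->.
    by rewrite in_fset_set; [exact/mem_set|exact: gr_nbr_finite].
  have := fsubset_leq_card h; rewrite card_imfset // => h'.
  apply: leq_trans (geq_card_fset_set (gr_deg (f i))).
  by apply: leq_trans h'; rewrite cardE.
have adjT i : dist_le adj r k0 i.
  have : f i \in gball r x by have : f i \in s by exact: mem_nth.
  suff H j : (j <= r)%N -> forall i, f i \in gball j x -> dist_le adj j k0 i by exact: H.
  elim: j => [|j IH] jr k.
    by rewrite in_gball0 -fk0 => /eqP/fi ->; exists [::].
  move=> /in_gballS[z zj /in_nb e].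
  have [l fl] := fs z (gball_mono (ltnW jr) zj).
  rewrite -fl in zj e; have [p [p1 p2 p3]] := IH (ltnW jr) l zj.
  case: e => [/fi ->|e]; first by exists p; split=> //; exact: leqW.
  exists (rcons p k); rewrite rcons_path last_rcons size_rcons p1 p2; split=> //.
  exact/adjP.
exists (RootedBall adjS adjI adjD adjT).
apply/ball_isoP; exists f; split=> //= y; split=> [/fs //|[i <-]].
exact: mem_nth.
Qed.

Definition ulocal (U : Type) (f : forall G, gr_space G -> U) := exists n,
  forall G H (x : gr_space G) (x' : gr_space H) t, uiso n x x' t -> f G x = f H x'.

Lemma meas_unit G (a : unit) : measurable [set x : gr_space G | tt = a].
Proof. exact: meas_prop. Qed.

Lemma meas_ball_iso r G (a : rooted_ball d r) : measurable [set x : gr_space G | ball_iso a x].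
Proof.
have h : local (fun=> tt) (fun x : gr_space G => `[< ball_iso a x >]).
  exists r.+1 => x x' t it; apply/asboolP/asboolP; first exact: niso_ball_iso it.
  move=> h; have [b hb] := ball_iso_ex r x.
  by apply: (ball_iso_trans hb _ h); exact: niso_ball_iso it hb.
have := wlocal_meas (@meas_unit G) [set true] (local_wlocal h).
by congr measurable; apply/seteqP; split=> x; rewrite /preimage /= => /asboolP.
Qed.

(** The isomorphism type is a local function, hence factors through the finite type of patterns;
    this replaces a count of finite rooted graphs. *)
Lemma ball_iso_cover r G : exists (T : finType) (a : T -> rooted_ball d r),
  forall x : gr_space G, exists i, ball_iso (a i) x.
Proof.
have lG : local (fun=> tt) (fun (x : gr_space G) (a : rooted_ball d r) => ball_iso a x).
  exists r.+1 => x x' t it; apply/funext => a; apply/propext; split; first exact: niso_ball_iso it.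
  move=> h; have [b hb] := ball_iso_ex r x.
  by apply: (ball_iso_trans hb _ h); exact: niso_ball_iso it hb.
have [n [g hg]] := wlocal_factor (local_wlocal lG).
have [a0 _] := ball_iso_ex r (point : gr_space G).
have /choice[a ha] : forall p, exists a, (exists a, g p a) -> g p a.
  move=> p; have [[a ga]|h] := pselect (exists a, g p a); first by exists a.
  by exists a0.
exists _, a => x; exists (pattern (fun=> tt) n x).
have [b hb] := ball_iso_ex r x.
have := ha (pattern (fun=> tt) n x); rewrite -hg; apply; by exists b.
Qed.

(** A local function is constant on each ball type, so its mean is a finite sum of values times
    probabilities of types. *)
Lemma transfer G H (f : forall G, gr_space G -> R) : weakly_equivalent G H ->
  ulocal f -> mean (f G) = mean (f H).
Proof.
move=> we uf; have [n hf] := uf.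
have [TG [aG hG]] := ball_iso_cover n.+1 G.
have [TH [aH hH]] := ball_iso_cover n.+1 H.
(* Types are listed from both graphings, since one occurring in a single graphing must still be
   matched with a null set there. The list may repeat a type, which [P] corrects by keeping the
   first occurrence. *)
pose a (i : TG + TH) := match i with inl i => aG i | inr i => aH i end.
pose B (K : graphing R d) i := [set x : gr_space K | ball_iso (a i) x].
pose P (K : graphing R d) i := B K i `\` \bigcup_(j : TG + TH) ([set _ | enum_rank j < enum_rank i]%N `&` B K j).
have mB (K : graphing R d) i : measurable (B K i) by exact: meas_ball_iso.
have mP (K : graphing R d) i : measurable (P K i).
  apply: measurableD => //; apply: meas_bigcup => j.
  by apply: measurableI => //; exact: meas_prop.
have /choice[c hc] : forall i, exists c, (forall x, B G i x -> f G x = c) /\ (forall x, B H i x -> f H x = c).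
  move=> i; have [[x Bx]|h] := pselect (exists x, B G i x).
    by exists (f G x); split=> y By; have [t /hf->] := ball_iso_niso By Bx.
  have [[x Bx]|h'] := pselect (exists x, B H i x).
    by exists (f H x); split=> y By; have [t /hf->] := ball_iso_niso By Bx.
  by exists 0; split=> x Bx; [case: h|case: h']; exists x.
have fE (K : graphing R d) (hK : forall i x, B K i x -> f K x = c i) (cK : forall x : gr_space K, exists i, B K i x) :
    mean (f K) = \sum_i c i * fine (gr_mu K (P K i)).
  rewrite (@eq_mean _ _ _ _ (fun x => \sum_i c i * ind (P K i) x)).
    rewrite mean_sum; last by move=> i _; apply: bmeas_scale; exact: bmeas_ind.
    by apply: eq_bigr => i _; rewrite mean_scale ?mean_ind //; exact: bmeas_ind.
  move=> x; have [i0 hi0] := cK x.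
  pose i := [arg min_(i < i0 | `[< B K i x >]) (enum_rank i : nat)].
  have [hi mi] : B K i x /\ forall j, B K j x -> (enum_rank i <= enum_rank j)%N.
    rewrite /i; case: arg_minnP => [|j /asboolP hj mj]; first exact/asboolP.
    by split=> // k /asboolP/mj.
  rewrite (bigD1 i) //= big1 ?addr0.
    rewrite /ind; case: asboolP => [_|[]]; first by rewrite mulr1; exact: hK.
    by split=> // -[j _ [/= ji /mi]]; rewrite leqNgt ji.
  move=> j ji; rewrite /ind; case: asboolP => [[Bj nj]|_]; rewrite ?mulr0 //.
  exfalso; apply: nj; exists i => //; split=> //=.
  rewrite ltn_neqAle mi // andbT; apply: contraNneq ji => e.
  by apply/eqP/enum_rank_inj/val_inj.
rewrite (fE G) ?(fE H).
- apply: eq_bigr => i _; congr (_ * fine _).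
  (* One point where [P] loses something of [B] shows that type [i] repeats an earlier type; then
     [P] is empty at [i] in every graphing. *)
  have dich (K K' : graphing R d) : (exists x, B K i x /\ ~ P K i x) -> P K' i = set0.
    move=> [x [Bx nP]]; have [j [ji Bj]] : exists j, (enum_rank j < enum_rank i)%N /\ B K j x.
      apply: contrapT => h; apply: nP; split=> // -[j _ [/= ji Bj]]; apply: h; by exists j.
    apply/seteqP; split=> // y [By []]; exists j => //; split=> //.
    exact: (ball_iso_trans By Bx Bj).
  have [h|h] := pselect (exists x, B G i x /\ ~ P G i x); first by rewrite !(dich _ _ h) !measure0.
  have [h'|h'] := pselect (exists x, B H i x /\ ~ P H i x); first by rewrite !(dich _ _ h') !measure0.
  have E (K : graphing R d) : ~ (exists x, B K i x /\ ~ P K i x) -> P K i = B K i.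
    move=> hK; apply/seteqP; split=> x; first by case.
    by move=> Bx; apply: contrapT => nP; apply: hK; exists x.
  by rewrite (E G h) (E H h'); exact: we.
- by move=> i x; have [_] := hc i; apply.
- by move=> x; have [i hi] := hH x; exists (inr i).
- by move=> i x; have [+ _] := hc i; apply.
- by move=> x; have [i hi] := hG x; exists (inl i).
Qed.

End Transfer.

Local Open Scope ring_scope.
Local Open Scope fset_scope.

(** * Local functions of rooted finite sets *)

Section Families.
Context (R : realType) (d : nat).
Implicit Types (G H : graphing R d).

Definition rsets k G (x : gr_space G) : {fset {fset gr_space G}} :=
  [fset K in fpowerset (gball k x) | x \in K].

Lemma in_rsets k G (x : gr_space G) (K : {fset gr_space G}) :
  (K \in rsets k x) = (K `<=` gball k x) && (x \in K).
Proof. by rewrite !inE /= fpowersetE. Qed.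

Lemma rsets_sub k G (x : gr_space G) (K : {fset gr_space G}) : K \in rsets k x -> K `<=` gball k x.
Proof. by rewrite in_rsets => /andP[]. Qed.

Lemma rsets_card k G (x : gr_space G) : (#|` rsets k x| <= 2 ^ (d.+1 ^ k))%N.
Proof.
apply: (@leq_trans #|` fpowerset (gball k x)|).
  by apply: fsubset_leq_card; apply/fsubsetP => K; rewrite !inE => /andP[].
by rewrite card_fpowerset leq_pexp2l // gball_card.
Qed.

Section Transport.
Context (L : Type) (G H : graphing R d) (l : gr_space G -> L) (l' : gr_space H -> L).
Context (n : nat) (x : gr_space G) (x' : gr_space H) (t : gr_space G -> gr_space H).
Hypothesis it : niso l l' n x x' t.

Lemma niso_sub K K' : K `<=` gball n x -> K' `<=` gball n x ->
  (t @` K `<=` t @` K') = (K `<=` K').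
Proof.
move=> /fsubsetP hK /fsubsetP hK'; apply/fsubsetP/fsubsetP => [h y yK|h _ /imfsetP[y /= yK ->]].
  have /imfsetP[z /= zK' e] : t y \in t @` K' by apply: h; apply/imfsetP; exists y.
  by rewrite (niso_inj it (hK _ yK) (hK' _ zK') e).
by apply/imfsetP; exists y => //; exact: h.
Qed.

Lemma niso_in y (K : {fset gr_space G}) : y \in gball n x -> K `<=` gball n x -> (t y \in t @` K) = (y \in K).
Proof.
move=> hy /fsubsetP hK; apply/imfsetP/idP => [[z /= zK e]|yK]; last by exists y.
by rewrite (niso_inj it hy (hK _ zK) e).
Qed.

Lemma niso_img_inj (K K' : {fset gr_space G}) : K `<=` gball n x -> K' `<=` gball n x ->
  t @` K = t @` K' -> K = K'.
Proof.
move=> hK hK' e; apply/eqP; rewrite eqEfsubset -(niso_sub hK hK') -(niso_sub hK' hK).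
by rewrite e fsubset_refl.
Qed.

Lemma niso_card (K : {fset gr_space G}) : K `<=` gball n x -> #|` t @` K| = #|` K|.
Proof. by move=> /fsubsetP hK; apply: card_in_imfset => y z /hK hy /hK hz; exact: (niso_inj it). Qed.

Lemma gball_sub m j z : z \in gball m x -> (m + j <= n)%N -> gball j z `<=` gball n x.
Proof.
move=> zm mj; apply/fsubsetP => y yz; apply: gball_mono mj _ _; exact: gball_trans zm yz.
Qed.

Lemma niso_sum m j z (F : gr_space H -> R) : z \in gball m x -> (m + j <= n)%N ->
  \sum_(y <- gball j (t z)) F y = \sum_(y <- gball j z) F (t y).
Proof.
move=> zm mj; rewrite -(niso_gball_at it zm mj) big_imfset //=.
have /fsubsetP h := gball_sub zm mj.
by move=> u v /h hu /h hv; exact: (niso_inj it).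
Qed.

Lemma niso_rsets m k z : z \in gball m x -> (m + k <= n)%N ->
  rsets k (t z) = (fun K : {fset gr_space G} => t @` K) @` rsets k z.
Proof.
move=> zm mk; have h := gball_sub zm mk.
have zn : z \in gball n x by apply: gball_mono zm; apply: leq_trans mk; rewrite leq_addr.
apply/fsetP => K'; apply/idP/imfsetP => [|[K /= + ->]]; rewrite !in_rsets -(niso_gball_at it zm mk).
  move=> /andP[/fsubsetP hK' zK'].
  pose K := [fset y in gball k z | t y \in K'].
  have Ks : K `<=` gball k z by apply/fsubsetP => y; rewrite !inE => /andP[].
  have eK : K' = t @` K.
    apply/fsetP => y'; apply/idP/imfsetP => [y'K|[y /= + ->]]; last by rewrite !inE => /andP[].
    have /imfsetP[y /= yk e] := hK' _ y'K.
    by exists y => //; rewrite !inE yk -e.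
  exists K => //=; rewrite in_rsets Ks /=.
  by rewrite -(niso_in zn (fsubset_trans Ks h)) -eK.
move=> /andP[Ks zK]; rewrite niso_sub ?Ks //=; last exact: fsubset_trans Ks h.
by apply/imfsetP; exists z.
Qed.

Lemma niso_sum_rsets m k z (F : {fset gr_space H} -> R) : z \in gball m x -> (m + k <= n)%N ->
  \sum_(K <- rsets k (t z)) F K = \sum_(K <- rsets k z) F (t @` K).
Proof.
move=> zm mk; rewrite (niso_rsets zm mk) big_imfset //=.
have h := gball_sub zm mk.
by move=> K K' /rsets_sub hK /rsets_sub hK'; apply: niso_img_inj; apply: fsubset_trans h.
Qed.

End Transport.

Context (L : finType).

(* Families over all labelled graphs, so that locality compares values across
   different graphings. *)
Definition local_pt U (f : forall G, (gr_space G -> L) -> gr_space G -> U) := exists n,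
  forall G l H l' x x' t, niso l l' n x x' t -> f G l x = f H l' x'.

Definition local_set k U (u : forall G, (gr_space G -> L) -> gr_space G -> {fset gr_space G} -> U) := exists n,
  forall G l H l' x x' t, niso l l' n x x' t -> forall K, K `<=` gball k x -> u G l x K = u H l' x' (t @` K).

Definition local_setpt k m U (b : forall G, (gr_space G -> L) -> gr_space G -> {fset gr_space G} -> gr_space G -> U) :=
  exists n, forall G l H l' x x' t, niso l l' n x x' t ->
  forall K y, K `<=` gball k x -> y \in gball m x -> b G l x K y = b H l' x' (t @` K) (t y).

Lemma local_setpt_op2 k m U V W (op : U -> V -> W) b c : local_setpt k m b -> local_setpt k m c ->
  local_setpt k m (fun G l x K y => op (b G l x K y) (c G l x K y)).
Proof.
move=> [n1 h1] [n2 h2]; exists (maxn n1 n2) => G l H l' x x' t it K y hK hy.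
rewrite (h1 _ _ _ _ _ _ _ (niso_mono it (leq_maxl _ _)) K y hK hy).
by rewrite (h2 _ _ _ _ _ _ _ (niso_mono it (leq_maxr _ _)) K y hK hy).
Qed.

Lemma local_set_op2 k U V W (op : U -> V -> W) b c : local_set k b -> local_set k c ->
  local_set k (fun G l x K => op (b G l x K) (c G l x K)).
Proof.
move=> [n1 h1] [n2 h2]; exists (maxn n1 n2) => G l H l' x x' t it K hK.
rewrite (h1 _ _ _ _ _ _ _ (niso_mono it (leq_maxl _ _)) K hK).
by rewrite (h2 _ _ _ _ _ _ _ (niso_mono it (leq_maxr _ _)) K hK).
Qed.

Lemma local_set_op1 k U V (op : U -> V) b : local_set k b ->
  local_set k (fun G l x K => op (b G l x K)).
Proof.
by move=> [n1 h1]; exists n1 => G l H l' x x' t it K hK; rewrite (h1 _ _ _ _ _ _ _ it K hK).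
Qed.

Lemma local_pt_op2 U V W (op : U -> V -> W) f g : local_pt f -> local_pt g ->
  local_pt (fun G l x => op (f G l x) (g G l x)).
Proof.
move=> [n1 h1] [n2 h2]; exists (maxn n1 n2) => G l H l' x x' t it.
rewrite (h1 _ _ _ _ _ _ _ (niso_mono it (leq_maxl _ _))).
by rewrite (h2 _ _ _ _ _ _ _ (niso_mono it (leq_maxr _ _))).
Qed.

Lemma local_pt_op1 U V (op : U -> V) f : local_pt f -> local_pt (fun G l x => op (f G l x)).
Proof. by move=> [n h]; exists n => G l H l' x x' t /h ->. Qed.

Lemma local_set_at k m U u : @local_set k U u -> local_setpt k m (fun G l x K _ => u G l x K).
Proof. by move=> [n h]; exists n => G l H l' x x' t /h hh K y hK _; exact: hh. Qed.

Lemma local_pt_set k U f : @local_pt U f -> local_set k (fun G l x _ => f G l x).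
Proof. by move=> [n h]; exists n => G l H l' x x' t /h hh K _. Qed.

Lemma local_pt_at k m U f : @local_pt U f -> local_setpt k m (fun G l x _ y => f G l y).
Proof.
move=> [n h]; exists (m + n)%N => G l H l' x x' t it K y _ hy.
by apply: h; apply: (niso_shift it hy).
Qed.

Lemma local_setpt_mem k m : local_setpt k m (fun G l x K y => y \in K).
Proof.
exists (k + m)%N => G l H l' x x' t it K y hK hy; rewrite (niso_in it) //.
  exact: gball_mono (leq_addl _ _) _ hy.
by apply: fsubset_trans hK _; apply/fsubsetP; apply: gball_mono; exact: leq_addr.
Qed.

Lemma local_set_card k : local_set k (fun G l x K => #|` K|).
Proof. by exists k => G l H l' x x' t it K hK; rewrite (niso_card it). Qed.

(** A two-sided boundary: [x] may lie outside [K], as long as [K] splits its closed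
    neighbourhood. *)
Definition bdry G (K : {fset gr_space G}) (x : gr_space G) :=
  ~~ fdisjoint (nb x) K && ~~ (nb x `<=` K).

Lemma niso_nb G H l l' n x x' t k m (it : @niso R d L G H l l' n x x' t) (K : {fset gr_space G}) y :
  (k <= n)%N -> (m < n)%N -> K `<=` gball k x -> y \in gball m x ->
  [/\ K `<=` gball n x, nb y `<=` gball n x & nb (t y) = t @` nb y].
Proof.
move=> kn mn hK hy; split.
- by apply: fsubset_trans hK _; apply/fsubsetP; apply: gball_mono.
- by rewrite -nb_gball1; apply: gball_sub hy _; rewrite addn1.
- by rewrite -!nb_gball1 (niso_gball_at it hy) // addn1.
Qed.

Lemma local_setpt_meets k m : local_setpt k m (fun G l x K y => ~~ fdisjoint (nb y) K).
Proof.
exists (k + m).+1 => G l H l' x x' t it K y hK hy.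
have [hK' hn en] := niso_nb it (leqW (leq_addr m k)) (leq_addl k m : m < (k + m).+1)%N hK hy.
rewrite en; congr (~~ _).
apply/idP/idP => /fdisjointP h; apply/fdisjointP => z.
  by move=> /imfsetP[u /= un ->]; rewrite (niso_in it) ?h //; exact: (fsubsetP hn).
move=> zn; rewrite -(niso_in it (fsubsetP hn _ zn) hK'); apply: h.
by apply/imfsetP; exists z.
Qed.

Lemma local_setpt_nbsub k m : local_setpt k m (fun G l x K y => nb y `<=` K).
Proof.
exists (k + m).+1 => G l H l' x x' t it K y hK hy.
have [hK' hn en] := niso_nb it (leqW (leq_addr m k)) (leq_addl k m : m < (k + m).+1)%N hK hy.
by rewrite en (niso_sub it).
Qed.

Lemma local_setpt_bdry k m : local_setpt k m (fun G l x K y => bdry K y).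
Proof. exact: (local_setpt_op2 (fun a b => a && ~~ b) (local_setpt_meets k m) (local_setpt_nbsub k m)). Qed.

Lemma local_pt_sum_rsets k (u : forall G, (gr_space G -> L) -> gr_space G -> {fset gr_space G} -> R) :
  local_set k u -> local_pt (fun G l x => \sum_(K <- rsets k x) u G l x K).
Proof.
move=> [n h]; exists (k + n)%N => G l H l' x x' t it.
have <- := niso_root it.
rewrite (niso_sum_rsets it (m := 0)) ?in_gball0 ?eqxx ?leq_addr //.
apply: eq_big_seq => K /rsets_sub hK; apply: h hK.
by rewrite (niso_root it); apply: (niso_mono it); exact: leq_addl.
Qed.

Lemma local_set_sum k m (b : forall G, (gr_space G -> L) -> gr_space G -> {fset gr_space G} -> gr_space G -> R) :
  local_setpt k m b -> local_set k (fun G l x K => \sum_(y <- gball m x) b G l x K y).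
Proof.
move=> [n h]; exists (m + n)%N => G l H l' x x' t it K hK.
have <- := niso_root it.
rewrite (niso_sum it (m := 0)) ?in_gball0 ?eqxx ?leq_addr //.
apply: eq_big_seq => y hy; apply: h hK hy.
by rewrite (niso_root it); apply: (niso_mono it); exact: leq_addl.
Qed.

Lemma local_pt_sum_in k m (b : forall G, (gr_space G -> L) -> gr_space G -> {fset gr_space G} -> gr_space G -> R) :
  local_setpt k m b -> local_pt (fun G l x => \sum_(z <- gball m x) \sum_(K <- rsets k z) b G l z K x).
Proof.
move=> [n h]; exists (m + k + n)%N => G l H l' x x' t it.
have e := niso_root it.
rewrite -[in RHS]e (niso_sum it (m := 0)) ?in_gball0 ?eqxx //; last first.
  by rewrite -addnA leq_addr.
apply: eq_big_seq => z hz; rewrite (niso_sum_rsets it _ hz) ?leq_addr //.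
apply: eq_big_seq => K /rsets_sub hK; apply: h => //; last by rewrite gball_sym.
apply: (niso_shift it hz); by lia.
Qed.

Lemma local_pt_sum_out m (b : forall G, (gr_space G -> L) -> gr_space G -> R) :
  local_pt b -> local_pt (fun G l x => \sum_(z <- gball m x) b G l z).
Proof.
move=> [n h]; exists (m + n)%N => G l H l' x x' t it.
have e := niso_root it.
rewrite -[in RHS]e (niso_sum it (m := 0)) ?in_gball0 ?eqxx ?leq_addr //.
by apply: eq_big_seq => z hz; apply: h; apply: (niso_shift it hz).
Qed.

Section Labelled.
Context (G : graphing R d) (l : gr_space G -> L).
Hypothesis ml : forall a, measurable [set x | l x = a].

Lemma local_pt_wlocal U f : @local_pt U f -> wlocal l (f G l).
Proof. by move=> [n h]; exists n => x x' t it _; exact: h it. Qed.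

Lemma local_pt_bm f : @local_pt R f -> bmeas (f G l).
Proof. by move=> /local_pt_wlocal; exact: bmeas_wlocal. Qed.

(** The sender is the root [z] of a set and the receiver a vertex [x] near it: sums collected at a
    vertex become pairings over rooted sets. *)
Lemma mass_transport_sets k m (b : forall G, (gr_space G -> L) -> gr_space G -> {fset gr_space G} -> gr_space G -> R) :
  local_setpt k m b ->
  mean (fun x => \sum_(z <- gball m x) \sum_(K <- rsets k z) b G l z K x) =
  mean (fun z => \sum_(K <- rsets k z) \sum_(x <- gball m z) b G l z K x).
Proof.
move=> [n h]; rewrite -(@mass_transport _ _ _ _ _ ml m (fun z x => \sum_(K <- rsets k z) b G l z K x)).
  by apply: eq_mean => z; rewrite exchange_big.
exists (k + n)%N => x x' t it y hy.
have <- := niso_root it.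
rewrite (niso_sum_rsets it (m := 0)) ?in_gball0 ?eqxx ?leq_addr //.
apply: eq_big_seq => K /rsets_sub hK; apply: h hK hy.
by rewrite (niso_root it); apply: (niso_mono it); exact: leq_addl.
Qed.

End Labelled.
End Families.

Local Open Scope ring_scope.
Local Open Scope fset_scope.

(** * Components left by the cutting set *)

Section Components.
Context (R : realType) (d : nat).
Implicit Types (G H : graphing R d).

Definition kept_nb G (l : gr_space G -> bool) y : {fset gr_space G} :=
  [fset z in nb y | (z == y) || (~~ l y && ~~ l z)].

(* The [n]-ball of [x] after removing the edges incident to the labelled
   vertices; it is the whole component once components have at most [n]
   vertices. *)
Fixpoint cluster n G (l : gr_space G -> bool) x : {fset gr_space G} :=
  if n is m.+1 then \bigcup_(y <- cluster m l x) kept_nb l y else [fset x].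

Section One.
Context (G : graphing R d) (l : gr_space G -> bool).
Implicit Types (x y z : gr_space G).

Lemma in_kept_nb y z : (z \in kept_nb l y) = (z \in nb y) && ((z == y) || (~~ l y && ~~ l z)).
Proof. by rewrite !inE. Qed.

Lemma kept_nb_refl y : y \in kept_nb l y.
Proof. by rewrite in_kept_nb nb_refl eqxx. Qed.

Lemma kept_nb_sym y z : (z \in kept_nb l y) = (y \in kept_nb l z).
Proof. by rewrite !in_kept_nb nb_sym eq_sym [~~ l y && _]andbC. Qed.

Lemma in_clusterS n x y : reflect (exists2 z, z \in cluster n l x & y \in kept_nb l z) (y \in cluster n.+1 l x).
Proof.
apply: (iffP (bigfcupP _ _ _ _)) => [[z]|[z zn yz]]; first by rewrite andbT; exists z.
by exists z => //; rewrite zn.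
Qed.

Lemma cluster0 x y : (y \in cluster 0 l x) = (y == x).
Proof. by rewrite inE. Qed.

Lemma cluster_refl n x : x \in cluster n l x.
Proof.
elim: n => [|n IH]; first by rewrite cluster0.
by apply/in_clusterS; exists x => //; exact: kept_nb_refl.
Qed.

Lemma cluster_gball n x : cluster n l x `<=` gball n x.
Proof.
elim: n => [|n /fsubsetP IH]; apply/fsubsetP => y; first by rewrite cluster0 ?in_gball0.
move=> /in_clusterS[z /IH zn]; rewrite in_kept_nb => /andP[yz _].
by apply/in_gballS; exists z.
Qed.

Lemma cluster_rsets n x : cluster n l x \in rsets n x.
Proof. by rewrite in_rsets cluster_gball cluster_refl. Qed.

Lemma cluster_trans m n x y z : y \in cluster m l x -> z \in cluster n l y -> z \in cluster (m + n) l x.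
Proof.
move=> xy; elim: n z => [|n IH] z; first by rewrite cluster0 addn0 => /eqP ->.
by move=> /in_clusterS[u /IH h hz]; rewrite addnS; apply/in_clusterS; exists u.
Qed.

Lemma cluster_sym n x y : (y \in cluster n l x) = (x \in cluster n l y).
Proof.
suff h a b : b \in cluster n l a -> a \in cluster n l b by apply/idP/idP; exact: h.
elim: n a b => [|n IH] a b; first by rewrite !cluster0 eq_sym.
move=> /in_clusterS[z /IH za bz]; rewrite -addn1 addnC; apply: cluster_trans za.
by apply/in_clusterS; exists b; rewrite ?cluster0 // kept_nb_sym.
Qed.

Lemma cluster_mono m n x : (m <= n)%N -> cluster m l x `<=` cluster n l x.
Proof.
move=> mn; apply/fsubsetP => y hy; rewrite -(subnKC mn); apply: cluster_trans hy _.
exact: cluster_refl.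
Qed.

(** Until the clusters become stationary, each increase of the radius adds a point; the bound on
    cardinalities stops this by radius [n]. *)
Lemma cluster_stable n x : (forall y, (#|` cluster n l y| <= n)%N) -> cluster n.+1 l x = cluster n l x.
Proof.
move=> hc.
have step_ j : cluster j.+1 l x = cluster j l x -> cluster j.+2 l x = cluster j.+1 l x.
  by move=> e; rewrite [in LHS]/= -/(cluster j.+1 l x) e.
have fixed j m : cluster j.+1 l x = cluster j l x -> cluster (m + j).+1 l x = cluster (m + j) l x.
  by move=> e; elim: m => // m IH; rewrite addSn; exact: step_.
apply: contrapT => ne.
have big j : (j <= n)%N -> (j < #|` cluster j l x|)%N.
  elim: j => [|j IH] jn; first by rewrite cardfs1.
  apply: (leq_ltn_trans (IH (ltnW jn))); apply: fproper_ltn_card.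
  rewrite fproperEneq cluster_mono // andbT; apply/eqP => e; apply: ne.
  by have := fixed j (n - j)%N (esym e); rewrite subnK // ltnW.
by have := big n (leqnn n); rewrite ltnNge hc.
Qed.

Section Finite.
Context (k : nat) (hc : forall y, (#|` cluster k l y| <= k)%N).

Lemma cluster_closed x y : y \in cluster k l x -> kept_nb l y `<=` cluster k l x.
Proof. by move=> h; apply/fsubsetP => z hz; rewrite -cluster_stable //; apply/in_clusterS; exists y. Qed.

Lemma cluster_sub n x y : y \in cluster k l x -> cluster n l y `<=` cluster k l x.
Proof.
move=> h; elim: n => [|n /fsubsetP IH]; apply/fsubsetP => z; first by rewrite cluster0 => /eqP ->.
by move=> /in_clusterS[u /IH uk hz]; apply: (fsubsetP (cluster_closed uk)).
Qed.

Lemma cluster_eq x y : y \in cluster k l x -> cluster k l y = cluster k l x.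
Proof.
by move=> h; apply/eqP; rewrite eqEfsubset cluster_sub //=; apply: cluster_sub; rewrite cluster_sym.
Qed.

Lemma cluster_nb x : (forall u, u \in nb x -> ~~ l u) -> nb x `<=` cluster k l x.
Proof.
move=> h; apply: fsubset_trans (cluster_closed (cluster_refl k x)).
by apply/fsubsetP => y hy; rewrite in_kept_nb hy !h ?orbT // nb_refl.
Qed.

Let wt z : R := (#|` cluster k l z|%:R)^-1.

Lemma wt_gt0 y : 0 < wt y.
Proof. by rewrite invr_gt0 ltr0n cardfs_gt0; apply/fset0Pn; exists y; exact: cluster_refl. Qed.

Lemma sum_clusterE (S : {fset gr_space G}) y :
  \sum_(z <- S) (y \in cluster k l z)%:R * wt z = (size [seq z <- S | z \in cluster k l y])%:R * wt y :> R.
Proof.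
transitivity (\sum_(z <- S | z \in cluster k l y) wt y).
  rewrite [RHS]big_mkcond /=; apply: eq_bigr => z _; rewrite cluster_sym.
  by case: ifP => [/cluster_eq h|_]; rewrite ?mul0r // mul1r /wt h.
by rewrite -big_filter big_const_seq count_predT iter_addr_0 -[LHS]mulr_natl.
Qed.

Lemma sum_cluster (S : {fset gr_space G}) y :
  \sum_(z <- S) (y \in cluster k l z)%:R * wt z <= 1 :> R.
Proof.
rewrite sum_clusterE -ler_pdivlMr ?wt_gt0 // mul1r invrK ler_nat.
apply: uniq_leq_size; first by rewrite filter_uniq // fset_uniq.
by move=> z; rewrite mem_filter => /andP[].
Qed.

Lemma sum_cluster1 x : \sum_(z <- gball k x) (x \in cluster k l z)%:R * wt z = 1 :> R.
Proof.
apply/eqP; rewrite eq_le sum_cluster /= sum_clusterE -ler_pdivrMr ?wt_gt0 // mul1r invrK ler_nat.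
apply: uniq_leq_size; first exact: fset_uniq.
by move=> z hz; rewrite mem_filter hz (fsubsetP (cluster_gball k x)).
Qed.

(** Without labels on [nb x], this neighbourhood lies in one component and nothing splits it.
    Otherwise each of its at most [d + 1] points receives total weight at most 1, and a labelled
    point makes the right-hand sum at least 1. *)
Lemma sum_bdry m x : \sum_(z <- gball m x) (bdry (cluster k l z) x)%:R * wt z <=
  d.+1%:R * \sum_(u <- nb x) (l u)%:R :> R.
Proof.
have wt_ge0 z : 0 <= wt z by rewrite invr_ge0.
have [h|h] := pselect (forall u, u \in nb x -> ~~ l u).
  rewrite big1 ?mulr_ge0 ?sumr_ge0 // => z _.
  rewrite /bdry; case: (boolP (fdisjoint _ _)) => [|nd]; first by rewrite mul0r.
  have [y yn yz] : exists2 y, y \in nb x & y \in cluster k l z.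
    apply: contrapT => hy; move/negP: nd; apply; apply/fdisjointP => y yn.
    by apply/negP => yz; apply: hy; exists y.
  have yx : y \in cluster k l x by exact: (fsubsetP (cluster_nb h)).
  by rewrite -(cluster_eq yz) (cluster_eq yx) cluster_nb // mul0r.
have [u un lu] : exists2 u, u \in nb x & l u.
  by apply: contrapT => hu; apply: h => u un; apply/negP => lu; apply: hu; exists u.
apply: (@le_trans _ _ (d.+1%:R * 1)); last first.
  rewrite ler_wpM2l // (big_fsetD1 u) //= lu lerDl.
  by apply: sumr_ge0.
apply: (@le_trans _ _ (\sum_(z <- gball m x) \sum_(y <- nb x) (y \in cluster k l z)%:R * wt z)).
  apply: ler_sum => z _; rewrite /bdry; case: (boolP (fdisjoint _ _)) => [|nd] /=.
    by rewrite mul0r sumr_ge0 // => y _; rewrite mulr_ge0.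
  have [y yn yz] : exists2 y, y \in nb x & y \in cluster k l z.
    apply: contrapT => hy; move/negP: nd; apply; apply/fdisjointP => y yn.
    by apply/negP => yz; apply: hy; exists y.
  rewrite (big_fsetD1 y) //= yz mul1r.
  apply: (@le_trans _ _ (wt z)).
    by case: (nb x `<=` _); rewrite ?mul0r ?mul1r.
  by rewrite lerDl sumr_ge0 // => ? _; rewrite mulr_ge0.
rewrite exchange_big /= mulr1.
apply: (@le_trans _ _ (\sum_(y <- nb x) 1)).
  by apply: ler_sum => y _; exact: sum_cluster.
by rewrite big_const_seq count_predT iter_addr_0 ler_nat nb_card.
Qed.

End Finite.
End One.

Lemma niso_cluster G H (l : gr_space G -> bool) (l' : gr_space H -> bool) n x x' t :
  niso l l' n x x' t -> forall j, (j <= n)%N -> t @` cluster j l x = cluster j l' x'.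
Proof.
move=> it; elim=> [|j IH] jn.
  by rewrite /= imfset_fset1 (niso_root it).
have {}IH := IH (ltnW jn).
have nbE y : y \in cluster j l x -> t @` kept_nb l y = kept_nb l' (t y).
  move=> /(fsubsetP (cluster_gball l j x)) yj.
  have yn : y \in gball n x by exact: gball_mono (ltnW jn) _ yj.
  have nn u : u \in nb y -> u \in gball n x.
    by move=> uy; apply: (gball_mono jn); apply/in_gballS; exists y.
  have en : nb (t y) = t @` nb y.
    by rewrite -!nb_gball1 (niso_gball_at it yj) // addn1.
  apply/fsetP => z'; apply/imfsetP/idP.
    move=> [z /= + ->]; rewrite !in_kept_nb en => /andP[zy h].
    have zn := nn _ zy.
    rewrite (niso_label it yn) (niso_label it zn); apply/andP; split.
      by apply/imfsetP; exists z.
    by case/orP: h => [/eqP ->|->]; rewrite ?eqxx ?orbT.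
  rewrite in_kept_nb en => /andP[/imfsetP[z /= zy ->]].
  have zn := nn _ zy.
  rewrite (niso_label it yn) (niso_label it zn) => h; exists z => //.
  rewrite in_kept_nb zy /=; case/orP: h => [/eqP/(niso_inj it zn yn) ->|->]; by rewrite ?eqxx ?orbT.
apply/fsetP => z'; apply/imfsetP/in_clusterS.
  move=> [z /= /in_clusterS[y yj zy] ->]; exists (t y).
    by rewrite -IH; apply/imfsetP; exists y.
  by rewrite -nbE //; apply/imfsetP; exists z.
move=> [y']; rewrite -IH => /imfsetP[y /= yj ->]; rewrite -nbE // => /imfsetP[z /= zy ->].
by exists z => //; apply/in_clusterS; exists y.
Qed.

Lemma local_set_cluster k : @local_set R d bool k _ (fun G l x K => K == cluster k l x).
Proof.
exists k => G l H l' x x' t it K hK; rewrite -(niso_cluster it (leqnn k)).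
apply/eqP/eqP => [->//|]; apply: (niso_img_inj it) => //.
exact: cluster_gball.
Qed.

Lemma sum_rsets_cluster k G (l : gr_space G -> bool) x (F : {fset gr_space G} -> R) :
  \sum_(K <- rsets k x) (K == cluster k l x)%:R * F K = F (cluster k l x).
Proof.
rewrite (big_fsetD1 (cluster k l x)) ?cluster_rsets //= eqxx mul1r big_seq big1 ?addr0 // => K.
by rewrite !inE => /andP[/negbTE -> _]; rewrite mul0r.
Qed.

Lemma hyperfinite_cluster G (eps : R) : hyperfinite G -> 0 < eps ->
  exists (k : nat) (l : gr_space G -> bool),
    [/\ forall a, measurable [set x | l x = a]%classic,
        (mean (fun x => (l x)%:R) < eps)
      & forall y, (#|` cluster k l y| <= k)%N].
Proof.
move=> hG eps0; have [k [Z [_ mZ muZ hZ]]] := hG eps eps0.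
pose l x := `[< Z x >].
exists k, l; split.
- case; first by rewrite (_ : mkset _ = Z) //; apply/seteqP; split=> x /= => [/asboolP|h]//; apply/asboolP.
  rewrite (_ : mkset _ = ~` Z)%classic; first exact: measurableC.
  by apply/seteqP; split=> x /=; [move=> /negbT/asboolPn|move=> h; apply/negbTE/asboolPn].
- rewrite (_ : (fun x => _) = ind Z) // mean_ind //.
  by rewrite -lte_fin fineK // fin_num_measure.
- move=> y; have := geq_card_fset_set (hZ y).
  apply: leq_trans; apply: fsubset_leq_card; apply/fsubsetP => z.
  have sub n u : u \in cluster n l y -> component (edge_rel (gr_edge G `\` [set e | Z e.1 \/ Z e.2])%classic) y u.
    elim: n u => [|n IH] u; first by rewrite cluster0 => /eqP ->; exists [::].
    move=> /in_clusterS[v /IH[p p1 p2]]; rewrite in_kept_nb => /andP[/in_nb uv].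
    case/orP => [/eqP ->|/andP[/asboolPn lv /asboolPn lu]]; first by exists p.
    case: uv => [->|e]; first by exists p.
    exists (rcons p u); last by rewrite last_rcons.
    rewrite rcons_path p1 p2 /=; apply/mem_set; split=> //=; tauto.
  move=> /sub h; rewrite in_fset_set; first exact/mem_set.
  by apply/finite_set_leP; exists k; exact: hZ.
Qed.

End Components.

Local Open Scope fset_scope.
Local Open Scope ring_scope.

(** * The fractional partition *)

Section Optimization.
Context (R : realType) (d k : nat).
Implicit Types (G H : graphing R d).

Definition setfun := forall G, gr_space G -> {fset gr_space G} -> R.

Definition ulocal_set (w : setfun) := @local_set R d unit k R (fun G _ => w G).

Lemma ulocal_set_local_set (L : finType) w : ulocal_set w -> @local_set R d L k R (fun G _ => w G).
Proof. by move=> [n h]; exists n => G l H l' x x' t /niso_forget it; exact: h it. Qed.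

Lemma local_pt_ulocal (f : forall G, gr_space G -> R) : @local_pt R d unit R (fun G _ => f G) -> ulocal f.
Proof. by move=> [n h]; exists n => G H x x' t; exact: h. Qed.

Lemma sum_bound (I : eqType) (s : seq I) (F : I -> R) (C : R) n : 0 <= C -> (size s <= n)%N ->
  (forall i, i \in s -> `|F i| <= C) -> `|\sum_(i <- s) F i| <= n%:R * C.
Proof.
move=> C0 sn h; apply: le_trans (ler_norm_sum _ _ _) _.
apply: (@le_trans _ _ (\sum_(i <- s) C)).
  by rewrite big_seq [X in _ <= X]big_seq; apply: ler_sum => i /h.
rewrite big_const_seq count_predT iter_addr_0 -[X in X <= _]mulr_natl.
by rewrite ler_wpM2r // ler_nat.
Qed.

Section Near.
Context (G : graphing R d) (l : gr_space G -> bool).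
Hypothesis ml : forall a, measurable [set x | l x = a]%classic.

Let c1 (H : graphing R d) (l : gr_space H -> bool) x (K : {fset gr_space H}) : R := (K == cluster k l x)%:R.

Lemma local_set_c1 : local_set k c1.
Proof. exact: (local_set_op1 (fun b : bool => b%:R : R) (@local_set_cluster R d k)). Qed.

Definition lsetfun := forall H : graphing R d, (gr_space H -> bool) -> gr_space H -> {fset gr_space H} -> R.

Definition pairing (u : lsetfun) : R :=
  mean (fun x => \sum_(K <- rsets k x) u G l x K).

Lemma pairing_add (u v : lsetfun) : local_set k u -> local_set k v ->
  pairing (fun H l x K => u H l x K + v H l x K) = pairing u + pairing v.
Proof.
move=> lu lv; rewrite /pairing -mean_add.
- by apply: eq_mean => x; rewrite big_split.
- by have := local_pt_bm ml (local_pt_sum_rsets lu).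
- by have := local_pt_bm ml (local_pt_sum_rsets lv).
Qed.

Lemma pairing_scale (a : R) (u : lsetfun) : local_set k u ->
  pairing (fun H l x K => a * u H l x K) = a * pairing u.
Proof.
move=> lu; rewrite /pairing -mean_scale.
- by apply: eq_mean => x; rewrite mulr_sumr.
- by have := local_pt_bm ml (local_pt_sum_rsets lu).
Qed.

Lemma pairing_le (u v : lsetfun) : local_set k u -> local_set k v -> (forall x K, u G l x K <= v G l x K) ->
  pairing u <= pairing v.
Proof.
move=> lu lv uv; apply: mean_le.
- by have := local_pt_bm ml (local_pt_sum_rsets lu).
- by have := local_pt_bm ml (local_pt_sum_rsets lv).
- by move=> x; apply: ler_sum.
Qed.

Lemma eq_pairing (u v : lsetfun) : (forall x K, K \in rsets k x -> u G l x K = v G l x K) -> pairing u = pairing v.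
Proof. by move=> h; apply: eq_mean => x; apply: eq_big_seq => K; exact: h. Qed.

Let err (w : setfun) := pairing (fun H l x K => (w H x K - c1 l x K) ^+ 2).

Let D0 : R := (2 ^ (d.+1 ^ k))%:R.

(* Quantitative projection onto the local functions: perturbing an almost
   minimal [w] by [s * v] and [- s * v] bounds the inner product of the error
   with [v]. *)
Lemma near_minimizer (C delta : R) : 0 <= C -> 0 < delta ->
  exists w : setfun, [/\ ulocal_set w, forall H (x : gr_space H) K, 0 <= w H x K <= 1 &
    forall v : setfun, ulocal_set v -> (forall x K, K \in rsets k x -> `|v G x K| <= C) ->
      `|pairing (fun H l x K => (w H x K - c1 l x K) * v H x K)| <= delta].
Proof.
move=> C0 delta0.
pose S := [set r | exists w, ulocal_set w /\ r = err w]%classic.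
have sq0 u : 0 <= pairing (fun H l x K => (u H l x K) ^+ 2).
  by apply: mean_ge0 => x; apply: sumr_ge0 => K _; exact: sqr_ge0.
have iS : has_inf S.
  split; first by exists (err (fun _ _ _ => 0)), (fun _ _ _ => 0); split=> //; exists 0%N.
  by exists 0 => r [w [_ ->]]; exact: sq0.
pose q := C ^+ 2 * D0.
have q0 : 0 <= q by rewrite mulr_ge0 ?sqr_ge0 // ler0n.
(* With this [s], the slack [s * delta] above the infimum and the quadratic term, at most
   [s ^ 2 * q <= s * delta], bound [2 * s * |I|] by [2 * s * delta]. *)
pose s := delta / (q + 1).
have s0 : 0 < s by rewrite divr_gt0 // ltr_wpDl.
have sq : s * q <= delta.
  by rewrite /s mulrAC ler_pdivrMr ?ltr_wpDl // ler_wpM2l ?(ltW delta0) // lerDl.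
have [_ [w0 [lw0 ->]] hw0] := inf_adherent (mulr_gt0 s0 delta0) iS.
(* Truncation to the unit interval does not increase the error, the target being an indicator. *)
pose w : setfun := fun H x K => Num.max 0 (Num.min 1 (w0 H x K)).
have lw : ulocal_set w by exact: (local_set_op1 (fun r : R => Num.max 0 (Num.min 1 r)) lw0).
have lw' := ulocal_set_local_set bool lw.
have lw0' := ulocal_set_local_set bool lw0.
have lerr (u : setfun) : local_set k (fun H (_ : gr_space H -> bool) => u H) ->
    local_set k (fun H l x K => (u H x K - c1 l x K)).
  by move=> lu; exact: (local_set_op2 (fun a b : R => a - b) lu local_set_c1).
have hw : err w < inf S + s * delta.
  apply: le_lt_trans hw0; apply: pairing_le.
  - exact: (local_set_op1 (fun r : R => r ^+ 2) (lerr w lw')).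
  - exact: (local_set_op1 (fun r : R => r ^+ 2) (lerr w0 lw0')).
  - move=> x K; rewrite /w /c1 /Num.max /Num.min.
    by case: (K == _) => /=; case: (ltP 1 (w0 G x K)) => h1; case: ltP => h2; nra.
exists w; split=> //.
  move=> H x K; rewrite /w /Num.max /Num.min.
  by case: (ltP 1 (w0 H x K)) => h1; case: ltP => h2; apply/andP; split; lra.
move=> v lv bv.
have lv' := ulocal_set_local_set bool lv.
set I := pairing _.
pose Q := pairing (fun H l x K => (v H x K) ^+ 2).
have Qq : Q <= q.
  rewrite /Q /pairing -[q](mean_cst G); apply: mean_le.
  - by have := local_pt_bm ml (local_pt_sum_rsets (local_set_op1 (fun r : R => r ^+ 2) lv')).
  - exact: bmeas_cst.
  - move=> x; apply: le_trans (ler_norm _) _; rewrite /q mulrC.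
    apply: sum_bound; [exact: sqr_ge0|exact: rsets_card|].
    by move=> K /bv h; rewrite normrX lerXn2r ?nnegrE.
have key (e : R) : - (s * delta) <= 2 * e * I + e ^+ 2 * Q.
  pose we : setfun := fun H x K => w H x K + e * v H x K.
  have lwe : ulocal_set we by exact: (local_set_op2 (fun a b : R => a + e * b) lw lv).
  have h : inf S <= err we by apply: ge_inf; [case: iS|exists we].
  have E : err we = err w + (2 * e * I + e ^+ 2 * Q).
    rewrite /err /I /Q -pairing_scale; last exact: (local_set_op2 (fun a b : R => a * b) (lerr w lw') lv').
    rewrite -pairing_scale; last exact: (local_set_op1 (fun r : R => r ^+ 2) lv').
    rewrite -pairing_add; last 2 first.
    - exact: (local_set_op2 (fun a b : R => 2 * e * (a * b)) (lerr w lw') lv').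
    - exact: (local_set_op1 (fun r : R => e ^+ 2 * r ^+ 2) lv').
    rewrite -pairing_add; last 2 first.
    - exact: (local_set_op1 (fun r : R => r ^+ 2) (lerr w lw')).
    - exact: (local_set_op2 (fun a b : R => 2 * e * (a * b) + e ^+ 2 * b ^+ 2) (lerr w lw') lv').
    apply: eq_pairing => x K _; rewrite /we; ring.
  by move: h; rewrite E; lra.
have k1 := key s; have k2 := key (- s).
have b1 : s ^+ 2 * Q <= s * delta.
  by rewrite expr2 -mulrA ler_wpM2l ?(ltW s0) // (le_trans _ sq) // ler_wpM2l ?(ltW s0).
rewrite ler_norml; apply/andP; split.
  rewrite -(ler_pM2l s0); move: k1 b1; nra.
rewrite -(ler_pM2l s0); move: k2 b1; rewrite sqrrN; nra.
Qed.

End Near.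

Definition share G (K : {fset gr_space G}) (x : gr_space G) : R := (x \in K)%:R * (#|` K|%:R)^-1.
Definition bdry_share G (K : {fset gr_space G}) (x : gr_space G) : R := (bdry K x)%:R * (#|` K|%:R)^-1.

(* Total weight of the sets that contain [x]; [1] for an exact fractional
   partition. *)
Definition coverage (w : setfun) G (x : gr_space G) : R :=
  \sum_(z <- gball k x) \sum_(K <- rsets k z) w G z K * share K x.

(** Radius [k.+1]: a set splitting [nb x] contains a point of [nb x], which is within distance [k]
    of its root. *)
Definition boundary_mass (w : setfun) G (x : gr_space G) : R :=
  \sum_(z <- gball k.+1 x) \sum_(K <- rsets k z) w G z K * bdry_share K x.

Arguments coverage w {G} x.
Arguments boundary_mass w {G} x.

Lemma local_setpt_share (L : finType) m : @local_setpt R d L k m R (fun G _ _ K x => share K x).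
Proof.
exact: (local_setpt_op2 (fun (b : bool) (n : nat) => b%:R * n%:R^-1 : R) (@local_setpt_mem R d L k m) (local_set_at m (@local_set_card R d L k))).
Qed.

Lemma local_setpt_bdry_share (L : finType) m : @local_setpt R d L k m R (fun G _ _ K x => bdry_share K x).
Proof.
exact: (local_setpt_op2 (fun (b : bool) (n : nat) => b%:R * n%:R^-1 : R) (@local_setpt_bdry R d L k m) (local_set_at m (@local_set_card R d L k))).
Qed.

Lemma norm_weight G (K : {fset gr_space G}) (b : bool) : `|b%:R * (#|` K|%:R)^-1 : R| <= 1.
Proof.
rewrite normrM ger0_norm ?ler0n // ger0_norm ?invr_ge0 ?ler0n //.
case: b; rewrite ?mul0r // mul1r.
by case: #|` K| => [|n]; rewrite ?invr0 // invf_le1 ?ltr0n // ler1n.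
Qed.

Lemma local_pt_coverage (L : finType) w : ulocal_set w -> @local_pt R d L R (fun G _ => @coverage w G).
Proof.
move=> /(ulocal_set_local_set L) lw.
exact: (local_pt_sum_in (local_setpt_op2 (fun a b : R => a * b) (local_set_at k lw) (@local_setpt_share L k))).
Qed.

Lemma local_pt_boundary_mass (L : finType) w : ulocal_set w -> @local_pt R d L R (fun G _ => @boundary_mass w G).
Proof.
move=> /(ulocal_set_local_set L) lw.
exact: (local_pt_sum_in (local_setpt_op2 (fun a b : R => a * b) (local_set_at k.+1 lw) (@local_setpt_bdry_share L k.+1))).
Qed.

(** Two tests of the residual: the first has its own coverage defect built in and returns the square
    of that defect; the second compares boundaries, and [sum_bdry] bounds that of the components. *)
Lemma fractional_partition G (eps : R) (l : gr_space G -> bool) : 0 < eps ->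
  (forall a, measurable [set x | l x = a]%classic) ->
  (forall y, (#|` cluster k l y| <= k)%N) ->
  exists w : setfun, [/\ ulocal_set w, forall H (x : gr_space H) K, 0 <= w H x K <= 1,
    mean (fun x : gr_space G => (coverage w x - 1) ^+ 2) <= eps &
    mean (fun x : gr_space G => boundary_mass w x) <= eps + d.+1%:R ^+ 2 * mean (fun x => (l x)%:R)].
Proof.
move=> eps0 ml hc.
(* [B] bounds the coverage defect for any weights in the unit interval, and [C] bounds both test
   functions; both are fixed before [w] is chosen. *)
pose B : R := (d.+1 ^ k)%:R * ((2 ^ (d.+1 ^ k))%:R * 1) + 1.
have B0 : 0 <= B by rewrite addr_ge0 ?mulr_ge0 ?ler0n.
pose C : R := Num.max ((d.+1 ^ k)%:R * B) ((d.+1 ^ k.+1)%:R * 1).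
have C0 : 0 <= C by rewrite le_max mulr_ge0 ?ler0n.
have [w [lw w01 hw]] := near_minimizer ml C0 eps0.
exists w; split=> //.
- pose g H (x : gr_space H) := coverage w x - 1.
  have lg (L : finType) : @local_pt R d L R (fun H _ => @g H).
    exact: (local_pt_op1 (fun r : R => r - 1) (local_pt_coverage L lw)).
  have gB x : `|g G x| <= B.
    apply: le_trans (ler_normB _ _) _; rewrite normr1 lerD2r.
    apply: sum_bound; [by rewrite mulr_ge0 ?ler0n|exact: gball_card|] => z _.
    apply: sum_bound => //; first exact: rsets_card.
    move=> K _; rewrite normrM -[X in _ <= X]mulr1 ler_pM //; last exact: norm_weight.
    by have /andP[h0 h1] := w01 G z K; rewrite ger0_norm.
  (* This test function depends on [w] itself, which is allowed because [near_minimizer] treats all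
     bounded local [v] at once. *)
  pose v : setfun := fun H z K => \sum_(x <- gball k z) share K x * g H x.
  have lb (L : finType) : @local_setpt R d L k k R (fun H _ z K x => share K x * g H x).
    exact: (local_setpt_op2 (fun a b : R => a * b) (@local_setpt_share L k) (local_pt_at k k (lg L))).
  have lv : ulocal_set v by exact: (local_set_sum (lb unit)).
  have lc := local_set_c1.
  have lwc : local_set k (fun H (l : gr_space H -> bool) x K => w H x K - (K == cluster k l x)%:R).
    exact: (local_set_op2 (fun a b : R => a - b) (ulocal_set_local_set bool lw) local_set_c1).
  have /(hw v lv) : forall x K, K \in rsets k x -> `|v G x K| <= C.
    move=> x K _; rewrite le_max; apply/orP; left.
    apply: sum_bound => //; first exact: gball_card.
    move=> y _; rewrite normrM -[X in _ <= X]mul1r ler_pM //; exact: norm_weight.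
  move=> /(le_trans (ler_norm _)); apply: le_trans.
  have := mass_transport_sets ml (local_setpt_op2 (fun a b : R => a * b) (local_set_at k lwc) (lb bool)).
  rewrite /pairing le_eqVlt => h; apply/orP; left; apply/eqP.
  transitivity (mean (fun z => \sum_(K <- rsets k z) \sum_(x <- gball k z)
     (w G z K - (K == cluster k l z)%:R) * (share K x * g G x))); last first.
    by apply: eq_mean => z; apply: eq_bigr => K _; rewrite /v mulr_sumr.
  rewrite -h; apply: eq_mean => x.
  transitivity ((coverage w x - \sum_(z <- gball k x) \sum_(K <- rsets k z) (K == cluster k l z)%:R * share K x) * g G x).
    rewrite expr2; congr (_ * _); congr (_ - _).
    rewrite -[LHS](sum_cluster1 hc x); apply: eq_bigr => z _.
    by rewrite sum_rsets_cluster.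
  rewrite -sumrB mulr_suml; apply: eq_bigr => z _.
  rewrite -sumrB mulr_suml; apply: eq_bigr => K _; ring.
- pose v : setfun := fun H z K => \sum_(x <- gball k.+1 z) bdry_share K x.
  have lv : ulocal_set v by exact: (local_set_sum (@local_setpt_bdry_share unit k.+1)).
  have lv' := ulocal_set_local_set bool lv.
  have lw' := ulocal_set_local_set bool lw.
  have lb := @local_setpt_bdry_share bool k.+1.
  have lwc : local_set k (fun H (l : gr_space H -> bool) x K => w H x K - (K == cluster k l x)%:R).
    exact: (local_set_op2 (fun a b : R => a - b) lw' local_set_c1).
  have /(hw v lv) : forall x K, K \in rsets k x -> `|v G x K| <= C.
    move=> x K _; rewrite le_max; apply/orP; right.
    apply: sum_bound => //; first exact: gball_card.
    by move=> y _; exact: norm_weight.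
  move=> /(le_trans (ler_norm _)) h1.
  have e1 := mass_transport_sets ml (local_setpt_op2 (fun a b : R => a * b) (local_set_at k.+1 lw') lb).
  have e2 := mass_transport_sets ml (local_setpt_op2 (fun a b : R => a * b) (local_set_at k.+1 local_set_c1) lb).
  rewrite /= in e1 e2.
  have E : mean (fun x : gr_space G => boundary_mass w x) =
     pairing l (fun H l x K => (w H x K - (K == cluster k l x)%:R) * v H x K) +
     pairing l (fun H l x K => (K == cluster k l x)%:R * v H x K).
    rewrite -pairing_add //; last 2 first.
    - exact: (local_set_op2 (fun a b : R => a * b) lwc lv').
    - exact: (local_set_op2 (fun a b : R => a * b) local_set_c1 lv').
    rewrite [LHS]e1; apply: eq_mean => z; apply: eq_bigr => K _.
    by rewrite -mulr_sumr -/(v G z K); ring.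
  rewrite E; apply: lerD => //.
  have -> : pairing l (fun H l x K => (K == cluster k l x)%:R * v H x K) =
     mean (fun x => \sum_(z <- gball k.+1 x) bdry_share (cluster k l z) x).
    transitivity (mean (fun x => \sum_(z <- gball k.+1 x) \sum_(K <- rsets k z) (K == cluster k l z)%:R * bdry_share K x)).
      by rewrite e2; apply: eq_mean => z; apply: eq_bigr => K _; rewrite /v mulr_sumr.
    by apply: eq_mean => x; apply: eq_bigr => z _; rewrite sum_rsets_cluster.
  have ll : @local_pt R d bool R (fun H l x => (l x)%:R).
    by exists 0%N => H1 l1 H2 l2 x x' t it; rewrite -(niso_root it) (niso_label it) // gball_refl.
  have ll1 : @local_pt R d bool R (fun H l x => \sum_(u <- gball 1 x) (l u)%:R).
    exact: local_pt_sum_out ll.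
  apply: (@le_trans _ _ (mean (fun x => d.+1%:R * \sum_(u <- gball 1 x) (l u)%:R))).
    apply: mean_le.
    - have := local_pt_bm ml (local_pt_sum_in (local_setpt_op2 (fun a b : R => a * b) (local_set_at k.+1 local_set_c1) lb)).
      rewrite /= (_ : (fun x => _) = (fun x => \sum_(z <- gball k.+1 x) bdry_share (cluster k l z) x)) //.
      by apply/funext => x; apply: eq_bigr => z _; rewrite sum_rsets_cluster.
    - by apply: bmeas_scale; exact: (local_pt_bm ml ll1).
    - by move=> x; rewrite nb_gball1; exact: sum_bdry.
  rewrite mean_scale; last exact: (local_pt_bm ml ll1).
  rewrite expr2 -mulrA ler_wpM2l //.
  (* Each vertex sends its label to its neighbours; exchanging sender and receiver produces the
     second factor [d + 1], the first coming from [sum_bdry]. *)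
  have -> : mean (fun x => \sum_(u <- gball 1 x) (l u)%:R : R) = mean (fun x => \sum_(u <- gball 1 x) (l x)%:R : R).
    apply: (@mass_transport _ _ _ _ _ ml 1 (fun x u => (l u)%:R : R)).
    by exists 1%N => x x' t it y hy; rewrite (niso_label it).
  rewrite -mean_scale; last exact: (local_pt_bm ml ll).
  apply: mean_le.
  + have l1 : @local_pt R d bool R (fun H _ x => 1) by exists 0%N.
    have := local_pt_bm ml (local_pt_op2 (fun a b : R => a * b) (local_pt_sum_out 1 l1) ll).
    rewrite (_ : (fun x => _) = (fun x : gr_space G => \sum_(u <- gball 1 x) (l x)%:R)) //.
    by apply/funext => x; rewrite mulr_suml; apply: eq_bigr => u _; rewrite mul1r.
  + by apply: bmeas_scale; exact: (local_pt_bm ml ll).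
  + move=> x; rewrite nb_gball1 big_const_seq count_predT iter_addr_0 -[X in X <= _]mulr_natl.
    by rewrite ler_wpM2r // ler_nat nb_card.
Qed.

End Optimization.
Arguments coverage {R d} k w {G} x.
Arguments boundary_mass {R d} k w {G} x.

Local Open Scope classical_set_scope.
Local Open Scope ring_scope.

(** * Rounding a fractional partition *)

Section Coloring.
Context (R : realType) (d : nat) (G : graphing R d).
Notation X := (gr_space G).
Implicit Types (x y z : X).

(** [a] numbers a cylinder containing [x] and no other vertex of its [m]-ball. Two vertices within
    distance [m] cannot share such a cylinder, so taking the least [a] gives a proper colouring with
    countably many colours. *)
Definition isolates m (a : nat) x : Prop := exists s, choice.unpickle a = Some s /\
  cylX (G := G) s x /\ forall w : m.-tuple 'I_d.+1, act w x <> x -> ~ cylX s (act w x).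

Lemma isolates_ex m x : exists a, `[< isolates m a x >].
Proof.
have [n hn] := cylX_sep x (gball m x).
exists (choice.pickle (mkseq (gr_code x) n)); apply/asboolP.
exists (mkseq (gr_code x) n); rewrite choice.pickleK; split=> //.
split; first by rewrite /cylX /= size_mkseq.
move=> w ne; rewrite /cylX /= size_mkseq => /hn e; apply: ne; apply: e.
exact: act_gball.
Qed.

Definition color m x : nat := ex_minn (isolates_ex m x).

Lemma color_neq m x y : y \in gball m x -> y <> x -> color m x <> color m y.
Proof.
move=> /in_gball[w wy] yx; rewrite /color.
case: ex_minnP => a /asboolP[s [es [_ hs]]] _.
case: ex_minnP => b /asboolP[s' [es' [hs' _]]] _ e.
move: es'; rewrite -e es => -[ss]; rewrite -ss in hs'.
by apply: (hs w); rewrite wy.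
Qed.

Lemma meas_isolates m a : measurable [set x | isolates m a x].
Proof.
rewrite (_ : mkset _ = \bigcup_(s : seq bool) ([set _ | choice.unpickle a = Some s] `&` (cylX s `&`
  \bigcap_(w : m.-tuple 'I_d.+1) ([set x | act w x = x] `|` ~` (act w @^-1` cylX s))))).
  apply: meas_bigcup => s; apply: measurableI; first exact: meas_prop.
  apply: measurableI; first exact: meas_cylX.
  apply: meas_bigcap => w; apply: measurableU; first by apply: borel_eq => //; exact: borel_act.
  by apply: measurableC; apply: borel_act; exact: meas_cylX.
apply/seteqP; split=> x.
  move=> [s [es [xs hs]]]; exists s => //; split=> //; split=> // w _.
  by have [e|ne] := pselect (act w x = x); [left|right; exact: hs].
move=> [s _ [es [xs hs]]]; exists s; split=> //; split=> // w ne.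
by have [] := hs w I.
Qed.

Lemma meas_color m a : measurable [set x | color m x = a].
Proof.
rewrite (_ : mkset _ = [set x | isolates m a x] `&` \bigcap_(b : 'I_a) ~` [set x | isolates m b x]).
  apply: measurableI; first exact: meas_isolates.
  by apply: meas_bigcap => b; apply: measurableC; exact: meas_isolates.
apply/seteqP; split=> x /=; rewrite /color; case: ex_minnP => b /asboolP hb mb.
  move=> <-; split=> // c _ /= /asboolP/mb; by rewrite leqNgt ltn_ord.
move=> [ha hc]; apply/eqP; rewrite eqn_leq mb /=; last exact/asboolP.
rewrite leqNgt; apply/negP => ba; exact: (hc (Ordinal ba) I).
Qed.

Lemma meas_color_pred m (P : set nat) : measurable [set x | P (color m x)].
Proof.
rewrite (_ : mkset _ = \bigcup_a ([set _ | P a] `&` [set x | color m x = a])).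
  by apply: meas_bigcup => a; apply: measurableI; [exact: meas_prop|exact: meas_color].
apply/seteqP; split=> x /=; first by move=> h; exists (color m x).
by move=> [a _ [/= h ->]].
Qed.

(** A finite palette is needed both for locality and for averaging; all colours from [N] on are
    merged. *)
Definition trunc_color m N x : 'I_N.+1 := inord (minn (color m x) N).

Lemma meas_trunc_color m N a : measurable [set x | trunc_color m N x = a].
Proof. exact: (meas_color_pred m [set j | inord (minn j N) = a]). Qed.

Definition lowcolor p N : set X := [set x | forall y, y \in gball p x -> (color (p + p) y < N)%N].

Lemma meas_lowcolor p N : measurable (lowcolor p N).
Proof.
rewrite (_ : lowcolor p N = \bigcap_(w : p.-tuple 'I_d.+1) (act w @^-1` [set x | (color (p + p) x < N)%N])).
  by apply: meas_bigcap => w; apply: borel_act; exact: (meas_color_pred _ [set j | j < N]%N).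
apply/seteqP; split=> x; first by move=> h w _; apply: h; exact: act_gball.
by move=> h y /in_gball[w <-]; exact: (h w I).
Qed.

Lemma lowcolor_inj p N x : lowcolor p N x -> {in gball p x &, injective (trunc_color (p + p) N)}.
Proof.
move=> h y z hy hz e; apply: contrapT => yz.
have c1 := h y hy; have c2 := h z hz.
apply: (@color_neq (p + p) z y) => //.
  by apply: gball_trans hy; rewrite gball_sym.
move/(congr1 val): e; rewrite /= !inordK ?ltnS ?geq_minr //.
by rewrite (minn_idPl (ltnW c1)) (minn_idPl (ltnW c2)) => ->.
Qed.

(** A ball is finite, so every vertex is eventually in [lowcolor p N]; continuity of the measure
    along this increasing sequence gives [N]. *)
Lemma lowcolor_large p (eps : R) : 0 < eps -> exists N, mean (ind (~` lowcolor p N)) < eps.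
Proof.
move=> eps0.
have ndl : {homo lowcolor p : n m / (n <= m)%N >-> (n <= m)%O}.
  by move=> n m nm; apply/subsetPset => x h y /h c; exact: leq_trans c nm.
have cT : \bigcup_N lowcolor p N = setT.
  apply/seteqP; split=> // x _; exists (\max_(y <- gball p x) (color (p + p) y).+1) => // y hy.
  exact: (@leq_bigmax_seq _ _ predT (fun y => (color (p + p) y).+1)).
have := @nondecreasing_cvg_mu _ _ _ (gr_mu G) _ (meas_lowcolor p) _ ndl.
rewrite cT => /(_ measurableT).
rewrite [X in _ --> X](_ : _ = 1%:E); last exact: probability_setT.
move=> /fine_cvgP[_ hc].
have h1 : (1 - eps < 1 :> R)%R by rewrite ltrBlDr ltrDl.
have [N _ hN] := cvgr_gt _ hc _ h1.
exists N; have := hN N (leqnn N) => /= {hN}.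
have mN := meas_lowcolor p N.
rewrite -(mean_ind mN) => hlt.
have -> : mean (ind (~` lowcolor p N)) = 1 - mean (ind (lowcolor p N)).
  rewrite -[X in X - _](mean_cst G) -mean_sub; [|exact: bmeas_cst|exact: bmeas_ind].
  by apply: eq_mean => x; rewrite ind_setC.
by rewrite ltrBlDr addrC -ltrBlDr.
Qed.

End Coloring.

Local Open Scope fset_scope.
Local Open Scope ring_scope.

(** The thresholds [t < M] discretise a uniform variable; an event of probability [q] is counted
    with an error of at most 1. *)
Lemma count_lt (R : realType) (q : R) M : 0 <= q <= 1 ->
  M%:R * q <= \sum_(t < M) ((t : nat)%:R < M%:R * q)%R%:R <= M%:R * q + 1.
Proof.
move=> /andP[q0 q1]; set r := M%:R * q.
have r0 : 0 <= r by rewrite mulr_ge0.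
have rM : r <= M%:R by rewrite /r -[X in _ <= X]mulr1 ler_wpM2l.
clearbody r; elim: M r r0 rM => [|M IH] r r0 rM.
  by rewrite big_ord0 (le_trans rM) //= addr_ge0.
rewrite big_ord_recl /=.
have [re|r1] := ltrP 0 r; last first.
  have -> : r = 0 by apply/eqP; rewrite eq_le r1.
  rewrite big1 => [|i _]; last by rewrite ltNge ler0n.
  by rewrite !add0r lexx ler01.
under eq_bigr do rewrite /= /bump /= add1n -natr1 -ltrBrDr.
rewrite [(nat_of_bool true)%:R]mulr1n.
have [r1|r1] := lerP 1 r.
  have /andP[h1 h2] := IH (r - 1) (ltac:(lra)) (ltac:(rewrite lerBlDr natr1; exact: rM)).
  by apply/andP; split; lra.
rewrite big1; last by move=> i _; rewrite ltNge (le_trans _ (ler0n _ i)) // subr_le0 ltW.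
by apply/andP; split; rewrite ?addr0; lra.
Qed.

Lemma average_le (R : realType) (I : finType) (i0 : I) (F : I -> R) (A : R) :
  \sum_i F i <= #|I|%:R * A -> exists i, F i <= A.
Proof.
move=> h; apply: contrapT => ne.
have lt i : A < F i by rewrite ltNge; apply/negP => hi; apply: ne; exists i.
have : \sum_(i : I) A < \sum_i F i.
  apply: ltr_sum => //; apply/hasP; exists i0 => //; exact: mem_index_enum.
rewrite sumr_const -mulr_natl => h'.
by have := lt_le_trans h' h; rewrite ltxx.
Qed.

(** * Selecting sets step by step *)

Section Rounding.
Context (R : realType) (d k : nat) (w : setfun R d) (L : finType) (M : nat).
Hypothesis lw : ulocal_set k w.
Hypothesis w01 : forall (G : graphing R d) (x : gr_space G) K, 0 <= @w G x K <= 1.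
Implicit Types (G H : graphing R d).

Notation Omega := ((L * {set L}) * 'I_M.+1)%type.

Definition colset G (l : gr_space G -> L) (K : {fset gr_space G}) : {set L} :=
  [set a | has (fun y => l y == a) (enum_fset K)].

Lemma colsetP G (l : gr_space G -> L) (K : {fset gr_space G}) a :
  reflect (exists2 y, y \in K & l y = a) (a \in colset l K).
Proof. by rewrite inE; apply: (iffP hasP) => -[y yK /eqP e]; exists y. Qed.

Lemma local_set_colset : @local_set R d L k _ (fun G l _ K => colset l K).
Proof.
exists k => G l H l' x x' t it K /fsubsetP hK.
apply/setP => a; apply/colsetP/colsetP => [[y yK <-]|[_ /imfsetP[y /= yK ->] <-]].
  by exists (t y); [apply/imfsetP; exists y|rewrite (niso_label it (hK _ yK))].
by exists y => //; rewrite (niso_label it (hK _ yK)).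
Qed.

(** A component appears once for each of its roots; division by the cardinality restores total
    weight one. *)
Definition rate G (z : gr_space G) (K : {fset gr_space G}) : R := @w G z K * (#|` K|%:R)^-1.

Lemma rate01 G (z : gr_space G) (K : {fset gr_space G}) : 0 <= rate z K <= 1.
Proof.
have /andP[h0 h1] := w01 z K.
have := norm_weight K true; rewrite mul1r ger0_norm ?invr_ge0 // => h2.
rewrite /rate mulr_ge0 ?invr_ge0 //=.
by rewrite -[X in _ <= X]mulr1 ler_pM ?invr_ge0.
Qed.

(* A step [o] consists of the colour of a root, the colours of the vertices of
   the set and a threshold; within a properly coloured ball it determines at
   most one rooted set, which is selected with probability proportional to its
   rate. *)
Definition fires (o : Omega) G (l : gr_space G -> L) z K : bool :=
  (o.1 == (l z, colset l K)) && ((o.2 : nat)%:R < M.+1%:R * rate z K).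

Lemma local_set_fires o : @local_set R d L k _ (fun G l z K => fires o l z K).
Proof.
have ll : @local_pt R d L L (fun G l x => l x).
  by exists 0%N => G l H l' x x' t it; rewrite -(niso_root it) (niso_label it) // gball_refl.
have l1 := local_set_op2 (fun a b => o.1 == (a, b)) (local_pt_set k ll) local_set_colset.
have l2 := local_set_op2 (fun (a : R) (b : nat) => (o.2 : nat)%:R < M.+1%:R * (a * b%:R^-1)) (ulocal_set_local_set L lw) (@local_set_card R d L k).
exact: (local_set_op2 andb l1 l2).
Qed.

Lemma sum_fires G (l : gr_space G -> L) z K :
  \sum_(o : Omega) (fires o l z K)%:R = \sum_(t < M.+1) ((t : nat)%:R < M.+1%:R * rate z K)%R%:R :> R.
Proof.
rewrite -(pair_bigA _ (fun a t => (fires (a, t) l z K)%:R)) /=.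
rewrite (bigD1 (l z, colset l K)) //= [X in _ + X]big1 ?addr0.
  by apply: eq_bigr => t _; rewrite /fires /= eqxx.
by move=> a ne; apply: big1 => t _; rewrite /fires /= (negbTE ne).
Qed.

Definition event_count G m (p : gr_space G -> {fset gr_space G} -> bool) x : R :=
  \sum_(z <- gball m x) \sum_(K <- rsets k z) (p z K)%:R.

Lemma event_count_gt0P G m (p : gr_space G -> {fset gr_space G} -> bool) (x : gr_space G) :
  reflect (exists z K, [/\ z \in gball m x, K \in rsets k z & p z K]) (0 < event_count m p x).
Proof.
apply: (iffP idP) => [h|[z [K [hz hK pK]]]].
  apply: contrapT => ne; move: h; rewrite /event_count big1_seq ?ltxx // => z /= hz.
  rewrite big1_seq // => K /= hK; case pK : (p z K) => //.
  by case: ne; exists z, K.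
rewrite /event_count (big_fsetD1 z) //= (big_fsetD1 K) //= pK -addrA ltr_wpDr //.
by rewrite addr_ge0 ?sumr_ge0 // => z' _; rewrite sumr_ge0.
Qed.

Lemma event_count_ge0 G m (p : gr_space G -> {fset gr_space G} -> bool) (x : gr_space G) : 0 <= event_count m p x.
Proof. by rewrite /event_count !sumr_ge0 // => z _; rewrite sumr_ge0. Qed.

(** Turns a count of events into an indicator, which is how uniqueness yields a lower bound for
    hits. *)
Lemma event_count_le1 G m (p : gr_space G -> {fset gr_space G} -> bool) (x : gr_space G) :
  (forall z K z' K', z \in gball m x -> K \in rsets k z -> p z K ->
    z' \in gball m x -> K' \in rsets k z' -> p z' K' -> z = z' /\ K = K') ->
  event_count m p x <= (0 < event_count m p x)%R%:R.
Proof.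
move=> u; case: event_count_gt0P => [[z [K [hz hK pK]]]|ne].
  rewrite /event_count (big_fsetD1 z) //= (big_fsetD1 K) //= pK.
  rewrite [X in _ + X + _]big1_seq ?[X in _ + X]big1_seq ?addr0 //.
    move=> z' /=; rewrite !inE => /andP[zz hz']; apply: big1_seq => K' /= hK'.
    case pK' : (p z' K') => //; have [e _] := u _ _ _ _ hz hK pK hz' hK' pK'.
    by rewrite e eqxx in zz.
  move=> K' /=; rewrite in_fsetD1 => /andP[KK hK'].
  case pK' : (p z K') => //.
  by have [_ e] := u _ _ _ _ hz hK pK hz hK' pK'; rewrite e eqxx in KK.
rewrite /event_count big1_seq // => z /= hz; rewrite big1_seq // => K /= hK.
by case pK : (p z K) => //; case: ne; exists z, K.
Qed.

(** The selected set need only meet [nb x]. Hence [bad] implies [hit], and a hit that is not bad has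
    all of [nb x] inside the set. *)
Definition hit (o : Omega) G (l : gr_space G -> L) x : bool :=
  0 < event_count k.+1 (fun z K => fires o l z K && ~~ fdisjoint (nb x) K) x.

Definition bad (o : Omega) G (l : gr_space G -> L) x : bool :=
  0 < event_count k.+1 (fun z K => fires o l z K && bdry K x) x.

Lemma bad_hit o G (l : gr_space G -> L) x : bad o l x -> hit o l x.
Proof.
move=> /event_count_gt0P[z [K [hz hK /andP[h1 /andP[h2 _]]]]]; apply/event_count_gt0P.
by exists z, K; rewrite h1.
Qed.

Lemma local_pt_hit o : @local_pt R d L _ (fun G l x => hit o l x).
Proof.
have := local_pt_sum_in (local_setpt_op2 (fun a b : bool => (a && b)%:R : R) (local_set_at k.+1 (local_set_fires o)) (@local_setpt_meets R d L k k.+1)).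
exact: (local_pt_op1 (fun r : R => 0 < r)).
Qed.

Lemma local_pt_bad o : @local_pt R d L _ (fun G l x => bad o l x).
Proof.
have := local_pt_sum_in (local_setpt_op2 (fun a b : bool => (a && b)%:R : R) (local_set_at k.+1 (local_set_fires o)) (@local_setpt_bdry R d L k k.+1)).
exact: (local_pt_op1 (fun r : R => 0 < r)).
Qed.

(* The first step that hits the neighbourhood of [x] does not contain it, or
   there is no such step. *)
Fixpoint failed (s : seq Omega) G (l : gr_space G -> L) x : bool :=
  if s is o :: s' then (if hit o l x then bad o l x else failed s' l x) else true.

Lemma local_pt_failed s : @local_pt R d L _ (fun G l x => failed s l x).
Proof.
elim: s => [|o s IH]; first by exists 0%N.
have := local_pt_op2 (fun (p : bool * bool) b => if p.1 then p.2 else b) (local_pt_op2 pair (local_pt_hit o) (local_pt_bad o)) IH.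
exact.
Qed.

Section Fixed.
Context (G : graphing R d) (l : gr_space G -> L).
Implicit Types (x y z : gr_space G).

(** Every set rooted within [k] of [x] stays in the ball of radius [k + k]. As colours are distinct
    there, a step selects at most one set through [x], so counting pairs of steps and sets does not
    overcount hits. *)
Lemma sum_hit x : {in gball (k + k) x &, injective l} ->
  M.+1%:R * coverage k w x <= \sum_(o : Omega) (hit o l x)%:R.
Proof.
move=> il.
apply: (@le_trans _ _ (\sum_(o : Omega) event_count k (fun z K => fires o l z K && (x \in K)) x)).
  rewrite /event_count exchange_big /= /coverage mulr_sumr; apply: ler_sum => z _.
  rewrite exchange_big /= mulr_sumr; apply: ler_sum => K _.
  rewrite /share; case: (x \in K); last by rewrite mul0r !mulr0 sumr_ge0.
  under eq_bigr do rewrite andbT.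
  by rewrite sum_fires mul1r; have /andP[] := count_lt M.+1 (rate01 z K).
apply: ler_sum => o _; apply: (@le_trans _ _ ((0 < event_count k (fun z K => fires o l z K && (x \in K)) x)%R%:R)).
  apply: event_count_le1 => z K z' K' hz hK /andP[/andP[/eqP e _] _] hz' hK' /andP[/andP[/eqP e' _] _].
  have gk u : u \in gball k x -> u \in gball (k + k) x by apply: gball_mono; exact: leq_addr.
  have sK u C y : u \in gball k x -> C \in rsets k u -> y \in C -> y \in gball (k + k) x.
    by move=> hu /rsets_sub/fsubsetP hC /hC; exact: gball_trans.
  move: e; rewrite e' => -[el ec].
  have ez : z = z' by apply: il; rewrite ?el //; exact: gk.
  split=> //; apply/fsetP => y; apply/idP/idP => hy.
    have : l y \in colset l K' by rewrite ec; apply/colsetP; exists y.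
    move=> /colsetP[v vK' /il ev]; rewrite -ev //; first exact: sK hz' hK' vK'.
    exact: sK hz hK hy.
  have : l y \in colset l K by rewrite -ec; apply/colsetP; exists y.
  move=> /colsetP[v vK' /il ev]; rewrite -ev //; first exact: sK hz hK vK'.
  exact: sK hz' hK' hy.
case: event_count_gt0P => // -[z [K [hz hK /andP[f xK]]]].
suff -> : hit o l x by [].
apply/event_count_gt0P; exists z, K; split=> //; first exact: gball_mono (leqnSn k) _ hz.
rewrite f /=; apply/negP => /fdisjointP/(_ x (nb_refl x)).
by rewrite xK.
Qed.

Let D1 : R := (d.+1 ^ k.+1)%:R * ((2 ^ (d.+1 ^ k))%:R * 1).

(** A union bound over the rooted sets near [x]; [D1] collects the rounding error 1 of [count_lt]
    for each of them. *)
Lemma sum_bad x : \sum_(o : Omega) (bad o l x)%:R <= M.+1%:R * boundary_mass k w x + D1.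
Proof.
apply: (@le_trans _ _ (\sum_(o : Omega) event_count k.+1 (fun z K => fires o l z K && bdry K x) x)).
  apply: ler_sum => o _; rewrite /bad; case: event_count_gt0P => [[z [K [hz hK pK]]]|_]; last exact: event_count_ge0.
  rewrite /event_count (big_fsetD1 z) //= (big_fsetD1 K) //= pK -addrA lerDl.
  by rewrite addr_ge0 ?sumr_ge0 // => z' _; rewrite sumr_ge0.
rewrite /event_count exchange_big /=.
apply: (@le_trans _ _ (\sum_(z <- gball k.+1 x) \sum_(K <- rsets k z) (M.+1%:R * (@w G z K * bdry_share K x) + 1))).
  apply: ler_sum => z _; rewrite exchange_big /=; apply: ler_sum => K _.
  rewrite /bdry_share; case: (bdry K x); last first.
    rewrite mul0r !mulr0 add0r big1 ?ler01 // => o _; by rewrite andbF.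
  under eq_bigr do rewrite andbT.
  by rewrite sum_fires mul1r; have /andP[] := count_lt M.+1 (rate01 z K).
under eq_bigr do rewrite big_split /= -mulr_sumr.
rewrite big_split /= -mulr_sumr lerD2l.
apply: le_trans (ler_norm _) _; apply: sum_bound; [by rewrite mulr_ge0 ?ler0n|exact: gball_card|] => z _.
by apply: sum_bound => //; [exact: rsets_card|move=> K _; rewrite normr1].
Qed.

(** If the current step hits [x], its set contains [nb x] and hence the next vertex of the path;
    that vertex is hit too and, not failing, has its neighbourhood in the same set. If [x] is not
    hit, no vertex of the path is, and the later steps decide. *)
Lemma failed_cluster s x : ~~ failed s l x -> exists K : {fset gr_space G},
  (#|` K| <= d.+1 ^ k)%N /\ forall p, path (fun u v => v \in nb u) x p -> all (fun y => ~~ failed s l y) p ->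
    last x p \in K.
Proof.
have evK o z K y : K \in rsets k z -> fires o l z K -> ~~ fdisjoint (nb y) K -> z \in gball k.+1 y.
  move=> /rsets_sub/fsubsetP hK _ nd.
  have [u un uK] : exists2 u, u \in nb y & u \in K.
    apply: contrapT => h; move/negP: nd; apply; apply/fdisjointP => u un.
    by apply/negP => uK; apply: h; exists u.
  rewrite -add1n; apply: (gball_trans (y := u)); first by rewrite nb_gball1.
  by rewrite gball_sym; exact: hK.
have good o z K y : K \in rsets k z -> fires o l z K -> ~~ fdisjoint (nb y) K -> ~~ bad o l y -> nb y `<=` K.
  move=> hK f nd /negP nb_; apply: contrapT => /negP ns; apply: nb_.
  by apply/event_count_gt0P; exists z, K; rewrite f /bdry nd ns (evK o z K).
have meet (y u : gr_space G) (K : {fset gr_space G}) : u \in nb y -> u \in K -> ~~ fdisjoint (nb y) K.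
  by move=> uy uK; apply/negP => /fdisjointP/(_ u uy); rewrite uK.
elim: s x => [//|o s IH] x /=.
case: ifP => hx nx.
  have /event_count_gt0P[z [K [hz hK /andP[f nd]]]] := hx.
  exists K; split.
    by apply: leq_trans (gball_card k z); apply: fsubset_leq_card; exact: rsets_sub hK.
  elim/last_ind => [|p v IHp] /=.
    by move=> _ _; apply: (fsubsetP (good _ _ _ _ hK f nd nx)); exact: nb_refl.
  rewrite rcons_path all_rcons last_rcons => /andP[pp vp] /andP[nv ap].
  have lK := IHp pp ap.
  have nl : ~~ fdisjoint (nb (last x p)) K by apply: meet lK; exact: nb_refl.
  have hl : hit o l (last x p).
    by apply/event_count_gt0P; exists z, K; rewrite f nl (evK o z K).
  have nbl : ~~ bad o l (last x p).
    case: (p) ap hl => [//|a q] /allP/(_ (last a q) (mem_last a q)).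
    by rewrite /=; case: ifP.
  exact: (fsubsetP (good _ _ _ _ hK f nl nbl)).
have [K [cK hK]] := IH x nx; exists K; split=> // p pp ap.
apply: hK => //.
suff : all (fun y => ~~ hit o l y && ~~ failed s l y) p by apply: sub_all => y /andP[].
elim/last_ind: p pp ap => [//|p v IHp].
rewrite rcons_path !all_rcons => /andP[pp vp] /andP[nv ap].
rewrite IHp // andbT.
have nl : ~~ hit o l (last x p).
  have := IHp pp ap; case: (p) => [_|a q /allP/(_ (last a q) (mem_last a q))/andP[]//].
  by rewrite hx.
move: nv; rewrite /=; case: ifP => [hv nbv|//].
have /event_count_gt0P[z [C [hz hC /andP[f nd]]]] := hv.
(* The set selected around [v] would contain its predecessor on the path, which would then have been
   hit. *)
have sC := good _ _ _ _ hC f nd nbv.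
have lC : last x p \in C by apply: (fsubsetP sC); rewrite nb_sym.
case/negP: nl; apply/event_count_gt0P; exists z, C.
have ndl := meet _ _ _ (nb_refl (last x p)) lC.
by rewrite f ndl (evK o z C).
Qed.

Hypothesis ml : forall a, measurable [set x | l x = a]%classic.

Let W : R := #|{: Omega}|%:R.
(** Bounds the probability that a uniformly random step misses a vertex with coverage at least 1/2
    and an injectively coloured ball. Likewise [M.+1 * b x] bounds the number of steps bad at
    [x]. *)
Let rho : R := 1 - M.+1%:R / (2 * W).
Let b x : R := boundary_mass k w x + D1 / M.+1%:R.

Lemma b_ge0 x : 0 <= b x.
Proof.
rewrite addr_ge0 ?divr_ge0 ?mulr_ge0 ?ler0n //.
apply: sumr_ge0 => z _; apply: sumr_ge0 => K _.
have /andP[h _] := w01 z K.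
by rewrite mulr_ge0 // /bdry_share mulr_ge0 ?invr_ge0.
Qed.

Lemma card_steps (o0 : Omega) : (M.+1 <= #|{: Omega}|)%N.
Proof.
rewrite card_prod card_ord leq_pmull // card_prod muln_gt0; apply/andP; split.
  by apply/card_gt0P; exists o0.1.1.
by apply/card_gt0P; exists o0.1.2.
Qed.

Lemma decay_rate (o0 : Omega) : 0 <= rho < 1.
Proof.
have h := card_steps o0; have W0 : 0 < W by rewrite ltr0n (leq_trans _ h).
have hW : M.+1%:R <= W by rewrite ler_nat.
rewrite subr_ge0 ler_pdivrMr ?mulr_gt0 // mul1r.
rewrite ltrBlDr ltrDl divr_gt0 ?mulr_gt0 // andbT.
by apply: le_trans hW _; lra.
Qed.

(* The right-hand side is the conditional expectation of the failure measure
   (up to a factor 2 on the boundary term), so some first step does not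
   increase it. *)
Lemma rounding (o0 : Omega) n (U : set (gr_space G)) : measurable U ->
  (forall x, U x -> {in gball (k + k) x &, injective l} /\ 2^-1 <= coverage k w x) ->
  exists s, mean (fun x => ind U x * (failed s l x)%:R) <= mean (fun x => ind U x * (2 * b x + rho ^+ n)).
Proof.
have hWM := card_steps o0; have /andP[rho0 rho1] := decay_rate o0.
have W0 : 0 < W by rewrite ltr0n (leq_trans _ hWM).
have bmb : bmeas b by apply: bmeas_add; [exact: (local_pt_bm ml (local_pt_boundary_mass L lw))|exact: bmeas_cst].
have bmBad s : bmeas (fun x => (failed s l x)%:R).
  exact: (local_pt_bm ml (local_pt_op1 (fun c : bool => c%:R : R) (local_pt_failed s))).
have bmbad o : bmeas (fun x => (bad o l x)%:R).
  exact: (local_pt_bm ml (local_pt_op1 (fun c : bool => c%:R : R) (local_pt_bad o))).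
have bmr m : bmeas (fun x => 2 * b x + rho ^+ m).
  by apply: bmeas_add; [exact: bmeas_scale|exact: bmeas_cst].
elim: n U => [|n IH] U mU hU.
  exists [::]; apply: mean_le.
  - by apply: bmeas_mul => //; exact: bmeas_ind.
  - by apply: bmeas_mul => //; exact: bmeas_ind.
  - move=> x; rewrite ler_wpM2l ?ler0n // /= expr0 lerDr mulr_ge0 ?b_ge0 //.
(* The points on which the first step [o] leaves the decision to later steps. The induction is
   stated for arbitrary [U] so that it applies to [V o], with a continuation [s o] that depends on
   [o]. *)
pose V o := (U `&` [set x | ~~ hit o l x])%classic.
have mV o : measurable (V o).
  apply: measurableI => //.
  have := wlocal_meas ml [set false]%classic (local_pt_wlocal l (local_pt_hit o)).
  by congr measurable; apply/seteqP; split=> x; rewrite /preimage /=; case: (hit o l x).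
have VE o x : ind (V o) x = ind U x * (1 - (hit o l x)%:R) :> R.
  rewrite ind_setI; congr (_ * _); rewrite /ind.
  have -> : `[< [set x | ~~ hit o l x]%classic x >] = ~~ hit o l x by exact: asboolb.
  by case: (hit o l x); rewrite ?subrr ?subr0.
have /choice[s hs] : forall o, exists s,
    mean (fun x => ind (V o) x * (failed s l x)%:R) <= mean (fun x => ind (V o) x * (2 * b x + rho ^+ n)).
  by move=> o; apply: IH => // x [Ux _]; exact: hU.
pose F o := mean (fun x => ind U x * (failed (o :: s o) l x)%:R).
suff [c hc] : exists c, F c <= mean (fun x => ind U x * (2 * b x + rho ^+ n.+1)) by exists (c :: s c).
apply: (average_le o0).
have bU : bmeas (ind U : _ -> R) by exact: bmeas_ind.
have FE o : F o <= mean (fun x => ind U x * (bad o l x)%:R + ind (V o) x * (2 * b x + rho ^+ n)).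
  rewrite mean_add; [|exact: bmeas_mul|by apply: bmeas_mul => //; exact: bmeas_ind].
  apply: (@le_trans _ _ (mean (fun x => ind U x * (bad o l x)%:R) + mean (fun x => ind (V o) x * (failed (s o) l x)%:R))).
    rewrite -mean_add; [|exact: bmeas_mul|by apply: bmeas_mul => //; exact: bmeas_ind].
    apply: mean_le; first exact: bmeas_mul.
      by apply: bmeas_add; apply: bmeas_mul => //; exact: bmeas_ind.
    move=> x; rewrite VE /= -mulrA -mulrDr ler_wpM2l ?ler0n //.
    have := @bad_hit o G l x; case: (hit o l x); case: (bad o l x); case: (failed _ _ _) => //= h;
      rewrite ?subrr ?subr0 ?mul0r ?mulr0 ?mul1r ?addr0 ?add0r //; by have := h isT.
  by rewrite lerD2l; exact: hs.
apply: le_trans (ler_sum _ (fun o _ => FE o)) _.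
rewrite -mean_sum; last first.
  by move=> o _; apply: bmeas_add; apply: bmeas_mul => //; exact: bmeas_ind.
rewrite -/W -mean_scale; last exact: bmeas_mul.
apply: mean_le.
- by apply: bmeas_sum => o _; apply: bmeas_add; apply: bmeas_mul => //; exact: bmeas_ind.
- by apply: bmeas_scale; exact: bmeas_mul.
move=> x; under eq_bigr do rewrite VE -mulrA -mulrDr.
rewrite -mulr_sumr mulrCA /ind; case: asboolP => [Ux|_]; last by rewrite !mul0r.
rewrite !mul1r big_split /= -mulr_suml sumrB sumr_const -/W.
have [il hc] := hU x Ux.
have h1 := sum_hit il; have h2 := sum_bad x.
set Sh := \sum_o _ in h1 *; set Sb := \sum_o _ in h2 *.
have M0 : 0 < (M.+1%:R : R) by rewrite ltr0n.
have h2' : Sb <= M.+1%:R * b x by rewrite /b mulrDr [X in _ + X]mulrCA mulfV ?gt_eqF // mulr1.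
have h1' : M.+1%:R / 2 <= Sh by apply: le_trans h1; apply: ler_wpM2l hc; exact: ltW.
have hr : W * rho = W - M.+1%:R / 2.
  by rewrite /rho; field; rewrite gt_eqF.
have e0 : 0 <= 2 * b x + rho ^+ n by rewrite addr_ge0 ?mulr_ge0 ?b_ge0 ?exprn_ge0.
rewrite exprS; move: (b_ge0 x) => b0.
have r0 : 0 <= rho ^+ n by exact: exprn_ge0.
(* Bad steps cost at most [M.+1 * b x]; the steps that hit, at least [M.+1 / 2] of them, each save
   [2 * b x]. The two cancel, which explains the factor 2. *)
have : (W - Sh) * (2 * b x + rho ^+ n) <= (W - M.+1%:R / 2) * (2 * b x + rho ^+ n).
  by rewrite ler_wpM2r // lerD2l lerN2.
have -> : W * (2 * b x + rho * rho ^+ n) = W * (2 * b x) + (W * rho) * rho ^+ n by ring.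
rewrite hr => h3; apply: le_trans (lerD h2' h3) _.
have -> : M.+1%:R * b x + (W - M.+1%:R / 2) * (2 * b x + rho ^+ n) = W * (2 * b x) + (W - M.+1%:R / 2) * rho ^+ n by field.
exact: lexx.
Qed.

End Fixed.
End Rounding.

Local Open Scope fset_scope.
Local Open Scope ring_scope.

(** * Transfer of hyperfiniteness *)

Lemma fset_card_le (T : choiceType) (A : set T) (C : {fset T}) n :
  (A `<=` [set` C])%classic -> (#|` C| <= n)%N -> (A #<= `I_n)%card.
Proof.
move=> sAC Cn; apply: (card_le_trans (subset_card_le sAC)).
have h : ([set` C] #= `I_#|` C|)%card by apply/card_eq_fsetP.
by rewrite (card_le_eql h) card_le_II.
Qed.

Lemma hyperfinite_weakly_equivalent (R : realType) (d : nat) (G H : graphing R d) :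
  weakly_equivalent G H -> hyperfinite G -> hyperfinite H.
Proof.
move=> we hG eps eps0.
(* The error terms below add up to [12 * e], so one sixteenth of [eps] leaves a strict margin. *)
pose e : R := eps / 16.
have e0 : 0 < e by rewrite divr_gt0.
have d0 : 0 < (d.+1%:R ^+ 2 : R) by rewrite exprn_gt0.
(* The measure of the cut absorbs the factor [d.+1 ^ 2] of [fractional_partition]. *)
have [k [l [ml hl hc]]] := hyperfinite_cluster hG (divr_gt0 e0 d0).
have [w [lw w01 hcov hbd]] := fractional_partition e0 ml hc.
have {hl}hbd : mean (fun x : gr_space G => boundary_mass k w x) <= e + e.
  apply: le_trans hbd _; rewrite lerD2l mulrC -ler_pdivlMr //; exact: ltW.
have covE : mean (fun x : gr_space G => (coverage k w x - 1) ^+ 2) = mean (fun x : gr_space H => (coverage k w x - 1) ^+ 2).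
  apply: (transfer we (f := fun K x => (coverage k w x - 1) ^+ 2)).
  exact: (local_pt_ulocal (local_pt_op1 (fun r : R => (r - 1) ^+ 2) (local_pt_coverage unit lw))).
have bdE : mean (fun x : gr_space G => boundary_mass k w x) = mean (fun x : gr_space H => boundary_mass k w x).
  apply: (transfer we (f := fun K x => boundary_mass k w x)).
  exact: (local_pt_ulocal (local_pt_boundary_mass unit lw)).
rewrite covE in hcov; rewrite bdE in hbd.
have [N hN] := lowcolor_large H (k + k) e0.
pose D1 : R := (d.+1 ^ k.+1)%:R * ((2 ^ (d.+1 ^ k))%:R * 1).
have D10 : 0 <= D1 by rewrite !mulr_ge0 ?ler0n.
have [M hM] : exists M : nat, D1 / M.+1%:R <= e.
  exists (Num.bound (D1 / e)); rewrite ler_pdivrMr ?ltr0n // mulrC -ler_pdivrMr //.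
  apply: le_trans (ltW (archi_boundP _)) _; first by rewrite divr_ge0 // ltW.
  by rewrite ler_nat.
(* Two vertices of a ball of radius [k + k] may be twice that far apart, hence the colouring
   radius. *)
pose lc := @trunc_color R d H ((k + k) + (k + k)) N.
have mlc : forall a, measurable [set x | lc x = a]%classic by exact: meas_trunc_color.
pose o0 : ('I_N.+1 * {set 'I_N.+1}) * 'I_M.+1 := ((ord0, finset.set0), ord0).
have /andP[rho0 rho1] := decay_rate R o0.
set rho := (1 - _) in rho0 rho1.
have [n hn] : exists n, rho ^+ n < e.
  have nr : `|rho| < 1 by rewrite ger0_norm.
  have [n _ h] := cvgr0_norm_lt _ (cvg_expr nr) _ e0.
  exists n; have := h n (leqnn n); rewrite /= ger0_norm //; exact: exprn_ge0.
(* The points where rounding applies; its complement is put into [Z] outright. *)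
pose U := (lowcolor (k + k) N `&` [set x : gr_space H | 2^-1 <= coverage k w x])%classic.
have lcov := local_pt_coverage 'I_N.+1 lw.
have mU : measurable U.
  apply: measurableI; first exact: meas_lowcolor.
  exact: (wlocal_meas mlc [set r : R | 2^-1 <= r]%classic (local_pt_wlocal lc lcov)).
have hU x : U x -> {in gball (k + k) x &, injective lc} /\ 2^-1 <= coverage k w x.
  by move=> [h1 h2]; split=> //; exact: lowcolor_inj h1.
have [s hs] := rounding lw w01 mlc o0 n mU hU.
have mB : measurable [set x | failed k w s lc x]%classic.
  have := wlocal_meas mlc [set true]%classic (local_pt_wlocal lc (local_pt_failed lw s)).
  by congr measurable; apply/seteqP; split=> x.
pose Z := ([set x | failed k w s lc x] `|` ~` U)%classic.
have mZ : measurable Z by apply: measurableU => //; exact: measurableC.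
exists (d.+1 ^ k)%N, Z; split=> //; first by rewrite expn_gt0.
- rewrite -(fineK (fin_num_measure _ _ mZ)) lte_fin -mean_ind //.
  have bmbd : bmeas (fun x : gr_space H => boundary_mass k w x) by exact: (local_pt_bm mlc (local_pt_boundary_mass _ lw)).
  have bmcov : bmeas (fun x : gr_space H => (coverage k w x - 1) ^+ 2).
    exact: (local_pt_bm mlc (local_pt_op1 (fun r : R => (r - 1) ^+ 2) lcov)).
  have bmBad : bmeas (fun x => (failed k w s lc x)%:R : R).
    exact: (local_pt_bm mlc (local_pt_op1 (fun c : bool => c%:R : R) (local_pt_failed lw s))).
  have bU : bmeas (ind U : _ -> R) by exact: bmeas_ind.
  have mlow := meas_lowcolor H (k + k) N.
  have bl : bmeas (ind (~` lowcolor (k + k) N)%classic : gr_space H -> R) by apply: bmeas_ind; exact: measurableC.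
  have b1 : bmeas (fun x => ind U x * (failed k w s lc x)%:R) by exact: bmeas_mul.
  have b2 : bmeas (fun x : gr_space H => boundary_mass k w x + D1 / M.+1%:R) by apply: bmeas_add => //; exact: bmeas_cst.
  have b3 : bmeas (fun x : gr_space H => 2 * (boundary_mass k w x + D1 / M.+1%:R) + rho ^+ n).
    by apply: bmeas_add; [exact: bmeas_scale|exact: bmeas_cst].
  (* Where coverage is below 1/2 its squared defect exceeds 1/4: Chebyshev's inequality with the
     factor 4. *)
  have h1 : mean (ind Z) <= mean (fun x => ind U x * (failed k w s lc x)%:R) +
      mean (ind (~` lowcolor (k + k) N)%classic : gr_space H -> R) + 4 * mean (fun x : gr_space H => (coverage k w x - 1) ^+ 2).
    rewrite -mean_scale // -mean_add // -mean_add; [|exact: bmeas_add|exact: bmeas_scale].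
    apply: mean_le; first exact: bmeas_ind.
      by apply: bmeas_add; [exact: bmeas_add|exact: bmeas_scale].
    move=> x; have sq := sqr_ge0 (coverage k w x - 1).
    have [Ux|nU] := pselect (U x).
      have -> : ind U x = 1 :> R by rewrite /ind; case: asboolP.
      have -> : ind Z x = (failed k w s lc x)%:R :> R.
        rewrite /ind; congr (nat_of_bool _)%:R; apply/asboolP/idP; last by left.
        by move=> [].
      have i0 : 0 <= ind (~` lowcolor (k + k) N)%classic x :> R by rewrite ler0n.
      by lra.
    have -> : ind U x = 0 :> R by rewrite /ind; case: asboolP.
    have z1 : ind Z x <= 1 :> R by rewrite /ind lern1 leq_b1.
    rewrite mul0r add0r; apply: le_trans z1 _.
    have [lo|nlo] := pselect (lowcolor (k + k) N x).
      have i0 : 0 <= ind (~` lowcolor (k + k) N)%classic x :> R by rewrite ler0n.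
      have : ~ (2^-1 <= coverage k w x) by move=> h; apply: nU.
      by move=> /negP; rewrite -ltNge => hh; nra.
    have -> : ind (~` lowcolor (k + k) N)%classic x = 1 :> R by rewrite /ind; case: asboolP.
    by lra.
  have h2 : mean (fun x => ind U x * (failed k w s lc x)%:R) <=
      2 * (mean (fun x : gr_space H => boundary_mass k w x) + D1 / M.+1%:R) + rho ^+ n.
    have -> : 2 * (mean (fun x : gr_space H => boundary_mass k w x) + D1 / M.+1%:R) + rho ^+ n =
        mean (fun x : gr_space H => 2 * (boundary_mass k w x + D1 / M.+1%:R) + rho ^+ n).
      rewrite mean_add; [|exact: bmeas_scale|exact: bmeas_cst].
      by rewrite mean_scale // mean_add ?mean_cst //; exact: bmeas_cst.
    apply: le_trans hs _; apply: mean_le; [by apply: bmeas_mul; [|exact: b3]|exact: b3|].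
    move=> x; rewrite /ind; case: asboolP => _; rewrite ?mul1r // mul0r.
    have h := @b_ge0 R d k w M w01 H x; rewrite addr_ge0 ?mulr_ge0 //; exact: exprn_ge0.
  have e16 : eps = 16 * e by rewrite /e mulrCA mulfV ?mulr1.
  have h3 : mean (ind Z) <= (2 * ((e + e) + e) + e) + e + 4 * e.
    apply: le_trans h1 _; apply: lerD; last by rewrite ler_wpM2l.
    apply: lerD; last exact: ltW.
    apply: le_trans h2 _; apply: lerD; last exact: ltW.
    by rewrite ler_wpM2l // lerD.
  apply: le_lt_trans h3 _; rewrite e16; clear -e0; clearbody e; lra.
- move=> x; set E := edge_rel _.
  have step_ u v : E u v -> [/\ v \in nb u, ~ Z u & ~ Z v].
    move=> /set_mem[/= e1 e2]; split; first by apply/in_nb; right.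
      by move=> zu; apply: e2; left.
    by move=> zv; apply: e2; right.
  (* A vertex of [Z] has lost all its edges and is its own component; from any other vertex,
     remaining paths avoid [Z] and [failed_cluster] confines them. *)
  have [Zx|nZx] := pselect (Z x).
    apply: (@fset_card_le _ _ [fset x]); last by rewrite cardfs1 expn_gt0.
    by move=> y [[|a p] /=]; [move=> _ <-; rewrite /= inE|move=> /andP[/step_[]]].
  have [C [cC hC]] : exists C : {fset gr_space H}, (#|` C| <= d.+1 ^ k)%N /\
      forall p, path (fun u v => v \in nb u) x p -> all (fun y => ~~ failed k w s lc y) p -> last x p \in C.
    by apply: failed_cluster; apply/negP => h; apply: nZx; left.
  apply: (fset_card_le _ cC) => y [p pp <-]; apply: hC.
    by apply: sub_path pp => u v /step_[].
  elim: p x {nZx} pp => //= a p IH x /andP[/step_[_ _ nZ] pp].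
  rewrite (IH a) // andbT; apply/negP => h; apply: nZ; by left.
Qed.

Theorem theorem2 (R : realType) (d : nat) (hd : (1 <= d)%N)
    (G H : graphing R d) (hGH : weakly_equivalent G H) :
  hyperfinite H <-> hyperfinite G.
Proof.
split; apply: hyperfinite_weakly_equivalent => // r alpha r1.
by rewrite hGH.
Qed.
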